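(* There is a polynomial-time algorithm for Stochastic Matching on general (not necessarily bipartite) graphs whose approximation ratio is at least $0.269$. That is, on every instance the expected weight of the constructed matching is at least $0.269\cdot\mathbb{E}[\mathrm{OPT}]$.
   Context: Stochastic Matching. An instance consists of: - an undirected graph $G=(V,E)$; - for each edge $e$, a probability $p_e\in(0,1]$ and a weight $w_e\ge 0$; - for each vertex $v$, a positive integer timeout $t_v$. Each edge $e$ exists independently with probability $p_e$, and its existence is revealed only by probing it. A probing strategy probes edges one at a time and may choose the next edge adaptively. It must obey these rules: - each edge is probed at most once; - an edge may be probed only if neither of its endpoints is already matched; - if a probed edge exists, it is irrevocably added to the matching; - for every vertex $v$, at most $t_v$ of the edges incident to $v$ are probed. The value of a strategy is the expected total weight of the matching it constructs, and $\mathrm{OPT}$ denotes an optimal strategy. An algorithm has approximation ratio at least $\alpha$ if, on every instance, its expected matching weight is at least $\alpha\,\mathbb{E}[\mathrm{OPT}]$. *)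

(* Defs.v *)
(* Stochastic Matching, probing strategies, and a
   randomized logarithmic-cost RAM with a probe oracle (to express
   "polynomial-time algorithm").  All quantities are rationals. *)
From mathcomp Require Import all_boot all_order all_algebra.
Set Implicit Arguments. Unset Strict Implicit. Unset Printing Implicit Defensive.
Import Order.TTheory GRing.Theory Num.Theory.
Local Open Scope ring_scope.

(* Instances: vertices 0..nV-1, edges indexed 0..m-1 (m = size edges). *)
Record instance := Instance {
  nV    : nat;
  edges : seq (nat * nat);
  prob  : seq rat;
  wt    : seq rat;
  tmo   : seq nat
}.

Definition nE (I : instance) : nat := size (edges I).
Definition ends (I : instance) (e : nat) : nat * nat := nth (0%N, 0%N) (edges I) e.
Definition p_ (I : instance) (e : nat) : rat := nth 0 (prob I) e.
Definition w_ (I : instance) (e : nat) : rat := nth 0 (wt I) e.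
Definition t_ (I : instance) (v : nat) : nat := nth 0%N (tmo I) v.

Definition upair (uv : nat * nat) : nat * nat := (minn uv.1 uv.2, maxn uv.1 uv.2).

Definition wf_instance (I : instance) : bool :=
  [&& size (prob I) == nE I, size (wt I) == nE I, size (tmo I) == nV I,
      all (fun uv => [&& (uv.1 < nV I)%N, (uv.2 < nV I)%N & uv.1 != uv.2]) (edges I),
      uniq (map upair (edges I)),
      all (fun p => (0 < p) && (p <= 1)) (prob I),
      all (fun w => 0 <= w) (wt I) &
      all (fun t => (0 < t)%N) (tmo I)].

(* Probing histories: chronological list of (edge probed, outcome).    *)
Definition history := seq (nat * bool).

Definition incident (I : instance) (v e : nat) : bool :=
  ((ends I e).1 == v) || ((ends I e).2 == v).

Definition matched (I : instance) (h : history) (v : nat) : bool :=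
  has (fun x => x.2 && incident I v x.1) h.

Definition nprobed (I : instance) (h : history) (v : nat) : nat :=
  count (fun x => incident I v x.1) h.

Definition legal_probe (I : instance) (h : history) (e : nat) : bool :=
  let u := (ends I e).1 in let v := (ends I e).2 in
  [&& (e < nE I)%N, e \notin map fst h,
      ~~ matched I h u, ~~ matched I h v,
      (nprobed I h u < t_ I u)%N & (nprobed I h v < t_ I v)%N].

Definition legal_history (I : instance) (h : history) : bool :=
  all (fun i => legal_probe I (take i h) (nth (0%N, false) h i).1) (iota 0 (size h)).

Definition hvalue (I : instance) (h : history) : rat :=
  \sum_(x <- h | x.2) w_ I x.1.

(* A realization: which edges exist (bit e of r).  Its probability. *)
Definition real_prob (I : instance) (r : seq bool) : rat :=
  \prod_(e < nE I) (if nth false r e then p_ I e else 1 - p_ I e).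

(* (Deterministic, adaptive) probing strategies: next edge to probe as a
   function of the history, or None to stop.  A valid strategy probes at
   most nE edges (each at most once), so nE+1 rounds capture its run.  *)
Definition strategy := history -> option nat.

Fixpoint run_strat (S : strategy) (r : seq bool) (fuel : nat) (h : history) : history :=
  match fuel with
  | 0%N => h
  | f.+1 => match S h with
            | None => h
            | Some e => run_strat S r f (rcons h (e, nth false r e))
            end
  end.

Definition strat_hist (I : instance) (S : strategy) (r : seq bool) : history :=
  run_strat S r (nE I).+1 [::].

Definition valid_strategy (I : instance) (S : strategy) : Prop :=
  forall r : (nE I).-tuple bool, legal_history I (strat_hist I S r).

Definition strat_value (I : instance) (S : strategy) : rat :=
  \sum_(r : (nE I).-tuple bool) real_prob I r * hvalue I (strat_hist I S r).

Inductive instr :=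
  | IConst of nat & nat          (* R[i] := c *)
  | IAdd of nat & nat & nat      (* R[i] := R[j] + R[k] *)
  | ISub of nat & nat & nat      (* R[i] := R[j] - R[k] (truncated) *)
  | ILoad of nat & nat           (* R[i] := R[R[j]] *)
  | IStore of nat & nat          (* R[R[i]] := R[j] *)
  | IJz of nat & nat             (* if R[i] = 0 then goto l *)
  | ICoin of nat                 (* R[i] := fair random bit *)
  | IProbe of nat & nat          (* probe edge R[i]; R[j] := outcome *)
  | IHalt.

Definition program := seq instr.

Record mstate := MState {
  pc : nat; mem : nat -> nat; mhist : history; ncoin : nat; mcost : nat }.

Definition bl (x : nat) : nat := (trunc_log 2 x).+1.

Definition upd (m : nat -> nat) (a v : nat) : nat -> nat :=
  fun b => if b == a then v else m b.

Definition b2n (b : bool) : nat := if b then 1%N else 0%N.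

Definition step (i : instr) (r : seq bool) (coins : nat -> bool) (s : mstate) : mstate :=
  let R := mem s in
  let nx := (pc s).+1 in
  match i with
  | IConst a c => MState nx (upd R a c) (mhist s) (ncoin s)
                    (mcost s + 1 + bl a + bl c)
  | IAdd a j k => MState nx (upd R a (R j + R k)) (mhist s) (ncoin s)
                    (mcost s + 1 + bl a + bl j + bl k + bl (R j) + bl (R k))
  | ISub a j k => MState nx (upd R a (R j - R k)) (mhist s) (ncoin s)
                    (mcost s + 1 + bl a + bl j + bl k + bl (R j) + bl (R k))
  | ILoad a j => MState nx (upd R a (R (R j))) (mhist s) (ncoin s)
                    (mcost s + 1 + bl a + bl j + bl (R j) + bl (R (R j)))
  | IStore a j => MState nx (upd R (R a) (R j)) (mhist s) (ncoin s)
                    (mcost s + 1 + bl a + bl j + bl (R a) + bl (R j))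
  | IJz a l => MState (if R a == 0%N then l else nx) R (mhist s) (ncoin s)
                    (mcost s + 1 + bl a + bl (R a))
  | ICoin a => MState nx (upd R a (b2n (coins (ncoin s)))) (mhist s) (ncoin s).+1
                    (mcost s + 1 + bl a)
  | IProbe a j => let e := R a in let o := nth false r e in
                  MState nx (upd R j (b2n o)) (rcons (mhist s) (e, o)) (ncoin s)
                    (mcost s + 1 + bl a + bl j + bl e)
  | IHalt => s
  end.

Fixpoint exec (P : program) (r : seq bool) (coins : nat -> bool) (fuel : nat)
  (s : mstate) : option mstate :=
  match fuel with
  | 0%N => None
  | f.+1 => match nth IHalt P (pc s) with
            | IHalt => Some s
            | i => exec P r coins f (step i r coins s)
            end
  end.

Definition enc_rat (q : rat) : seq nat := [:: `|numq q|%N; `|denq q|%N].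

Definition encode (I : instance) : seq nat :=
  [:: nV I; nE I] ++
  flatten [seq [:: (ends I e).1; (ends I e).2] ++ enc_rat (p_ I e) ++ enc_rat (w_ I e)
          | e <- iota 0 (nE I)] ++
  tmo I.

Definition input_size (I : instance) : nat := \sum_(x <- encode I) bl x.

Definition init_state (I : instance) : mstate :=
  MState 0 (fun a => nth 0%N (encode I) a) [::] 0 0.

Definition run_alg (P : program) (I : instance) (r : seq bool) (coins : nat -> bool)
  (B : nat) : option mstate := exec P r coins B.+1 (init_state I).

Definition good_run (P : program) (I : instance) (r : seq bool) (coins : nat -> bool)
  (B : nat) : Prop :=
  match run_alg P I r coins B with
  | Some s => (mcost s <= B)%N /\ legal_history I (mhist s)
  | None => False
  end.

Definition run_value (P : program) (I : instance) (r : seq bool) (coins : nat -> bool)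
  (B : nat) : rat :=
  match run_alg P I r coins B with
  | Some s => hvalue I (mhist s)
  | None => 0
  end.

(* expected matching weight; a run of cost <= B uses < B coins, so
   averaging over B fair coins is exact *)
Definition alg_value (P : program) (I : instance) (B : nat) : rat :=
  \sum_(r : (nE I).-tuple bool) real_prob I r *
    ((2%:R ^+ B)^-1 * \sum_(cs : B.-tuple bool) run_value P I r (fun n => nth false cs n) B).

(* Main.v *)
(** An LP with one variable per edge bounds every strategy: the probabilities [x_e]
    that it probes [e] satisfy the matching constraints [sum p_e x_e <= 1] and the
    timeout constraints [sum x_e <= t_v], and its value is [sum w_e p_e x_e].  The
    program solves this LP up to a factor [255/256] by an integral subgradient method:
    multipliers at the vertices rise with the violated constraints, and an edge is
    selected whenever its weight exceeds its price.

    It then runs 1000 rounds over all the edges, in each of which an edge is probed, if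
    this is still legal, with probability [x_e/1024].  Small rounds simulate a uniformly
    random order of the edges: up to round [k] an endpoint of [e] stays available with
    probability at least that of [t_v] Poisson-like arrivals not being exceeded, and the
    resulting sum over the rounds is a Riemann sum whose value is checked by fixed-point
    arithmetic.  It exceeds [277/1024], and [277/1024 * 255/256 > 0.269]. *)
Require Import Defs.
From Stdlib Require Import ZArith.
From mathcomp Require Import all_boot all_order all_algebra zify ring lra ssrZ.
Set Implicit Arguments. Unset Strict Implicit. Unset Printing Implicit Defensive.
Import Order.TTheory GRing.Theory Num.Theory.

(** The subgradient solution overshoots its constraints by a factor [1 + 2/h], [h = 512]. It is
    never repaired: the overshoot goes into [d = (1 + 2/h)/(2h)], the load that one round may put on
    a vertex, and only the loss [1 - 2/h] in value is paid. In the analysis of an edge [e], every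
    arrival of another edge at an endpoint counts as a probe, legal or not, and must not exist. This
    only lowers the estimate, and it decouples the endpoints: the graph is simple, so the arrivals
    at the two ends are independent and their survival probabilities multiply. The tension lies in
    [x_e]. If it is large, [e] has probably arrived in an earlier round; if it is small, the other
    edges may use up nearly the whole timeout of its endpoints. Splitting at [x_e = 1/2] gives two
    sums over the rounds, both at least 277. On the machine side, a step at most doubles the largest
    number in memory, so a polynomial number of steps already implies polynomial logarithmic cost.
    All precisions are powers of two, multiplication and division are programmed, and the LP phase
    uses no randomness, so one fixed LP solution serves all coins and realizations. *)

Module Machine.
Local Open Scope nat_scope.
Notation rmem := Defs.mem.

(** * Runs of the machine and their logarithmic cost *)

Section Reach.
Variables (P : program) (r : seq bool) (coins : nat -> bool).

Definition is_halt (i : instr) : bool := if i is IHalt then true else false.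

(** Halting is not a step, so the index counts executed instructions and [exec] needs just one more
    unit of fuel. *)
Inductive reach : nat -> mstate -> mstate -> Prop :=
| reach0 s : reach 0 s s
| reachS k s s' : is_halt (nth IHalt P (pc s)) = false ->
    reach k (step (nth IHalt P (pc s)) r coins s) s' -> reach k.+1 s s'.

Lemma reach_trans a b s1 s2 s3 : reach a s1 s2 -> reach b s2 s3 -> reach (a + b) s1 s3.
Proof. by elim=> [//|k s s' H1 _ IH] /IH; apply: reachS. Qed.

Lemma exec_reach k s s' f : reach k s s' -> nth IHalt P (pc s') = IHalt -> k < f ->
  exec P r coins f s = Some s'.
Proof.
move=> H; elim: H f => [{}s|{}k {}s {}s' Hh _ IH] [//|f] Hs' Hf /=; first by rewrite Hs'.
by have := IH f Hs' Hf; case: (nth IHalt P (pc s)) Hh.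
Qed.

Definition opmax (i : instr) : nat :=
  match i with
  | IConst a c => maxn a c
  | IAdd a j k | ISub a j k => maxn a (maxn j k)
  | ILoad a j | IStore a j | IProbe a j => maxn a j
  | IJz a l => a
  | ICoin a => a
  | IHalt => 0
  end.

Lemma bl_le x b : x <= 2 ^ b -> bl x <= b.+1.
Proof.
move=> H; rewrite /bl ltnS; case: (posnP x) => [->|x0]; first by rewrite trunc_log0.
by rewrite -(@leq_exp2l 2) //; apply: leq_trans H; apply: trunc_logP.
Qed.

(** An addition at most doubles the largest value, hence the exponent of the memory bound grows by
    one per step; no instruction is charged more than five logarithms. *)
Lemma step_cost i s b : is_halt i = false -> opmax i <= 2 ^ b ->
    (forall a, rmem s a <= 2 ^ b) ->
  mcost (step i r coins s) <= mcost s + (1 + 5 * b.+1) /\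
  (forall a, rmem (step i r coins s) a <= 2 ^ b.+1).
Proof.
have le1 : 1 <= 2 ^ b by rewrite expn_gt0.
have E : 2 ^ b.+1 = 2 ^ b + 2 ^ b by rewrite expnS mul2n addnn.
case: i => [a c|a j k|a j k|a j|a j|a l|a|a j|] //= _ Ho Hm; split;
  try (move=> a'; rewrite /upd; case: eqP => _; move: (Hm a') => Ha'; rewrite E);
  rewrite ?geq_max in Ho; try (case/andP: Ho => Ho1 Ho2);
  try (case/andP: Ho2 => Ho2 Ho3); try lia.
- have := bl_le Ho1; have := bl_le Ho2; lia.
- have := bl_le Ho1; have := bl_le Ho2; have := bl_le Ho3.
  have := bl_le (Hm j); have := bl_le (Hm k); lia.
- have := Hm j; have := Hm k; lia.
- have := bl_le Ho1; have := bl_le Ho2; have := bl_le Ho3.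
  have := bl_le (Hm j); have := bl_le (Hm k); lia.
- have := Hm j; have := Hm k; lia.
- have := bl_le Ho1; have := bl_le Ho2.
  have := bl_le (Hm j); have := bl_le (Hm (rmem s j)); lia.
- have := Hm (rmem s j); lia.
- have := bl_le Ho1; have := bl_le Ho2.
  have := bl_le (Hm j); have := bl_le (Hm a); lia.
- have := Hm j; lia.
- have := bl_le Ho; have := bl_le (Hm a); lia.
- move=> a'; have := Hm a'; lia.
- have := bl_le Ho; lia.
- case: (coins _) => /=; lia.
- have := bl_le Ho1; have := bl_le Ho2; have := bl_le (Hm a); lia.
- case: (nth _ _ _) => /=; lia.
Qed.

(** Iterating [step_cost], the exponent never exceeds [b + k]. From here on it is enough to count
    steps; the size of intermediate values need not be followed. *)
Lemma reach_cost k s s' b : reach k s s' -> all (fun i => opmax i <= 2 ^ b) P ->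
    (forall a, rmem s a <= 2 ^ b) ->
  mcost s' <= mcost s + k * (1 + 5 * (b + k)).
Proof.
move=> H; elim: H b => [{}s|{}k {}s {}s' Hh _ IH] b HP Hm; first by rewrite mul0n addn0.
have Hi : opmax (nth IHalt P (pc s)) <= 2 ^ b.
  case: (ltnP (pc s) (size P)) => Hp; last by rewrite nth_default.
  by have /(all_nthP IHalt) := HP; apply.
have [H1 H2] := step_cost Hh Hi Hm.
have HP' : all (fun i => opmax i <= 2 ^ b.+1) P.
  by apply: sub_all HP => i /leq_trans; apply; rewrite leq_exp2l.
by have := IH _ HP' H2; nia.
Qed.

Lemma reach_ncoin k s s' : reach k s s' -> ncoin s' <= ncoin s + k.
Proof.
elim=> [{}s|{}k {}s {}s' Hh _ IH]; first by rewrite addn0.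
by apply: (leq_trans IH); case: (nth _ _ _) => /=; lia.
Qed.

End Reach.

(** * A structured language with scalar variables and arrays *)

Inductive cmd :=
| CSkip
| CConst of nat & nat
| CAdd of nat & nat & nat
| CSub of nat & nat & nat
| CLoad of nat & nat & nat
| CStore of nat & nat & nat
| CCoin of nat
| CProbe of nat & nat
| CSeq of cmd & cmd
| CIf of nat & cmd & cmd
| CWhile of nat & cmd.

(* Cell [k] of array [j < 16]; the scalars are array 0 and the input is array 1.
   Cells 0 and 1 of the machine are scratch space for address computations. *)
Definition aa (j k : nat) : nat := 16 * k + j + 2.
Definition va (x : nat) : nat := aa 0 x.

(** Four doublings leave 16 times the index in cell 0, and adding [j + 2] yields the address
    [aa j k]. *)
Definition addr_code (j y : nat) : seq instr :=
  [:: IAdd 0 (va y) (va y); IAdd 0 0 0; IAdd 0 0 0; IAdd 0 0 0;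
      IConst 1 (j + 2); IAdd 0 0 1].

(** Jumps are absolute, hence the parameter [off], the address at which the code will lie.
    [IConst 0 0] followed by [IJz 0] is an unconditional jump; it accounts for the two extra steps
    of [runs] after a taken branch and after a loop body. *)
Fixpoint comp (off : nat) (c : cmd) : seq instr :=
  match c with
  | CSkip => [::]
  | CConst x k => [:: IConst (va x) k]
  | CAdd x y z => [:: IAdd (va x) (va y) (va z)]
  | CSub x y z => [:: ISub (va x) (va y) (va z)]
  | CLoad x j y => addr_code j y ++ [:: ILoad (va x) 0]
  | CStore j x y => addr_code j x ++ [:: IStore 0 (va y)]
  | CCoin x => [:: ICoin (va x)]
  | CProbe x y => [:: IProbe (va x) (va y)]
  | CSeq c1 c2 => let l1 := comp off c1 in l1 ++ comp (off + size l1) c2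
  | CIf x c1 c2 =>
      let l1 := comp off.+1 c1 in
      let o2 := off + size l1 + 3 in
      let l2 := comp o2 c2 in
      IJz (va x) o2 :: l1 ++ [:: IConst 0 0; IJz 0 (o2 + size l2)] ++ l2
  | CWhile x c1 =>
      let l1 := comp off.+1 c1 in
      IJz (va x) (off + size l1 + 3) :: l1 ++ [:: IConst 0 0; IJz 0 off]
  end.

Record hst := HSt { hm : nat -> nat -> nat; hh : history; hc : nat }.

Definition setm (s : hst) (j k v : nat) : hst :=
  HSt (fun j' k' => if (j' == j) && (k' == k) then v else hm s j' k') (hh s) (hc s).

Section Semantics.
Variables (r : seq bool) (coins : nat -> bool).

Inductive runs : cmd -> hst -> nat -> hst -> Prop :=
| RSkip s : runs CSkip s 0 s
| RConst x k s : runs (CConst x k) s 1 (setm s 0 x k)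
| RAdd x y z s : runs (CAdd x y z) s 1 (setm s 0 x (hm s 0 y + hm s 0 z))
| RSub x y z s : runs (CSub x y z) s 1 (setm s 0 x (hm s 0 y - hm s 0 z))
| RLoad x j y s : runs (CLoad x j y) s 7 (setm s 0 x (hm s j (hm s 0 y)))
| RStore j x y s : runs (CStore j x y) s 7 (setm s j (hm s 0 x) (hm s 0 y))
| RCoin x s : runs (CCoin x) s 1
    (let s1 := setm s 0 x (b2n (coins (hc s))) in HSt (hm s1) (hh s) (hc s).+1)
| RProbe x y s : runs (CProbe x y) s 1
    (let e := hm s 0 x in let o := nth false r e in
     let s1 := setm s 0 y (b2n o) in HSt (hm s1) (rcons (hh s) (e, o)) (hc s))
| RSeq c1 c2 s k1 s1 k2 s2 : runs c1 s k1 s1 -> runs c2 s1 k2 s2 ->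
    runs (CSeq c1 c2) s (k1 + k2) s2
| RIfT x c1 c2 s k s' : hm s 0 x != 0 -> runs c1 s k s' -> runs (CIf x c1 c2) s (1 + k + 2) s'
| RIfF x c1 c2 s k s' : hm s 0 x = 0 -> runs c2 s k s' -> runs (CIf x c1 c2) s (1 + k) s'
| RWhileF x c1 s : hm s 0 x = 0 -> runs (CWhile x c1) s 1 s
| RWhileT x c1 s k1 s1 k2 s2 : hm s 0 x != 0 -> runs c1 s k1 s1 ->
    runs (CWhile x c1) s1 k2 s2 -> runs (CWhile x c1) s (1 + k1 + 2 + k2) s2.

Fixpoint okc (c : cmd) : bool :=
  match c with
  | CLoad _ j _ | CStore j _ _ => 0 < j < 16
  | CSeq c1 c2 | CIf _ c1 c2 => okc c1 && okc c2
  | CWhile _ c1 => okc c1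
  | _ => true
  end.

(** Every [aa j k] is at least 2, so the scratch cells 0 and 1 are outside the relation and address
    computations preserve it. *)
Definition rel (s : hst) (st : mstate) : Prop :=
  [/\ forall j k, j < 16 -> rmem st (aa j k) = hm s j k, mhist st = hh s & ncoin st = hc s].

Definition codeat (P : program) (off : nat) (l : seq instr) : Prop :=
  forall i, i < size l -> nth IHalt P (off + i) = nth IHalt l i.

Lemma codeat_cat P off l1 l2 : codeat P off (l1 ++ l2) ->
  codeat P off l1 /\ codeat P (off + size l1) l2.
Proof.
move=> H; split=> i Hi.
  by rewrite H ?size_cat ?nth_cat ?Hi //; lia.
by rewrite -addnA H ?size_cat ?nth_cat; [rewrite ltnNge leq_addr /= addKn | lia].
Qed.

Lemma codeat_cons P off i l : codeat P off (i :: l) ->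
  nth IHalt P off = i /\ codeat P off.+1 l.
Proof.
move=> H; split; first by have := H 0 isT; rewrite addn0.
by move=> k Hk; rewrite addSnnS (H k.+1).
Qed.

Lemma rel_setm s m h n c x pc' j k v : j < 16 -> rel s (MState pc' m h n c) ->
  rel (setm s j k v) (MState x (upd m (aa j k) v) h n c).
Proof.
move=> Hj [/= H1 H2 H3]; split=> //= j' k' Hj'; rewrite /upd.
have -> : (aa j' k' == aa j k) = (j' == j) && (k' == k) by rewrite /aa; lia.
by case: ifP => // _; apply: H1.
Qed.

Lemma mem_addr_code P st off j y : codeat P off (addr_code j y) -> pc st = off ->
  exists st', [/\ reach P r coins 6 st st', pc st' = off + 6, rmem st' 0 = aa j (rmem st (va y)),
    forall a, 1 < a -> rmem st' a = rmem st a & mhist st' = mhist st /\ ncoin st' = ncoin st].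
Proof.
case: st => p m h n c /codeat_cons [A1] /codeat_cons [A2] /codeat_cons [A3].
case/codeat_cons=> [A4] /codeat_cons [A5] /codeat_cons [A6 _] /= Hp; subst p.
eexists; split.
  apply: reachS; rewrite /= A1 //=; apply: reachS; rewrite /= A2 //=.
  apply: reachS; rewrite /= A3 //=; apply: reachS; rewrite /= A4 //=.
  apply: reachS; rewrite /= A5 //=; apply: reachS; rewrite /= A6 //=.
  exact: reach0.
- by rewrite /=; lia.
- by rewrite /= /upd /= /aa; lia.
- by move=> a Ha /=; rewrite /upd; case: a Ha => [|[|a]].
- by [].
Qed.

(** Induction on the run and not on the command: the [while] case then has a hypothesis for its
    remaining iterations. The index of [runs] is exactly the number of machine steps. *)
Lemma comp_correct P c s k s' : runs c s k s' -> okc c ->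
  forall off st, codeat P off (comp off c) -> pc st = off -> rel s st ->
  exists st', [/\ reach P r coins k st st', pc st' = off + size (comp off c) & rel s' st'].
Proof.
have one (i : instr) off st (s1 : hst) :
    codeat P off [:: i] -> pc st = off -> is_halt i = false ->
    pc (step i r coins st) = off.+1 -> rel s1 (step i r coins st) ->
    exists st', [/\ reach P r coins 1 st st', pc st' = off + 1 & rel s1 st'].
  case/codeat_cons => H _ Hp Hi Hpc Hr; exists (step i r coins st).
  split=> //; last by rewrite Hpc addn1.
  by apply: reachS; rewrite Hp H //; apply: reach0.
elim=> {c s k s'}.
- by move=> s _ off st _ Hp Hr; exists st; split; [apply: reach0|rewrite addn0|].
- move=> x k s _ off [p m h n c] Hc /= Hp Hr; apply: (one _ _ _ _ Hc) => //=; first by rewrite Hp.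
  exact: rel_setm Hr.
- move=> x y z s _ off [p m h n c] Hc /= Hp Hr; apply: (one _ _ _ _ Hc) => //=; first by rewrite Hp.
  by case: (Hr) => /= Hm _ _; rewrite !Hm //; apply: rel_setm Hr.
- move=> x y z s _ off [p m h n c] Hc /= Hp Hr; apply: (one _ _ _ _ Hc) => //=; first by rewrite Hp.
  by case: (Hr) => /= Hm _ _; rewrite !Hm //; apply: rel_setm Hr.
- move=> x j y s /= /andP[_ Hj] off st /(@codeat_cat _ _ (addr_code j y)) [Hc1 Hc2] Hp Hr.
  have [[p1 m1 h1 n1 c1] [/= R1 Hp1 H0 Hm [Hh1 Hn1]]] := mem_addr_code Hc1 Hp.
  case: Hr => Hr1 Hr2 Hr3.
  have Hr' : rel s (MState p1 m1 h1 n1 c1).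
    by split=> /= [j' k' Hj'||]; rewrite ?Hm ?Hh1 ?Hn1 ?Hr1 // /aa; lia.
  have := @one _ _ (MState p1 m1 h1 n1 c1) (setm s 0 x (hm s j (hm s 0 y))) Hc2 Hp1; case=> //=; first by rewrite Hp1.
    have -> : m1 (m1 0) = hm s j (hm s 0 y).
      by rewrite H0 (Hr1 0) // Hm ?Hr1 // /aa; lia.
    exact: rel_setm Hr'.
  move=> st' [R2 Hp2 Hr2']; exists st'; split=> //; first exact: (reach_trans R1 R2).
  by rewrite Hp2 -addnA.
- move=> j x y s /= /andP[_ Hj] off st /(@codeat_cat _ _ (addr_code j x)) [Hc1 Hc2] Hp Hr.
  have [[p1 m1 h1 n1 c1] [/= R1 Hp1 H0 Hm [Hh1 Hn1]]] := mem_addr_code Hc1 Hp.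
  case: Hr => Hr1 Hr2 Hr3.
  have Hr' : rel s (MState p1 m1 h1 n1 c1).
    by split=> /= [j' k' Hj'||]; rewrite ?Hm ?Hh1 ?Hn1 ?Hr1 // /aa; lia.
  have := @one _ _ (MState p1 m1 h1 n1 c1) (setm s j (hm s 0 x) (hm s 0 y)) Hc2 Hp1; case=> //=; first by rewrite Hp1.
    rewrite H0 (Hr1 0) // Hm ?(Hr1 0) //; last by rewrite /va /aa; lia.
    exact: rel_setm Hr'.
  move=> st' [R2 Hp2 Hr2']; exists st'; split=> //; first exact: (reach_trans R1 R2).
  by rewrite Hp2 -addnA.
- move=> x s _ off [p m h n c] Hc /= Hp Hr; apply: (one _ _ _ _ Hc) => //=; first by rewrite Hp.
  case: (Hr) => /= Hm Hh1 Hn1; rewrite Hn1.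
  have [/= A1 A2 A3] := rel_setm p x (b2n (coins (hc s))) (isT : 0 < 16) Hr.
  by split=> //=.
- move=> x y s _ off [p m h n c] Hc /= Hp Hr; apply: (one _ _ _ _ Hc) => //=; first by rewrite Hp.
  case: (Hr) => /= Hm Hh1 Hn1; rewrite Hm // Hh1.
  have [/= A1 A2 A3] := rel_setm p y (b2n (nth false r (hm s 0 x))) (isT : 0 < 16) Hr.
  by split=> //=.
- move=> c1 c2 s k1 s1 k2 s2 _ IH1 _ IH2 /= /andP[Ho1 Ho2] off st /codeat_cat [C1 C2] Hp Hr.
  have [st1 [R1 P1 Q1]] := IH1 Ho1 _ _ C1 Hp Hr.
  have [st2 [R2 P2 Q2]] := IH2 Ho2 _ _ C2 P1 Q1.
  exists st2; split=> //; first exact: (reach_trans R1 R2).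
  by rewrite P2 size_cat addnA.
- move=> x c1 c2 s k s' Hx _ IH /= /andP[Ho1 Ho2] off [p m h n c] /codeat_cons [J] /codeat_cat [C1].
  case/codeat_cons=> J1 /codeat_cons [J2 C2] /= Hp Hr; subst p.
  case: (Hr) => /= Hm Hh1 Hn1.
  have [//|//|[p1 m1 h1 n1 c1'] [R1 /= P1 Q1]] :=
    IH Ho1 off.+1 (MState off.+1 m h n (c + 1 + bl (va x) + bl (m (va x)))) C1.
  exists (MState (off + size (comp off.+1 c1) + 3 + size (comp (off + size (comp off.+1 c1) + 3) c2))
    (upd m1 0 0) h1 n1 (c1' + 1 + bl 0 + bl 0 + 1 + bl 0 + bl 0)); split.
  + rewrite -addnA; apply: reachS; first by rewrite /= J.
    rewrite /= J /= Hm // (negbTE Hx) -(Hm 0 x) //; apply: (reach_trans R1).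
    apply: reachS; rewrite /= P1 J1 //=; apply: reachS; rewrite /= J2 //=.
    exact: reach0.
  + by rewrite /= size_cat /=; lia.
  + case: Q1 => /= A1 A2 A3; split=> //= j' k' Hj'; rewrite -A1 // /upd.
    by case: eqP => //; rewrite /aa; lia.
- move=> x c1 c2 s k s' Hx _ IH /= /andP[Ho1 Ho2] off [p m h n c] /codeat_cons [J] /codeat_cat [C1].
  case/codeat_cons=> J1 /codeat_cons [J2 C2] /= Hp Hr; subst p.
  case: (Hr) => /= Hm Hh1 Hn1; set o2 := off + _ + 3 in C2 J2 J *.
  have C2' : codeat P o2 (comp o2 c2) by move: C2; congr codeat; rewrite /o2; lia.
  have [//|//|st' [R1 P1 Q1]] :=
    IH Ho2 o2 (MState o2 m h n (c + 1 + bl (va x) + bl (m (va x)))) C2'.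
  exists st'; split=> //.
  + have Hx0 : m (va x) = 0 by rewrite Hm.
    by apply: reachS; rewrite /= J //= Hx0; rewrite Hx0 in R1.
  + by rewrite P1 /= size_cat /= /o2; lia.
- move=> x c1 s Hx _ off [p m h n c] /= /codeat_cons [J _] Hp [/= Hm Hh1 Hn1]; subst p.
  eexists; split; first by apply: reachS; rewrite /= J //=; apply: reach0.
    by rewrite /= /va Hm // Hx /= size_cat /=; lia.
  by split.
- move=> x c1 s k1 s1 k2 s2 Hx _ IH1 _ IH2 /= Ho off [p m h n c] Hc /= Hp Hr; subst p.
  case/codeat_cons: (Hc) => J /codeat_cat [C1] /codeat_cons [J1] /codeat_cons [J2 _].
  case: (Hr) => /= Hm Hh1 Hn1.
  have [//|//|[p1 m1 h1 n1 c1'] [R1 /= P1 Q1]] :=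
    IH1 Ho off.+1 (MState off.+1 m h n (c + 1 + bl (va x) + bl (m (va x)))) C1.
  have Q1' : rel s1 (MState off (upd m1 0 0) h1 n1 (c1' + 1 + bl 0 + bl 0 + 1 + bl 0 + bl 0)).
    case: Q1 => /= A1 A2 A3; split=> //= j' k' Hj'; rewrite -A1 // /upd.
    by case: eqP => //; rewrite /aa; lia.
  have [st' [R2 P2 Q2]] := IH2 Ho off (MState off _ _ _ _) Hc erefl Q1'.
  exists st'; split=> //.
  rewrite -!addnA; apply: reachS; first by rewrite /= J.
  rewrite /= J /= Hm // (negbTE Hx) -(Hm 0 x) //; apply: (reach_trans R1).
  apply: reachS; rewrite /= P1 J1 //=; apply: reachS; rewrite /= J2 //=.
Qed.

End Semantics.
End Machine.
Export Machine.

(** * A total-correctness logic with step budgets *)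

Module Spec.
Local Open Scope nat_scope.

Notation "c1 ;; c2" := (CSeq c1 c2) (at level 65, right associativity).

Fixpoint modv (c : cmd) : seq nat :=
  match c with
  | CConst x _ | CAdd x _ _ | CSub x _ _ | CLoad x _ _ | CCoin x | CProbe _ x => [:: x]
  | CSeq c1 c2 | CIf _ c1 c2 => modv c1 ++ modv c2
  | CWhile _ c1 => modv c1
  | _ => [::]
  end.

Fixpoint moda (c : cmd) : seq nat :=
  match c with
  | CStore j _ _ => [:: j]
  | CSeq c1 c2 | CIf _ c1 c2 => moda c1 ++ moda c2
  | CWhile _ c1 => moda c1
  | _ => [::]
  end.

Fixpoint pure (c : cmd) : bool :=
  match c with
  | CCoin _ | CProbe _ _ => false
  | CSeq c1 c2 | CIf _ c1 c2 => pure c1 && pure c2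
  | CWhile _ c1 => pure c1
  | _ => true
  end.

(* Reading and writing are locked: the kernel would otherwise spend exponential
   time comparing nested updates. *)
Definition rd : hst -> nat -> nat -> nat := locked hm.
Definition wr : hst -> nat -> nat -> nat -> hst := locked setm.
Definition tick : hst -> hst := locked (fun s => HSt (hm s) (hh s) (hc s).+1).
Definition logp : hst -> nat -> bool -> hst :=
  locked (fun s e o => HSt (hm s) (rcons (hh s) (e, o)) (hc s)).

Lemma rd_wr s j k v j' k' :
  rd (wr s j k v) j' k' = if (j' == j) && (k' == k) then v else rd s j' k'.
Proof. by rewrite /rd /wr -!lock. Qed.
Lemma hh_wr s j k v : hh (wr s j k v) = hh s. Proof. by rewrite /wr -lock. Qed.
Lemma hc_wr s j k v : hc (wr s j k v) = hc s. Proof. by rewrite /wr -lock. Qed.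
Lemma rd_tick s j k : rd (tick s) j k = rd s j k. Proof. by rewrite /rd /tick -!lock. Qed.
Lemma hh_tick s : hh (tick s) = hh s. Proof. by rewrite /tick -lock. Qed.
Lemma hc_tick s : hc (tick s) = (hc s).+1. Proof. by rewrite /tick -lock. Qed.
Lemma rd_logp s e o j k : rd (logp s e o) j k = rd s j k.
Proof. by rewrite /rd /logp -!lock. Qed.
Lemma hh_logp s e o : hh (logp s e o) = rcons (hh s) (e, o).
Proof. by rewrite /logp -lock. Qed.
Lemma hc_logp s e o : hc (logp s e o) = hc s. Proof. by rewrite /logp -lock. Qed.
Definition rdE := (rd_wr, rd_tick, rd_logp, hh_wr, hc_wr, hh_tick, hc_tick, hh_logp, hc_logp).

Definition eff1 (c : cmd) (s : hst) : hst :=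
  match c with
  | CConst x k => wr s 0 x k
  | CAdd x y z => wr s 0 x (rd s 0 y + rd s 0 z)
  | CSub x y z => wr s 0 x (rd s 0 y - rd s 0 z)
  | CLoad x j y => wr s 0 x (rd s j (rd s 0 y))
  | CStore j x y => wr s j (rd s 0 x) (rd s 0 y)
  | _ => s
  end.

Definition atomic (c : cmd) : bool :=
  match c with
  | CConst _ _ | CAdd _ _ _ | CSub _ _ _ | CLoad _ _ _ | CStore _ _ _ | CSkip => true
  | _ => false
  end.

(** The frame read off the syntax of [c]. It lets each specification below mention only what its
    command is meant to change. *)
Definition framed (c : cmd) (s s' : hst) : Prop :=
  [/\ forall x, x \notin modv c -> rd s' 0 x = rd s 0 x,
      forall j k, j != 0 -> j \notin moda c -> rd s' j k = rd s j k
    & pure c -> hh s' = hh s /\ hc s' = hc s].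

Section Logic.
Variables (r : seq bool) (coins : nat -> bool).

Definition spec (c : cmd) (s : hst) (K : nat) (Q : hst -> Prop) : Prop :=
  exists s' k, [/\ runs r coins c s k s', k <= K & Q s'].

Lemma runs_framed c s k s' : runs r coins c s k s' -> okc c -> framed c s s'.
Proof.
pose fr cc s0 s1 := [/\ forall x, x \notin modv cc -> hm s1 0 x = hm s0 0 x,
      forall j k0, j != 0 -> j \notin moda cc -> hm s1 j k0 = hm s0 j k0
    & pure cc -> hh s1 = hh s0 /\ hc s1 = hc s0].
suff: runs r coins c s k s' -> okc c -> fr c s s' by rewrite /framed /rd -lock.
have F0 cc s0 : fr cc s0 s0 by split.
have Fv cc s0 x v : x \in modv cc -> fr cc s0 (setm s0 0 x v).
  move=> Hx; split=> [y Hy|j k0 Hj _|_] //=.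
    by case: eqP => // E; rewrite E Hx in Hy.
  by rewrite (negbTE Hj).
elim=> {c s k s'} //=.
- by move=> x k s _; apply: Fv; rewrite inE.
- by move=> x y z s _; apply: Fv; rewrite inE.
- by move=> x y z s _; apply: Fv; rewrite inE.
- by move=> x j y s _; apply: Fv; rewrite inE.
- move=> j x y s /andP[Hj _]; split=> [z _|j' k' _|_] //=.
    by case: j Hj.
  by rewrite inE => /negbTE ->.
- move=> x s _; case: (Fv (CCoin x) s x (b2n (coins (hc s)))); first by rewrite inE.
  by move=> A1 A2 _; split.
- move=> x y s _; case: (Fv (CProbe x y) s y (b2n (nth false r (hm s 0 x)))); first by rewrite inE.
  by move=> A1 A2 _; split.
- move=> c1 c2 s k1 s1 k2 s2 _ IH1 _ IH2 /andP[/IH1 [A1 A2 A3] /IH2 [B1 B2 B3]].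
  split=> [x|j k|] /=; rewrite ?mem_cat ?negb_or.
  + by case/andP=> H1 H2; rewrite B1 // A1.
  + by move=> Hj /andP[H1 H2]; rewrite B2 // A2.
  + by case/andP=> H1 H2; case: (A3 H1) => <- <-; apply: B3.
- move=> x c1 c2 s k s' _ _ IH /andP[/IH [A1 A2 A3] _].
  split=> [y|j k0|] /=; rewrite ?mem_cat ?negb_or.
  + by case/andP=> H1 H2; rewrite A1.
  + by move=> Hj /andP[H1 H2]; rewrite A2.
  + by case/andP=> H1 H2; apply: A3.
- move=> x c1 c2 s k s' _ _ IH /andP[_ /IH [A1 A2 A3]].
  split=> [y|j k0|] /=; rewrite ?mem_cat ?negb_or.
  + by case/andP=> H1 H2; rewrite A1.
  + by move=> Hj /andP[H1 H2]; rewrite A2.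
  + by case/andP=> H1 H2; apply: A3.
- move=> x c1 s k1 s1 k2 s2 _ _ IH1 _ IH2 Ho.
  case: (IH1 Ho) => A1 A2 A3; case: (IH2 Ho) => /= B1 B2 B3.
  split=> /= [y H|j k H0 H|H]; first by rewrite B1 // A1.
    by rewrite B2 // A2.
  by case: (A3 H) => <- <-; apply: B3.
Qed.

Lemma spec_frame c s K Q : okc c -> spec c s K Q ->
  spec c s K (fun s' => Q s' /\ framed c s s').
Proof.
move=> Ho [s' [k [H1 H2 H3]]]; exists s', k; split=> //; split=> //.
exact: runs_framed H1 Ho.
Qed.

Lemma spec_weak c s K K' (Q Q' : hst -> Prop) : spec c s K Q -> K <= K' ->
  (forall s', Q s' -> Q' s') -> spec c s K' Q'.
Proof.
move=> [s' [k [H1 H2 H3]]] HK HQ; exists s', k; split=> //; last exact: HQ.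
exact: leq_trans HK.
Qed.

Lemma spec_then c1 c2 s K K1 (Q1 Q : hst -> Prop) : spec c1 s K1 Q1 -> K1 <= K ->
  (forall s', Q1 s' -> spec c2 s' (K - K1) Q) -> spec (c1 ;; c2) s K Q.
Proof.
move=> [s1 [k1 [A1 A2 A3]]] HK /(_ _ A3) [s2 [k2 [B1 B2 B3]]].
by exists s2, (k1 + k2); split=> //; [apply: RSeq A1 B1 | lia].
Qed.

Lemma spec_assoc c1 c2 c3 s K (Q : hst -> Prop) :
  spec (c1 ;; (c2 ;; c3)) s K Q -> spec ((c1 ;; c2) ;; c3) s K Q.
Proof.
move=> [s' [k [H1 H2 H3]]]; exists s', k; split=> //.
inversion H1 as [| | | | | | | |? ? ? k1 s1 k2 ? R1 R2| | | |]; subst.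
inversion R2 as [| | | | | | | |? ? ? k3 s3 k4 ? R3 R4| | | |]; subst.
by rewrite addnA; apply: RSeq R4; apply: RSeq R3.
Qed.

Lemma spec_assoc' c1 c2 c3 s K (Q : hst -> Prop) :
  spec ((c1 ;; c2) ;; c3) s K Q -> spec (c1 ;; (c2 ;; c3)) s K Q.
Proof.
move=> [s' [k [H1 H2 H3]]]; exists s', k; split=> //.
inversion H1 as [| | | | | | | |? ? ? k1 s1 k2 ? R1 R2| | | |]; subst.
inversion R1 as [| | | | | | | |? ? ? k3 s3 k4 ? R3 R4| | | |]; subst.
by rewrite -addnA; apply: RSeq R3 _; apply: RSeq R4 R2.
Qed.

Lemma spec_atom1 c s K (Q : hst -> Prop) : atomic c -> 7 <= K -> Q (eff1 c s) -> spec c s K Q.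
Proof.
case: c => //= [|x k|x y z|x y z|x j y|j x y] _ HK; rewrite /wr /rd -?lock => HQ.
- by exists s, 0; split=> //; apply: RSkip.
- by eexists; exists 1; split; [apply: RConst|lia|].
- by eexists; exists 1; split; [apply: RAdd|lia|].
- by eexists; exists 1; split; [apply: RSub|lia|].
- by eexists; exists 7; split; [apply: RLoad|lia|].
- by eexists; exists 7; split; [apply: RStore|lia|].
Qed.

Lemma spec_atom c c2 s K (Q : hst -> Prop) : atomic c -> 7 <= K ->
  spec c2 (eff1 c s) (K - 7) Q -> spec (c ;; c2) s K Q.
Proof.
move=> Ha HK H; apply: (spec_then (K1 := 7) (Q1 := fun s' => s' = eff1 c s)) => //.
  exact: spec_atom1.
by move=> _ ->.
Qed.

Lemma spec_if x c1 c2 s K (Q : hst -> Prop) : 3 <= K ->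
  (rd s 0 x != 0 -> spec c1 s (K - 3) Q) -> (rd s 0 x = 0 -> spec c2 s (K - 3) Q) ->
  spec (CIf x c1 c2) s K Q.
Proof.
rewrite /rd -lock => HK H1 H2; case: (eqVneq (hm s 0 x) 0) => [/[dup] E /H2|/[dup] E /H1] [s' [k [A B C]]].
  by exists s', (1 + k); split=> //; [apply: RIfF|lia].
by exists s', (1 + k + 2); split=> //; [apply: RIfT|lia].
Qed.

(** The invariant is indexed by the value of the guard variable, which counts the remaining
    iterations. *)
Lemma spec_down x body s k K (I : nat -> hst -> Prop) (Q : hst -> Prop) :
  rd s 0 x = k -> I k s ->
  (forall k' s', k' < k -> rd s' 0 x = k'.+1 -> I k'.+1 s' ->
     spec body s' K (fun s2 => rd s2 0 x = k' /\ I k' s2)) ->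
  (forall s', I 0 s' -> rd s' 0 x = 0 -> Q s') ->
  spec (CWhile x body) s (k * (K + 3) + 1) Q.
Proof.
elim: k s => [|k IH] s Hx HI Hb HQ.
  by exists s, 1; split; [apply: RWhileF; rewrite /rd -lock in Hx| |apply: HQ].
have [s1 [k1 [A1 A2 [A3 A4]]]] := Hb k s (ltnSn k) Hx HI.
have [|s2 [k2 [B1 B2 B3]]] := IH s1 A3 A4 _ HQ.
  by move=> k' s' Hk'; apply: Hb; apply: ltnW.
exists s2, (1 + k1 + 2 + k2); split=> //; last lia.
by apply: RWhileT A1 B1; move: Hx; rewrite /rd -lock => ->.
Qed.

(** For loops without a counter: the index [i] is a ghost, and termination comes from [i < N] as
    long as the guard is nonzero. *)
Lemma spec_up x body s N K (I : nat -> hst -> Prop) (Q : hst -> Prop) : I 0 s ->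
  (forall i s', I i s' -> rd s' 0 x != 0 -> i < N /\ spec body s' K (I i.+1)) ->
  (forall i s', I i s' -> rd s' 0 x = 0 -> Q s') ->
  spec (CWhile x body) s (N * (K + 3) + 1) Q.
Proof.
move=> HI Hb HQ.
suff H d i s' : d + i = N -> I i s' -> spec (CWhile x body) s' (d * (K + 3) + 1) Q.
  by apply: (H N 0) => //; rewrite addn0.
elim: d i s' => [|d IH] i s' E Hi.
  case: (eqVneq (rd s' 0 x) 0) => Hx; last by case: (Hb _ _ Hi Hx); lia.
  by exists s', 1; split; [apply: RWhileF; rewrite /rd -lock in Hx| |apply: HQ Hi _].
case: (eqVneq (rd s' 0 x) 0) => Hx.
  by exists s', 1; split; [apply: RWhileF; rewrite /rd -lock in Hx|lia|apply: HQ Hi _].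
have [_ [s1 [k1 [A1 A2 A3]]]] := Hb _ _ Hi Hx.
have [|s2 [k2 [B1 B2 B3]]] := IH _ _ _ A3; first lia.
exists s2, (1 + k1 + 2 + k2); split=> //; last lia.
by apply: RWhileT A1 B1; rewrite /rd -lock in Hx.
Qed.

(* Variable 0 always holds the constant 1. *)
Definition cfor (i n d : nat) (body : cmd) : cmd :=
  CConst i 0 ;; CSub d n i ;; CWhile d (body ;; CAdd i i 0 ;; CSub d n i).

(** The guard [d = n - i] counts down, so this is an instance of [spec_down]. The body has to
    establish the invariant in the state reached after the updates of [i] and [d], whence the two
    writes in its postcondition. *)
Lemma spec_for i n d body s N K (I : nat -> hst -> Prop) (Q : hst -> Prop) :
  uniq [:: 0; i; n; d] -> okc body ->
  0 \notin modv body -> i \notin modv body -> n \notin modv body ->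
  rd s 0 n = N -> rd s 0 0 = 1 ->
  I 0 (wr (wr s 0 i 0) 0 d N) ->
  (forall k s', k < N -> rd s' 0 i = k -> rd s' 0 n = N -> rd s' 0 0 = 1 -> I k s' ->
     spec body s' K (fun s2 => I k.+1 (wr (wr s2 0 i k.+1) 0 d (N - k.+1)))) ->
  (forall s', I N s' -> Q s') ->
  spec (cfor i n d body) s (N * (K + 17) + 15) Q.
Proof.
move=> Hu Ho H0 Hi Hn HN H1 HI Hb HQ.
have {Hu} [[u1 u2 u3] [u4 u5 u6]] : [/\ i != 0, n != 0 & d != 0] /\ [/\ n != i, d != i & d != n].
  move: Hu; rewrite /= !inE !negb_or => /andP[/and3P[a b c]] /andP[/andP[e f]] /andP[g _].
  by split; split; rewrite eq_sym.
apply: spec_atom => //; first lia.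
apply: spec_atom => //; first lia.
rewrite /eff1 /= ?rdE /=; set s0 := wr _ _ _ _.
have E0 : s0 = wr (wr s 0 i 0) 0 d N.
  by rewrite /s0 (negbTE u4) eqxx HN subn0.
pose J k s' := [/\ k <= N, rd s' 0 i = N - k, rd s' 0 n = N, rd s' 0 0 = 1 & I (N - k) s'].
apply: (@spec_weak _ _ (N * (K + 14 + 3) + 1) _ Q _); [|lia|by []].
apply: (spec_down (I := J)).
- by rewrite E0 rdE !eqxx.
- rewrite E0; split=> //; rewrite ?subnn ?rdE //= ?rdE //=.
  + by rewrite (eq_sym i d) (negbTE u5) eqxx.
  + by rewrite (eq_sym n d) (negbTE u6) (negbTE u4).
  + by rewrite (eq_sym 0 d) (eq_sym 0 i) (negbTE u3) (negbTE u1).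
- move=> k s' Hk Hd [_ A1 A2 A3 A4].
  have HH : N - k.+1 < N by lia.
  have := spec_frame Ho (Hb _ _ HH A1 A2 A3 A4) => /spec_then; apply; first lia.
  move=> s2 [B1 [B2 _ _]].
  apply: spec_atom => //; first lia.
  apply: spec_atom1 => //; first lia.
  rewrite /eff1 /= !rdE /= !eqxx (negbTE u4) /= (B2 i) // (B2 n) // (B2 0) // A1 A2 A3.
  have E : N - k.+1 + 1 = (N - k.+1).+1 by lia.
  have E2 : (N - k.+1).+1 = N - k by lia.
  split; first lia.
  split=> //=; rewrite ?rdE /=.
  + lia.
  + by rewrite (eq_sym i d) (negbTE u5) eqxx /=; lia.
  + by rewrite (eq_sym n d) (negbTE u6) (negbTE u4) B2.
  + by rewrite (eq_sym 0 d) (eq_sym 0 i) (negbTE u3) (negbTE u1) B2.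
  + by rewrite E -E2.
- by move=> s' [_ _ _ _]; rewrite subn0 => A _; apply: HQ.
Qed.

End Logic.
End Spec.
Export Spec.

(** * Multiplication, division and random numbers *)

Module Arithmetic.
Local Open Scope nat_scope.

Notation vone := 0. Notation vn := 1. Notation vm := 2. Notation vK := 3.
Notation vKK := 4. Notation vHK := 5. Notation vR := 6. Notation vbeta := 7.
Notation vL := 8. Notation vbig := 9. Notation vptr := 10. Notation ve := 11.
Notation vd := 12. Notation vt1 := 13. Notation vt2 := 14. Notation vx := 15.
Notation vy := 16. Notation vu := 17. Notation vv := 18. Notation vit := 19.
Notation vq := 20. Notation vNA := 21. Notation vNB := 22. Notation vpn := 23.
Notation vpd := 24. Notation vwn := 25. Notation vwd := 26. Notation macc := 27.
Notation mi := 28. Notation my := 29. Notation mt := 30. Notation md := 31.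
Notation mz := 32. Notation vdd := 33. Notation vM := 34. Notation vuu := 35.

Notation aIn := 1. Notation aU := 2. Notation aV := 3. Notation aPN := 4.
Notation aPD := 5. Notation aWN := 6. Notation aWD := 7. Notation aT := 8.
Notation aPow := 9. Notation aP := 10. Notation aC := 11. Notation aY := 12.
Notation aZ := 13. Notation aX := 14. Notation aCNT := 15.

Ltac at1 := do ?[apply: spec_assoc]; apply: spec_atom; [by []|lia|rewrite /eff1 ?rdE /=].
Ltac at0 := apply: spec_atom1; [by []|lia|rewrite /eff1 ?rdE /=].

(** Double-and-add from the top bit of [y]; the table [aPow] of powers of two replaces shifting. As
    subtraction truncates, [md = my + 1 - 2 ^ i] is nonzero exactly when [2 ^ i <= my]. *)
Definition cmul (dst x y : nat) : cmd :=
  CConst mz 0 ;; CAdd my y mz ;; CAdd mi vL mz ;; CConst macc 0 ;;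
  CWhile mi (CSub mi mi vone ;; CAdd macc macc macc ;; CLoad mt aPow mi ;;
     CAdd md my vone ;; CSub md md mt ;; CIf md (CSub my my mt ;; CAdd macc macc x) CSkip) ;;
  CAdd dst macc mz.

Definition Kmul (L : nat) : nat := L * 70 + 50.

(** Repeated subtraction is affordable because all quotients needed are at most the precision [kK],
    which is linear in the size of the graph. Truncation makes the quotient round up. *)
Definition cdivup (q t d : nat) : cmd :=
  CConst q 0 ;; CWhile t (CSub t t d ;; CAdd q q vone).

Fixpoint cpow2 (x k : nat) : cmd :=
  if k is k'.+1 then cpow2 x k' ;; CAdd x x x else CConst x 1.

Definition ccoins : cmd :=
  CConst vuu 0 ;; CConst mz 0 ;; CAdd mi vbeta mz ;;
  CWhile mi (CCoin vx ;; CAdd vuu vuu vuu ;; CAdd vuu vuu vx ;; CSub mi mi vone).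

(** The earliest coin is the most significant bit. *)
Fixpoint uval (coins : nat -> bool) (pos b : nat) : nat :=
  if b is b'.+1 then 2 * uval coins pos b' + coins (pos + b') else 0.

Section Blocks.
Variables (r : seq bool) (coins : nat -> bool).
Local Notation spec := (spec r coins).

Lemma spec_mul dst x y s L X Y :
  x \notin [:: macc; mi; my; mt; md; mz] -> y != mz ->
  rd s 0 vone = 1 -> rd s 0 vL = L -> (forall i, i < L -> rd s aPow i = 2 ^ i) ->
  rd s 0 x = X -> rd s 0 y = Y -> Y < 2 ^ L ->
  spec (cmul dst x y) s (Kmul L) (fun s' => rd s' 0 dst = X * Y).
Proof.
rewrite !inE !negb_or => /and5P[x1 x2 x3 x4 /andP[x5 x6]] Hy H1 HL HP HX HY HYL.
rewrite /Kmul; do 4 at1.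
(* [macc] is [X] times the bits of [Y] already read, and [my] is the unread remainder. *)
pose I k s' := [/\ rd s' 0 macc * 2 ^ k + X * rd s' 0 my = X * Y, rd s' 0 my < 2 ^ k,
  rd s' 0 x = X, rd s' 0 vone = 1 /\ rd s' 0 mz = 0 & forall i, i < L -> rd s' aPow i = 2 ^ i].
apply: (spec_then (K1 := L * (60 + 3) + 1) (Q1 := I 0)).
- apply: (spec_down (I := I)) => //=.
  + by rewrite !rdE /= addn0.
  + rewrite /I ?rdE /= ?rdE /= (negbTE Hy) (negbTE x1) (negbTE x2) (negbTE x3) (negbTE x6) addn0 HY; split=> // i Hi; rewrite ?rdE /=; exact: HP.
  + move=> k s' Hk Hi [A1 A2 A3 [A4 A5] A6].
    have E2 : 2 ^ k.+1 = 2 * 2 ^ k by rewrite expnS.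
    do 5 at1; rewrite Hi A4 subn1 /= A6 //.
    apply: spec_if; [lia| |]; rewrite !rdE /= => Hmd.
      at1; at0; rewrite (negbTE x1) (negbTE x2) (negbTE x3) (negbTE x4) (negbTE x5).
      by split=> //; split=> //= [||||i Hi']; rewrite ?rdE /= ?(negbTE x1) ?(negbTE x2) ?(negbTE x3) ?(negbTE x4) ?(negbTE x5) //; [nia|nia|exact: A6].
    at0.
    by split=> //; split=> //= [||||i Hi']; rewrite ?rdE /= ?(negbTE x1) ?(negbTE x2) ?(negbTE x3) ?(negbTE x4) ?(negbTE x5) //; [nia|nia|exact: A6].
- lia.
- move=> s' [A1 A2 A3 [A4 A5] A6]; at0; rewrite eqxx A5 -A1; nia.
Qed.

Lemma spec_divup q t d s A D Kb :
  uniq [:: vone; q; t; d] -> rd s 0 vone = 1 -> rd s 0 t = A -> rd s 0 d = D -> A <= Kb * D ->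
  spec (cdivup q t d) s (Kb * 17 + 8) (fun s' =>
    A <= rd s' 0 q * D /\ (0 < rd s' 0 q -> (rd s' 0 q).-1 * D < A)).
Proof.
rewrite /= !inE !negb_or => /andP[/and3P[u1 u2 u3] /andP[/andP[u4 u5] /andP[u6 _]]] H1 HA HD HK.
at1.
pose I i s' := [/\ rd s' 0 q = i, rd s' 0 t = A - i * D, rd s' 0 d = D, rd s' 0 vone = 1 &
  0 < i -> i.-1 * D < A].
apply: (@spec_weak _ _ _ _ (Kb * (14 + 3) + 1)
  _ (fun s' => A <= rd s' 0 q * D /\ (0 < rd s' 0 q -> (rd s' 0 q).-1 * D < A))); [|lia|by []].
apply: (spec_up (I := I)).
- split=> //; rewrite ?rdE /= ?eqxx ?(eq_sym t q) ?(eq_sym d q) ?(negbTE u4) ?(negbTE u5) ?(negbTE u1) //.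
  lia.
- move=> i s' [A1 A2 A3 A4 A5] Ht; split; first nia.
  at1; at0; split; rewrite ?rdE /= ?eqxx ?(eq_sym t q) ?(eq_sym d q) ?(eq_sym d t)
    ?(negbTE u4) ?(negbTE u5) ?(negbTE u6) ?(negbTE u1) ?(negbTE u2) ?A1 ?A2 ?A3 ?A4 //; nia.
- move=> i s' [A1 A2 A3 A4 A5] Ht; rewrite A1; split=> //; nia.
Qed.

Lemma spec_pow2 x k s : spec (cpow2 x k) s (7 * k.+1) (fun s' => rd s' 0 x = 2 ^ k).
Proof.
elim: k => [|k IH] /=; first by at0; rewrite eqxx.
apply: (spec_then IH); first lia.
by move=> s' H; at0; rewrite eqxx H expnS mul2n addnn.
Qed.

Lemma modv_pow2 x k y : (y \in modv (cpow2 x k)) = (y == x).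
Proof. by elim: k => [|k IH] /=; rewrite ?mem_cat ?IH !inE ?orbb. Qed.

Lemma okc_pow2 x k : okc (cpow2 x k).
Proof. by elim: k => //= k ->. Qed.

Lemma moda_pow2 x k : moda (cpow2 x k) = [::].
Proof. by elim: k => //= k ->. Qed.

Lemma pure_pow2 x k : pure (cpow2 x k).
Proof. by elim: k => //= k ->. Qed.

Lemma spec_coin x c2 s K (Q : hst -> Prop) : 7 <= K ->
  spec c2 (tick (wr s 0 x (b2n (coins (hc s))))) (K - 7) Q ->
  spec (CCoin x ;; c2) s K Q.
Proof.
move=> HK H; apply: (spec_then (K1 := 7) (Q1 := fun s' =>
  s' = tick (wr s 0 x (b2n (coins (hc s)))))) => //.
  by eexists; exists 1; split; [apply: RCoin| |rewrite /tick /wr -!lock].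
by move=> _ ->.
Qed.

Lemma spec_probe x y c2 s K (Q : hst -> Prop) : 7 <= K ->
  spec c2 (let e := rd s 0 x in let o := nth false r e in
     logp (wr s 0 y (b2n o)) e o) (K - 7) Q ->
  spec (CProbe x y ;; c2) s K Q.
Proof.
move=> HK H; apply: (spec_then (K1 := 7) (Q1 := fun s' =>
  s' = let e := rd s 0 x in let o := nth false r e in
     logp (wr s 0 y (b2n o)) e o)) => //.
  by eexists; exists 1; split; [apply: RProbe| |rewrite /logp /wr /rd -!lock].
by move=> _ ->.
Qed.

Lemma spec_coins s b : rd s 0 vone = 1 -> rd s 0 vbeta = b ->
  spec ccoins s (b * 31 + 22) (fun s' =>
    [/\ rd s' 0 vuu = uval coins (hc s) b, hc s' = hc s + b & hh s' = hh s]).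
Proof.
move=> H1 Hb; do 3 at1.
pose I k s' := [/\ rd s' 0 vuu = uval coins (hc s) (b - k), hc s' = hc s + (b - k),
  hh s' = hh s, rd s' 0 vone = 1 & k <= b].
apply: (@spec_weak _ _ _ _ (b * (28 + 3) + 1)
  _ (fun s' => [/\ rd s' 0 vuu = uval coins (hc s) b, hc s' = hc s + b & hh s' = hh s]));
  [|lia|by []].
apply: (spec_down (I := I)) => /=.
- by rewrite !rdE /= addn0.
- by split=> //=; rewrite ?rdE /= ?subnn ?addn0.
- move=> k s' Hk Hi [A1 A2 A3 A4 A5].
  apply: spec_coin => //; at1; at1; at0; split; first by rewrite Hi A4 subn1 ?rdE.
  have E : b - k = (b - k.+1).+1 by lia.
  split=> //=; rewrite ?rdE /= ?A1 ?A2 ?E //; [|lia|lia].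
  by rewrite [RHS]/=; case: (coins _) => /=; lia.
- by move=> s' [A1 A2 A3 A4 A5] _; split=> //; rewrite ?A1 ?A2 subn0.
Qed.

End Blocks.
End Arithmetic.
Export Arithmetic.

(** * Reading the input and setting the precision parameters *)

Module Input.
Local Open Scope nat_scope.

Definition cget (a : nat) : cmd :=
  CLoad vx aIn vptr ;; CStore a ve vx ;; CAdd vptr vptr vone.

(** [vbig] sums all numerators and denominators: a bound for each of them, from which the length of
    the table of powers is found. *)
Definition cunpack_edge : cmd :=
  cget aU ;; cget aV ;; cget aPN ;; CAdd vbig vbig vx ;; cget aPD ;; CAdd vbig vbig vx ;;
  cget aWN ;; CAdd vbig vbig vx ;; cget aWD ;; CAdd vbig vbig vx ;; CStore aCNT ve mz.

Definition cunpack : cmd :=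
  CConst vone 1 ;; CConst mz 0 ;; CLoad vn aIn mz ;; CLoad vm aIn vone ;;
  CConst vptr 2 ;; CConst vbig 0 ;; cfor ve vm vd cunpack_edge ;;
  cfor ve vn vd (cget aT ;; CStore aY ve mz ;; CStore aZ ve mz).

(** Every parameter is a fixed power of two times a power of [M = 2 ^ a], so one doubling of [M]
    multiplies each by a constant. The loop stops at the first [M] above [nV + nE], which is at most
    twice that sum plus one. *)
Definition cparams_body : cmd :=
  CAdd vM vM vM ;; CAdd vK vK vK ;; CAdd vKK vKK vKK ;; CAdd vKK vKK vKK ;;
  CAdd vHK vHK vHK ;; CAdd vHK vHK vHK ;; CAdd vHK vHK vHK ;; CAdd vHK vHK vHK ;;
  CAdd vR vR vR ;; CAdd vR vR vR ;; CAdd vR vR vR ;; CAdd vR vR vR ;;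
  CAdd vbeta vbeta vx ;; CAdd vd vt1 vone ;; CSub vd vd vM.

Definition cparams (e1 e2 e3 e4 b : nat) : cmd :=
  cpow2 vK e1 ;; cpow2 vKK e2 ;; cpow2 vHK e3 ;; cpow2 vR e4 ;; CConst vbeta b ;;
  CConst vM 1 ;; CAdd vt1 vn vm ;; CConst vx 4 ;; CAdd vd vt1 vone ;; CSub vd vd vM ;;
  CWhile vd cparams_body.

(** The table ends at the first power above [vbig + vHK]. This covers the second factor of every
    later call of [cmul]. *)
Definition cpowtab : cmd :=
  CAdd vbig vbig vHK ;; CAdd vbig vbig vone ;; CConst vL 0 ;; CConst vt1 1 ;;
  CSub vd vbig vt1 ;;
  CWhile vd (CStore aPow vL vt1 ;; CAdd vt1 vt1 vt1 ;; CAdd vL vL vone ;; CSub vd vbig vt1).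

Section Init.
Variables (r : seq bool) (coins : nat -> bool).
Local Notation spec := (spec r coins).
Variables (n m : nat) (U V PN PD WN WD T In : nat -> nat).

Definition EdgeA (k : nat) (s : hst) : Prop := forall e, e < k ->
  [/\ rd s aU e = U e, rd s aV e = V e, rd s aPN e = PN e, rd s aPD e = PD e &
      rd s aWN e = WN e /\ rd s aWD e = WD e].

Definition VertA (k : nat) (s : hst) : Prop := forall v, v < k ->
  [/\ rd s aT v = T v, rd s aY v = 0 & rd s aZ v = 0].

Definition sumb (k : nat) : nat := \sum_(e < k) (PN e + PD e + WN e + WD e).

Hypothesis In0 : In 0 = n.
Hypothesis In1 : In 1 = m.
Hypothesis InE : forall e, e < m ->
  [/\ In (2 + 6 * e) = U e, In (3 + 6 * e) = V e, In (4 + 6 * e) = PN e,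
      In (5 + 6 * e) = PD e & In (6 + 6 * e) = WN e /\ In (7 + 6 * e) = WD e].
Hypothesis InT : forall v, v < n -> In (2 + 6 * m + v) = T v.

Lemma spec_unpack s : (forall i, i < 2 + 6 * m + n -> rd s aIn i = In i) ->
  spec cunpack s (m * 200 + n * 80 + 200) (fun s' =>
    [/\ [/\ rd s' 0 vone = 1, rd s' 0 vn = n, rd s' 0 vm = m & rd s' 0 vbig = sumb m],
      EdgeA m s', VertA n s', (forall e, e < m -> rd s' aCNT e = 0) &
      hh s' = hh s /\ hc s' = hc s]).
Proof.
move=> HIn; do 6 at1; rewrite /= !HIn ?In0 ?In1; try lia.
set s0 := wr _ _ _ _.
pose I k s' := [/\ [/\ rd s' 0 vptr = 2 + 6 * k, rd s' 0 vbig = sumb k, rd s' 0 mz = 0,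
   rd s' 0 vn = n & rd s' 0 vm = m], EdgeA k s', (forall i, i < 2 + 6 * m + n -> rd s' aIn i = In i),
   (forall e, e < k -> rd s' aCNT e = 0) & [/\ hh s' = hh s, hc s' = hc s & rd s' 0 vone = 1]].
apply: (spec_then (K1 := m * (170 + 17) + 15) (Q1 := I m)); [|lia|].
  apply: (spec_for (I := I)) => //; rewrite /s0 ?rdE //.
    by split=> //; [split| |]; rewrite /s0 ?rdE /= ?rdE /= ?muln0 // ?/sumb ?big_ord0 // => i Hi; rewrite !rdE /= HIn.
  move=> k s1 Hk Hi Hn H1 [[A1 A2 A3 A4 A5] A6 A7 A8 [A9 A10 A11]].
  have [B1 B2 B3 B4 [B5 B6]] := InE Hk.
  have EI i : i < 2 + 6 * m + n -> forall j, i = j -> rd s1 aIn i = In j.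
    by move=> Hj j <-; apply: A7.
  have E0 : rd s1 aIn (2 + 6 * k) = U k by rewrite (EI _ _ (2 + 6 * k)) //; lia.
  have E1 : rd s1 aIn (2 + 6 * k + 1) = V k by rewrite (EI _ _ (3 + 6 * k)) //; lia.
  have E2 : rd s1 aIn (2 + 6 * k + 1 + 1) = PN k by rewrite (EI _ _ (4 + 6 * k)) //; lia.
  have E3 : rd s1 aIn (2 + 6 * k + 1 + 1 + 1) = PD k by rewrite (EI _ _ (5 + 6 * k)) //; lia.
  have E4 : rd s1 aIn (2 + 6 * k + 1 + 1 + 1 + 1) = WN k by rewrite (EI _ _ (6 + 6 * k)) //; lia.
  have E5 : rd s1 aIn (2 + 6 * k + 1 + 1 + 1 + 1 + 1) = WD k
    by rewrite (EI _ _ (7 + 6 * k)) //; lia.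
  rewrite /cunpack_edge /cget; do 22 at1; at0.
  rewrite Hi A1 A2 A3 H1 E0 E1 E2 E3 E4 E5; split=> //.
  - split; rewrite ?rdE //=; first lia.
    by rewrite /sumb big_ord_recr /= !addnA.
  - move=> e; rewrite ltnS leq_eqVlt !rdE /=; case: (eqVneq e k) => [->|_] //= He; exact: A6.
  - by move=> i Hi'; rewrite !rdE /= A7.
  - move=> e; rewrite ltnS leq_eqVlt !rdE /=; case: (eqVneq e k) => [->|_] //= He; exact: A8.
  - by rewrite !rdE.
move=> {s0} s1 [[A1 A2 A3 A4 A5] A6 A7 A8 [A9 A10 A11]].
pose J k s' := [/\ [/\ rd s' 0 vptr = 2 + 6 * m + k, rd s' 0 vbig = sumb m, rd s' 0 mz = 0,
   rd s' 0 vn = n & rd s' 0 vm = m], EdgeA m s', (forall i, i < 2 + 6 * m + n -> rd s' aIn i = In i),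
   (forall e, e < m -> rd s' aCNT e = 0) /\ VertA k s' &
   [/\ hh s' = hh s, hc s' = hc s & rd s' 0 vone = 1]].
apply: (@spec_weak _ _ _ _ (n * (40 + 17) + 15) _ (J n)); [|lia|]; last first.
  by move=> s' [[? ? ? ? ?] ? ? [? ?] [? ? ?]].
apply: (spec_for (I := J)) => //.
  by split; [split| | |split|split]; rewrite ?rdE //= ?addn0 // => i Hi; rewrite ?rdE /=; auto.
move=> k s2 Hk Hi Hn H1 [[B1 B2 B3 B4 B5] B6 B7 [B8 B9] [B10 B11 B12]].
rewrite /cget; do 4 at1; at0; rewrite Hi B1 B3 H1 B7; last lia.
rewrite InT //; split; [|by move=> i Hi'; rewrite !rdE /=; apply: B6| | |by rewrite !rdE].
- by split; rewrite ?rdE //=; lia.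
- by move=> i Hi'; rewrite !rdE /= B7.
- split=> [i Hi'|v]; first by rewrite !rdE /= B8.
  rewrite ltnS leq_eqVlt !rdE /=; case: (eqVneq v k) => [->|_] //= Hv; exact: B9.
Qed.

Lemma spec_params s e1 e2 e3 e4 b : rd s 0 vone = 1 -> rd s 0 vn = n -> rd s 0 vm = m ->
  spec (cparams e1 e2 e3 e4 b) s ((n + m).+1 * 120 + 7 * (e1 + e2 + e3 + e4) + 200) (fun s' => exists a,
    [/\ n + m < 2 ^ a, 2 ^ a <= 2 * (n + m) + 1, rd s' 0 vK = 2 ^ (e1 + a) &
     [/\ rd s' 0 vKK = 2 ^ (e2 + 2 * a),
      rd s' 0 vHK = 2 ^ (e3 + 4 * a), rd s' 0 vR = 2 ^ (e4 + 4 * a) & rd s' 0 vbeta = b + 4 * a]]).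
Proof.
move=> H1 Hn Hm.
have P x k s0 := spec_frame (okc_pow2 x k) (spec_pow2 r coins x k s0).
apply: (spec_then (P vK e1 s)); first lia; move=> s1 [A1 [B1 _ _]].
apply: (spec_then (P vKK e2 s1)); first lia; move=> s2 [A2 [B2 _ _]].
apply: (spec_then (P vHK e3 s2)); first lia; move=> s3 [A3 [B3 _ _]].
apply: (spec_then (P vR e4 s3)); first lia; move=> s4 [A4 [B4 _ _]].
have {}H1 : rd s4 0 vone = 1 by rewrite B4 ?B3 ?B2 ?B1 ?modv_pow2.
have {}Hn : rd s4 0 vn = n by rewrite B4 ?B3 ?B2 ?B1 ?modv_pow2.
have {}Hm : rd s4 0 vm = m by rewrite B4 ?B3 ?B2 ?B1 ?modv_pow2.
have {}A1 : rd s4 0 vK = 2 ^ e1 by rewrite B4 ?B3 ?B2 ?modv_pow2.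
have {}A2 : rd s4 0 vKK = 2 ^ e2 by rewrite B4 ?B3 ?modv_pow2.
have {}A3 : rd s4 0 vHK = 2 ^ e3 by rewrite B4 ?modv_pow2.
do 6 at1; rewrite H1 Hn Hm.
pose I a s' := [/\ [/\ rd s' 0 vd = n + m + 1 - 2 ^ a, 2 ^ a <= 2 * (n + m) + 1, rd s' 0 vM = 2 ^ a,
   rd s' 0 vx = 4 & rd s' 0 vt1 = n + m], rd s' 0 vone = 1, rd s' 0 vK = 2 ^ (e1 + a) &
     [/\ rd s' 0 vKK = 2 ^ (e2 + 2 * a),
      rd s' 0 vHK = 2 ^ (e3 + 4 * a), rd s' 0 vR = 2 ^ (e4 + 4 * a) & rd s' 0 vbeta = b + 4 * a]].
apply: (@spec_weak _ _ _ _ ((n + m).+1 * (105 + 3) + 1) _ (fun s' => exists a,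
    [/\ n + m < 2 ^ a, 2 ^ a <= 2 * (n + m) + 1, rd s' 0 vK = 2 ^ (e1 + a) &
     [/\ rd s' 0 vKK = 2 ^ (e2 + 2 * a),
      rd s' 0 vHK = 2 ^ (e3 + 4 * a), rd s' 0 vR = 2 ^ (e4 + 4 * a) & rd s' 0 vbeta = b + 4 * a]]));
  [|lia|by []].
apply: (spec_up (I := I)).
- by split; [split| | |split]; rewrite ?rdE /= ?A1 ?A2 ?A3 ?A4 ?H1 ?expn0 ?muln0 ?addn0; first [reflexivity | lia].
- move=> i s' [[C1 C2 C3 C4 C5] C6 C7 [C8 C9 C10 C11]].
  rewrite C1 => Hd; have Hi : i < 2 ^ i by apply: ltn_expl.
  split; first lia.
  rewrite /cparams_body; do 14 at1; at0; rewrite C3 C5 C6 C7 C8 C9 C10 C11 C4.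
  have E2 x : 2 ^ x + 2 ^ x = 2 ^ x.+1 by rewrite expnS mul2n addnn.
  rewrite !E2; split; [split| | |split]; rewrite ?rdE /= ?C4 ?C5 ?C6;
    first [(congr (2 ^ _); lia) | lia | (move: (E2 i); lia)].
- move=> i s' [[C1 C2 C3 C4 C5] C6 C7 C8] Hd; exists i; split=> //; lia.
Qed.

Lemma spec_powtab s bg hk : rd s 0 vone = 1 -> rd s 0 vbig = bg -> rd s 0 vHK = hk ->
  spec cpowtab s (bl (bg + hk + 1) * 31 + 50) (fun s' => exists L,
    [/\ rd s' 0 vL = L, L <= bl (bg + hk + 1), bg + hk < 2 ^ L &
       forall i, i < L -> rd s' aPow i = 2 ^ i]).
Proof.
move=> H1 Hb Hh; do 5 at1; rewrite H1 Hb Hh; set bg' := bg + hk + 1.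
pose I i s' := [/\ [/\ rd s' 0 vL = i, rd s' 0 vt1 = 2 ^ i, rd s' 0 vd = bg' - 2 ^ i,
  rd s' 0 vbig = bg' & rd s' 0 vone = 1], i <= bl bg' & forall k, k < i -> rd s' aPow k = 2 ^ k].
apply: (@spec_weak _ _ _ _ (bl bg' * (28 + 3) + 1) _ (fun s' => exists L,
    [/\ rd s' 0 vL = L, L <= bl bg', bg + hk < 2 ^ L &
       forall i, i < L -> rd s' aPow i = 2 ^ i])); [|lia|by []].
apply: (spec_up (I := I)).
- by split; [split| |]; rewrite ?rdE.
- move=> i s' [[A1 A2 A3 A4 A5] A6 A7]; rewrite A3 => Hd.
  have Hi : i < bl bg' by rewrite /bl ltnS trunc_log_max //; lia.
  split=> //; do 3 at1; at0; rewrite A1 A2 A4 A5.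
  have E2 x : 2 ^ x + 2 ^ x = 2 ^ x.+1 by rewrite expnS mul2n addnn.
  rewrite !E2; split; [split| |]; rewrite ?rdE //=; try lia.
  move=> k; rewrite ltnS leq_eqVlt !rdE /=; case: (eqVneq k i) => [->|_] //= Hk; exact: A7.
- by move=> i s' [[A1 A2 A3 A4 A5] A6 A7] Hd; exists i; split=> //; lia.
Qed.

End Init.
End Input.
Export Input.

(** * The subgradient iteration as a program *)

Module LinearProgram.
Local Open Scope nat_scope.

Definition cld : cmd :=
  CLoad vpn aPN ve ;; CLoad vpd aPD ve ;; CLoad vwn aWN ve ;; CLoad vwd aWD ve.

Definition cprods : cmd :=
  cmul vt1 vNB vpn ;; cmul vt1 vt1 vwn ;; cmul vt2 vNA vpd ;; cmul vt2 vt2 vwd.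

(** Fractions are compared by cross multiplication. [vNA / vNB] becomes the largest [p_e w_e] of an
    edge, the unit relative to which all weights are rounded. *)
Definition cargmax_body : cmd :=
  cld ;; cprods ;; CSub vdd vt1 vt2 ;; CIf vdd (cmul vNA vpn vwn ;; cmul vNB vpd vwd) CSkip.

Definition cargmax : cmd := CConst vNA 0 ;; CConst vNB 1 ;; cfor ve vm vd cargmax_body.

(** With [v_e = p_e w_e], [aC] receives [kHK] times the ceiling of [kK v_e / v_max], and [aP] the
    ceiling of [kK p_e] minus 1. The latter is strictly below [kK p_e], so a feasible solution stays
    feasible after rounding. *)
Definition cquant_body : cmd :=
  cld ;; cprods ;; cmul vt1 vt1 vK ;; cdivup vq vt1 vt2 ;; cmul vt1 vq vHK ;; CStore aC ve vt1 ;;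
  cmul vt1 vpn vK ;; cdivup vq vt1 vpd ;; CSub vq vq vone ;; CStore aP ve vq.

Definition cquant : cmd := cfor ve vm vd cquant_body.

Definition cdecide : cmd :=
  CLoad vu aU ve ;; CLoad vv aV ve ;; CLoad vx aY vu ;; CLoad vy aY vv ;; CAdd vx vx vy ;;
  CLoad vq aP ve ;; cmul vt1 vx vq ;; CLoad vx aZ vu ;; CLoad vy aZ vv ;; CAdd vx vx vy ;;
  cmul vt2 vx vKK ;; CAdd vt1 vt1 vt2 ;; CLoad vq aC ve ;; CSub vdd vq vt1 ;;
  CIf vdd (CStore aX ve vone) (CStore aX ve vdd).

Definition capply_body : cmd :=
  CLoad vdd aX ve ;;
  CIf vdd (CLoad vu aU ve ;; CLoad vv aV ve ;; CLoad vq aP ve ;;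
           CLoad vx aY vu ;; CAdd vx vx vq ;; CStore aY vu vx ;;
           CLoad vx aY vv ;; CAdd vx vx vq ;; CStore aY vv vx ;;
           CLoad vx aZ vu ;; CAdd vx vx vone ;; CStore aZ vu vx ;;
           CLoad vx aZ vv ;; CAdd vx vx vone ;; CStore aZ vv vx ;;
           CLoad vx aCNT ve ;; CAdd vx vx vone ;; CStore aCNT ve vx) CSkip.

Definition cdrop : cmd :=
  CLoad vx aY ve ;; CSub vx vx vK ;; CStore aY ve vx ;;
  CLoad vx aZ ve ;; CLoad vy aT ve ;; CSub vx vx vy ;; CStore aZ ve vx.

(** The decisions of an iteration are first collected in [aX], so that all of them see the same
    multipliers, and only then applied. *)
Definition clp : cmd :=
  CConst mz 0 ;; CAdd vit vR mz ;;
  CWhile vit (cfor ve vm vd cdecide ;; cfor ve vm vd capply_body ;; cfor ve vn vd cdrop ;;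
              CSub vit vit vone).

(** Transitivity of [x/y <= a/b <= w/z] in cross-multiplied form. *)
Lemma frac_trans a b x y z w : 0 < b -> x * b <= a * y -> a * z <= b * w -> x * z <= w * y.
Proof.
move=> b0 H1 H2; rewrite -(leq_pmul2l b0).
apply: (@leq_trans (a * y * z)); first by rewrite mulnA (mulnC b) leq_mul2r H1 orbT.
by rewrite mulnAC [X in _ <= X]mulnA leq_mul2r H2 orbT.
Qed.

Definition lpst : Type := ((nat -> nat) * (nat -> nat) * (nat -> nat))%type.

Section Env.
Variables (r : seq bool) (coins : nat -> bool).
Local Notation spec := (spec r coins).
Variables (n m kK kKK kHK kR kb L : nat) (U V PN PD WN WD T : nat -> nat).

Definition Env (s : hst) : Prop :=
  [/\ [/\ rd s 0 vone = 1, rd s 0 vn = n, rd s 0 vm = m, rd s 0 vK = kK & rd s 0 vKK = kKK],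
      [/\ rd s 0 vHK = kHK, rd s 0 vR = kR, rd s 0 vbeta = kb & rd s 0 vL = L],
      EdgeA U V PN PD WN WD m s & forall i, i < L -> rd s aPow i = 2 ^ i].

Definition evars : seq nat := [:: 0; 1; 2; 3; 4; 5; 6; 7; 8].
Definition earrs : seq nat := [:: 2; 3; 4; 5; 6; 7; 9].
Definition edisj (c : cmd) : bool :=
  ~~ has (fun x => x \in modv c) evars && ~~ has (fun x => x \in moda c) earrs.

Lemma Env_framed c s s' : edisj c -> framed c s s' -> Env s -> Env s'.
Proof.
move=> /andP[/hasPn Hv /hasPn Ha] [F1 F2 _] [[A1 A2 A3 A4 A5] [A6 A7 A8 A9] A10 A11].
have G1 x : x \in evars -> rd s' 0 x = rd s 0 x by move=> Hx; apply/F1/Hv.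
have G2 j k : j \in earrs -> rd s' j k = rd s j k.
  by move=> Hj; apply: F2; [case: j Hj | apply: Ha].
split; [split|split| |]; rewrite ?G1 //.
  by move=> e He; rewrite !G2 //; apply: A10.
by move=> i Hi; rewrite G2 //; apply: A11.
Qed.

Lemma Env_wr s x v : Env s -> x \notin evars -> Env (wr s 0 x v).
Proof.
move=> H Hx; apply: (@Env_framed (CConst x v) s); last by [].
  apply/andP; split=> //; apply/hasPn => y Hy; rewrite inE.
  by apply: contraNneq Hx => <-.
split=> [y|j k Hj _|_]; rewrite ?rdE /= ?inE.
- by move/negbTE ->.
- by rewrite (negbTE Hj).
- by [].
Qed.

Hypothesis PNL : forall e, e < m -> PN e < 2 ^ L.
Hypothesis PDL : forall e, e < m -> 0 < PD e < 2 ^ L.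
Hypothesis WNL : forall e, e < m -> WN e < 2 ^ L.
Hypothesis WDL : forall e, e < m -> 0 < WD e < 2 ^ L.
Hypothesis KL : kK < 2 ^ L.
Hypothesis KKL : kKK < 2 ^ L.
Hypothesis HKL : kHK < 2 ^ L.

Lemma spec_mulE dst x y s X Y :
  x \notin [:: macc; mi; my; mt; md; mz] -> y != mz -> edisj (cmul dst x y) ->
  Env s -> rd s 0 x = X -> rd s 0 y = Y -> Y < 2 ^ L ->
  spec (cmul dst x y) s (Kmul L) (fun s' => [/\ rd s' 0 dst = X * Y, Env s' &
     framed (cmul dst x y) s s']).
Proof.
move=> Hx Hy Hd HE HX HY HL; case: (HE) => [[A1 A2 A3 A4 A5] [A6 A7 A8 A9] A10 A11].
have H := spec_mul r coins dst Hx Hy A1 A9 A11 HX HY HL.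
apply: spec_weak (spec_frame _ H) (leqnn _) _ => // s' [B1 B2]; split=> //.
exact: Env_framed B2 HE.
Qed.

(** The last clause says that a nonzero maximum is attained: the edge [g] will serve as a feasible
    solution of value [A/B]. *)
Definition maxfrac (A B k : nat) : Prop :=
  [/\ 0 < B, forall f, f < k -> PN f * WN f * B <= A * (PD f * WD f) &
      A = 0 \/ exists2 g, g < k & A = PN g * WN g /\ B = PD g * WD g].

Definition LdE e (s : hst) : Prop :=
  [/\ rd s 0 vpn = PN e, rd s 0 vpd = PD e, rd s 0 vwn = WN e & rd s 0 vwd = WD e].

Lemma spec_ldprods s e A B : e < m -> Env s -> rd s 0 ve = e -> rd s 0 vNA = A -> rd s 0 vNB = B ->
  spec (cld ;; cprods) s (28 + 4 * Kmul L) (fun s' =>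
    [/\ Env s', LdE e s', rd s' 0 vt1 = B * PN e * WN e & rd s' 0 vt2 = A * PD e * WD e] /\
    framed (cld ;; cprods) s s').
Proof.
move=> He HE Hve HA HB; apply: spec_frame => //.
case: (HE) => [[A1 A2 A3 A4 A5] [A6 A7 A8 A9] A10 A11].
have [B1 B2 B3 B4 [B5 B6]] := A10 _ He.
rewrite /cld; do 4 at1; rewrite Hve B3 B4 B5 B6; set s0 := wr _ _ _ _.
have E0 : Env s0 by rewrite /s0; do 4 apply: Env_wr => //.
have L0 : LdE e s0 by rewrite /s0; split; rewrite !rdE.
have [HP1 HP2 HP3 HP4] := And4 (PNL He) (PDL He) (WNL He) (WDL He).
case/andP: HP2 => _ HP2; case/andP: HP4 => _ HP4.
have LdF c s1 s2 : framed c s1 s2 -> ~~ has (fun x => x \in modv c) [:: vpn; vpd; vwn; vwd] ->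
    LdE e s1 -> LdE e s2.
  by move=> [F1 _ _] /hasPn Hh [G1 G2 G3 G4]; split; rewrite F1 //; apply: Hh.
rewrite /cprods.
case: (L0) => G1 G2 G3 G4.
apply: (spec_then (spec_mulE (dst := vt1) (X := B) _ _ _ E0 _ G1 HP1)) => //; [by rewrite /s0 !rdE|lia|].
move=> s1 [C1 C2 C3]; have [F1 _ _] := C3; have L1 := LdF _ _ _ C3 isT L0.
case: (L1) => {G1 G2 G3 G4} G1 G2 G3 G4.
apply: (spec_then (spec_mulE (dst := vt1) _ _ _ C2 C1 G3 HP3)) => //; first lia.
move=> s2 [D1 D2 D3]; have [F2 _ _] := D3; have L2 := LdF _ _ _ D3 isT L1.
case: (L2) => {G1 G2 G3 G4} G1 G2 G3 G4.
apply: (spec_then (spec_mulE (dst := vt2) (X := A) _ _ _ D2 _ G2 HP2)) => //; [by rewrite F2 // F1 // /s0 !rdE|lia|].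
move=> s3 [J1 J2 J3]; have [F3 _ _] := J3; have L3 := LdF _ _ _ J3 isT L2.
case: (L3) => {G1 G2 G3 G4} G1 G2 G3 G4.
apply: spec_weak (spec_mulE (dst := vt2) _ _ _ J2 J1 G4 HP4) _ _ => //; first lia.
move=> s4 [M1 M2 M3]; have [F4 _ _] := M3; have L4 := LdF _ _ _ M3 isT L3.
by split=> //; rewrite F4 // F3.
Qed.

Lemma spec_argmax s : Env s ->
  spec cargmax s (m * (6 * Kmul L + 80) + 50) (fun s' => [/\ Env s',
    maxfrac (rd s' 0 vNA) (rd s' 0 vNB) m & framed cargmax s s']).
Proof.
move=> HE; suff H : spec cargmax s (m * (6 * Kmul L + 80) + 50)
   (fun s' => Env s' /\ maxfrac (rd s' 0 vNA) (rd s' 0 vNB) m).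
  by apply: spec_weak (spec_frame _ H) _ _ => // s' [[? ?] ?].
case: (HE) => [[A1 A2 A3 A4 A5] [A6 A7 A8 A9] A10 A11].
do 2 at1.
pose I k s' := Env s' /\ maxfrac (rd s' 0 vNA) (rd s' 0 vNB) k.
apply: (@spec_weak _ _ _ _ (m * (6 * Kmul L + 60 + 17) + 15) _ (I m)) => //; last lia.
apply: (spec_for (I := I)) => //; rewrite ?rdE //.
- split; first by do 4 apply: Env_wr => //.
  by rewrite !rdE /=; split=> //; left.
- move=> e s1 He Hve Hm H1 [B1 [B2 B3 B4]].
  rewrite /cargmax_body; apply: spec_assoc'.
  apply: (spec_then (spec_ldprods He B1 Hve erefl erefl)); first lia.
  move=> s2 [[C1 [L1 L2 L3 L4] C3 C4] [F1 _ _]].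
  have FA : rd s2 0 vNA = rd s1 0 vNA by apply: F1.
  have FB : rd s2 0 vNB = rd s1 0 vNB by apply: F1.
  have /andP[PD0 PD1] := PDL He; have /andP[WD0 WD1] := WDL He.
  at1; apply: spec_if; first lia; rewrite !rdE /= C3 C4 => Hd.
    have E0 : Env (wr s2 0 vdd (rd s1 0 vNB * PN e * WN e - rd s1 0 vNA * PD e * WD e)).
      exact: Env_wr.
    apply: (spec_then (spec_mulE (dst := vNA) (X := PN e) _ _ _ E0 _ _ (WNL He))) => //;
      rewrite ?rdE //; first lia.
    move=> s3 [D1 D2 [F3 _ _]].
    apply: spec_weak (spec_mulE (dst := vNB) (X := PD e) _ _ _ D2 _ _ WD1) _ _ => //;
      rewrite ?F3 ?rdE //; first lia.
    move=> s4 [G1 G2 [F4 _ _]]; split; first by do 2 apply: Env_wr => //.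
    rewrite !rdE /= G1 (F4 vNA) // D1; split; first by rewrite muln_gt0 PD0.
      move=> f; rewrite ltnS leq_eqVlt => /orP[/eqP ->|Hf]; first by [].
      have /andP[PDf _] := PDL (ltn_trans Hf He); have /andP[WDf _] := WDL (ltn_trans Hf He).
      have Hf' := B3 _ Hf.
      have {}Hd : rd s1 0 vNA * PD e * WD e <= rd s1 0 vNB * PN e * WN e by lia.
      by apply: (frac_trans B2 Hf'); rewrite !mulnA.
    by right; exists e.
  at0; split; first by do 3 apply: Env_wr => //.
  rewrite !rdE /= FA FB; split=> //.
    move=> f; rewrite ltnS leq_eqVlt => /orP[/eqP ->|Hf]; last exact: B3.
    by move: Hd; set a := rd s1 0 vNA; set b := rd s1 0 vNB => Hd; rewrite mulnC !mulnA; lia.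
  by case: B4 => [->|[g Hg E]]; [left|right; exists g => //; apply: ltnW].
Qed.

(** A ceiling stated without division. If [A = 0], the two inequalities force [q = 0]. *)
Definition goodC (A B e c : nat) : Prop := exists q, [/\ c = q * kHK,
  B * PN e * WN e * kK <= q * (A * PD e * WD e) &
  0 < q -> q.-1 * (A * PD e * WD e) < B * PN e * WN e * kK].
Definition goodP (e p : nat) : Prop := p * PD e < PN e * kK <= p.+1 * PD e.


Lemma Env_wra s j k v : Env s -> j != 0 -> j \notin earrs -> Env (wr s j k v).
Proof.
move=> H Hj Hx; apply: (@Env_framed (CStore j 0 0) s); last by [].
  apply/andP; split=> //; apply/hasPn => y Hy; rewrite inE.
  by apply: contraNneq Hx => <-.
split=> [y _|j' k' Hj' |_]; rewrite ?rdE /= ?inE.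
- by rewrite eq_sym (negbTE Hj).
- by move/negbTE ->.
- by [].
Qed.

Hypothesis PNPD : forall e, e < m -> 0 < PN e <= PD e.
Hypothesis K0 : 0 < kK.

Lemma spec_divupE q t d s A D Kb :
  uniq [:: vone; q; t; d] -> edisj (cdivup q t d) -> Env s -> rd s 0 t = A -> rd s 0 d = D ->
  A <= Kb * D ->
  spec (cdivup q t d) s (Kb * 17 + 8) (fun s' =>
    [/\ A <= rd s' 0 q * D, (0 < rd s' 0 q -> (rd s' 0 q).-1 * D < A), Env s' &
        framed (cdivup q t d) s s']).
Proof.
move=> Hu Hd HE HA HD HK; case: (HE) => [[A1 _ _ _ _] _ _ _].
apply: spec_weak (spec_frame _ (spec_divup r coins Hu A1 HA HD HK)) (leqnn _) _ => //.
by move=> s' [[B1 B2] B3]; split=> //; apply: Env_framed B3 HE.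
Qed.

Lemma spec_quant s A B : Env s -> rd s 0 vNA = A -> rd s 0 vNB = B -> maxfrac A B m ->
  spec cquant s (m * (7 * Kmul L + 34 * kK + 120) + 50) (fun s' => [/\ Env s',
    forall e, e < m -> goodC A B e (rd s' aC e), forall e, e < m -> goodP e (rd s' aP e) &
    framed cquant s s']).
Proof.
move=> HE HA HB [_ Hmax _].
suff H : spec cquant s (m * (7 * Kmul L + 34 * kK + 120) + 50) (fun s' => [/\ Env s',
    forall e, e < m -> goodC A B e (rd s' aC e) & forall e, e < m -> goodP e (rd s' aP e)]).
  by apply: spec_weak (spec_frame _ H) _ _ => // s' [[? ? ?] ?].
case: (HE) => [[A1 A2 A3 A4 A5] [A6 A7 A8 A9] A10 A11].
pose I k s' := [/\ Env s', rd s' 0 vNA = A /\ rd s' 0 vNB = B,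
  forall e, e < k -> goodC A B e (rd s' aC e) & forall e, e < k -> goodP e (rd s' aP e)].
apply: (@spec_weak _ _ _ _ (m * (7 * Kmul L + 34 * kK + 100 + 17) + 15) _ (I m)); last 2 first.
- lia.
- by move=> s' [? _ ? ?].
apply: (spec_for (I := I)) => //; rewrite ?rdE //.
  by split=> //; [do 2 apply: Env_wr => // | rewrite !rdE].
move=> e s1 He Hve Hm H1 [B1 [B2 B2'] B3 B4].
rewrite /cquant_body; apply: spec_assoc'.
apply: (spec_then (spec_ldprods He B1 Hve B2 B2')); first lia.
move=> s2 [[C1 [L1 L2 L3 L4] C3 C4] [F1 F1' _]].
apply: (spec_then (spec_mulE (dst := vt1) (Y := kK) _ _ _ C1 C3 _ KL)) => //;
  [by case: C1 => [[]]|lia|].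
move=> s3 [D1 D2 [F2 F2' _]].
have Hle : B * PN e * WN e * kK <= kK * (A * PD e * WD e).
  by rewrite mulnC leq_mul2l; apply/orP; right; have := Hmax _ He; rewrite -!mulnA mulnA mulnC !mulnA.
apply: (spec_then (spec_divupE (q := vq) (t := vt1) (d := vt2) _ _ D2 D1 _ Hle)) => //;
  [by rewrite F2|lia|].
move=> s4 [E1 E2 E3 [F3 F3' _]].
have E3' : rd s4 0 vHK = kHK by case: E3 => _ [].
apply: (spec_then (spec_mulE (dst := vt1) (x := vq) _ _ _ E3 erefl E3' HKL)) => //; first lia.
move=> s5 [G1 G2 [F4 F4' _]]; at1.
have Hve5 : rd s5 0 ve = e by rewrite F4 // F3 // F2 // F1.
set s6 := wr _ _ _ _.
have G3 : Env s6 by apply: Env_wra.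
apply: (spec_then (spec_mulE (dst := vt1) (x := vpn) (X := PN e) (Y := kK) _ _ _ G3 _ _ KL)) => //.
- by rewrite /s6 rdE /= F4 // F3 // F2.
- by case: G3 => [[]].
- lia.
move=> s7 [M1 M2 [F5 F5' _]].
have /andP[p0 p1] := PNPD He.
have Hle2 : PN e * kK <= kK * PD e by rewrite mulnC leq_mul2l p1 orbT.
apply: (spec_then (spec_divupE (q := vq) (t := vt1) (d := vpd) _ _ M2 M1 _ Hle2)) => //.
- by rewrite F5 // /s6 rdE /= F4 // F3 // F2.
- lia.
move=> s8 [N1 N2 N3 [F6 F6' _]].
have one8 : rd s8 0 vone = 1 by case: N3 => [[]].
have Hve8 : rd s8 0 ve = e by rewrite F6 // F5 // /s6 rdE /=.
at1; at0; rewrite one8 Hve8.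
have q0 : 0 < rd s8 0 vq.
  by case: (posnP (rd s8 0 vq)) N1 => // ->; rewrite mul0n leqn0 muln_eq0; lia.
split.
- by do 2 apply: Env_wr => //; apply: Env_wra => //; apply: Env_wr.
- by rewrite !rdE /= !F6 // !F5 // /s6 !rdE /= !F4 // !F3 // !F2 // !F1.
- move=> f; rewrite ltnS leq_eqVlt !rdE /= F6' // F5' // /s6 !rdE /= Hve5.
  case: (eqVneq f e) => [-> _|_ /= Hf].
    by exists (rd s4 0 vq); split.
  by rewrite F4' // F3' // F2' // F1' //; apply: B3.
- move=> f; rewrite ltnS leq_eqVlt !rdE /=.
  case: (eqVneq f e) => [-> _|_ /= Hf].
    by rewrite /goodP subn1 prednK // N1 andbT N2.
  by rewrite F6' // F5' // /s6 !rdE /= F4' // F3' // F2' // F1' //; apply: B4.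
Qed.

Variables (P C : nat -> nat).
Hypothesis PL : forall e, e < m -> P e < 2 ^ L.
Hypothesis Un : forall e, e < m -> U e < n.
Hypothesis Vn : forall e, e < m -> V e < n.
Hypothesis UV : forall e, e < m -> U e != V e.

Definition incb (v e : nat) : bool := (U e == v) || (V e == v).
(** The factor [kKK = kK ^ 2] balances the two kinds of multipliers: an iteration raises a matching
    multiplier by up to [m kK], but a timeout multiplier only by up to [m]. *)
Definition lpX (st : lpst) (e : nat) : bool :=
  (st.1.1 (U e) + st.1.1 (V e)) * P e + (st.1.2 (U e) + st.1.2 (V e)) * kKK < C e.
Definition lpY1 (st : lpst) (k v : nat) : nat :=
  st.1.1 v + \sum_(e < k) (lpX st e && incb v e) * P e.
Definition lpZ1 (st : lpst) (k v : nat) : nat :=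
  st.1.2 v + \sum_(e < k) (lpX st e && incb v e).
Definition lpstep (st : lpst) : lpst :=
  (fun v => lpY1 st m v - kK, fun v => lpZ1 st m v - T v, fun e => st.2 e + lpX st e).

Definition PCT (s : hst) : Prop :=
  [/\ Env s, forall e, e < m -> rd s aP e = P e, forall e, e < m -> rd s aC e = C e &
    forall v, v < n -> rd s aT v = T v].
Definition lprel (s : hst) (st : lpst) : Prop :=
  [/\ forall v, v < n -> rd s aY v = st.1.1 v, forall v, v < n -> rd s aZ v = st.1.2 v &
    forall e, e < m -> rd s aCNT e = st.2 e].

Lemma PCT_framed c s s' : edisj c -> ~~ has (fun x => x \in moda c) [:: aP; aC; aT] ->
  framed c s s' -> PCT s -> PCT s'.
Proof.
move=> H1 /hasPn H2 F [A1 A2 A3 A4]; case: (F) => _ F2 _.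
by split; [apply: Env_framed F A1|move=> e He; rewrite F2 ?H2 //; auto..].
Qed.

Lemma spec_decide s st : PCT s -> lprel s st ->
  spec (cfor ve vm vd cdecide) s (m * (2 * Kmul L + 150) + 15) (fun s' =>
    [/\ PCT s', lprel s' st, forall e, e < m -> rd s' aX e = lpX st e &
      framed (cfor ve vm vd cdecide) s s']).
Proof.
move=> HP HR.
suff H : spec (cfor ve vm vd cdecide) s (m * (2 * Kmul L + 150) + 15) (fun s' =>
    forall e, e < m -> rd s' aX e = lpX st e).
  apply: spec_weak (spec_frame _ H) _ _ => // s' [A1 A2]; split=> //.
    exact: PCT_framed A2 HP.
  by case: HR A2 => [B1 B2 B3] [_ F _]; split=> x Hx; rewrite F //; auto.
pose I k s' := [/\ PCT s', lprel s' st & forall e, e < k -> rd s' aX e = lpX st e].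
apply: (@spec_weak _ _ _ _ (m * (2 * Kmul L + 133 + 17) + 15) _ (I m)); last 2 first.
- lia.
- by move=> s' [].
case: (HP) => [[[A1 A2 A3 A4 A5] _ A6 _] A7 A8 A9].
have PCTv s0 x v : PCT s0 -> x \notin evars -> PCT (wr s0 0 x v).
  move=> [B1 B2 B3 B4] Hx; split; first (exact: Env_wr);
    by move=> y Hy; rewrite !rdE /=; auto.
have lpv s0 x v : lprel s0 st -> lprel (wr s0 0 x v) st.
  by move=> [B1 B2 B3]; split=> y Hy; rewrite !rdE /=; auto.
apply: (spec_for (I := I)) => //; first by split; [do 2 apply/PCTv => //|do 2 apply/lpv => //|].
move=> e s1 He Hve Hm H1 [B1 B2 B3].
case: (B1) => [[[_ _ _ _ HKK] _ B4 _] B5 B6 B7]; case: (B2) => [B8 B9 B10].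
have [C1 C2 _ _ _] := B4 _ He.
rewrite /cdecide; do 6 at1; rewrite Hve C1 C2 !B8 ?B5 ?Un ?Vn //; set s2 := wr _ _ _ _.
have E2 : Env s2 by rewrite /s2; do 6 apply: Env_wr => //; case: B1.
apply: (spec_then (spec_mulE (dst := vt1) (x := vx) (y := vq) _ _ _ E2 erefl erefl _)) => //.
- by rewrite /s2 !rdE /=; apply: PL.
- lia.
rewrite {1 2}/s2 !rdE /= => s3 [D1 D2 [F1 F1' _]].
do 3 at1; rewrite !F1 // !F1' // /s2 !rdE /= !B9 ?Un ?Vn //; set s4 := wr _ _ _ _.
have E4 : Env s4 by rewrite /s4; do 3 apply: Env_wr => //.
apply: (spec_then (spec_mulE (dst := vt2) (x := vx) (y := vKK) (Y := kKK) _ _ _ E4 erefl _ KKL)) => //.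
- by case: E4 => [[]].
- lia.
rewrite {1}/s4 !rdE /= => s5 [G1 G2 [F2 F2' _]].
do 3 at1.
have -> : rd s5 0 ve = e by rewrite F2 // /s4 !rdE /= F1 // /s2 !rdE /=.
have -> : rd s5 aC e = C e by rewrite F2' // /s4 !rdE /= F1' // /s2 !rdE /= B6.
have -> : rd s5 0 vt1 = (st.1.1 (U e) + st.1.1 (V e)) * P e by rewrite F2 // /s4 !rdE.
rewrite G1.
have Hone : rd s5 0 vone = 1 by case: G2 => [[]].
have Hve5 : rd s5 0 ve = e by rewrite F2 // /s4 !rdE /= F1 // /s2 !rdE /=.
have Hlp : lprel s5 st.
  by case: B2 => [K1 K2 K3]; split=> y Hy; rewrite F2' // /s4 !rdE /= F1' // /s2 !rdE /=; auto.
have HPCT : PCT s5.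
  by split=> // y Hy; rewrite F2' // /s4 !rdE /= F1' // /s2 !rdE /=; auto.
have HX f : f < e -> rd s5 aX f = lpX st f.
  by move=> Hf; rewrite F2' // /s4 !rdE /= F1' // /s2 !rdE /=; auto.
have PCTa s0 k v : PCT s0 -> PCT (wr s0 aX k v).
  move=> [K1 K2 K3 K4]; split; first (exact: Env_wra); by move=> y Hy; rewrite !rdE /=; auto.
have lpa s0 k v : lprel s0 st -> lprel (wr s0 aX k v) st.
  by move=> [K1 K2 K3]; split=> y Hy; rewrite !rdE /=; auto.
apply: spec_if; first lia; rewrite !rdE /= => Hd; at0; rewrite ?Hone ?Hve5.
  split; [by do 2 apply/PCTv => //; apply/PCTa; do 3 apply/PCTv => //|by do 2 apply/lpv => //; apply/lpa; do 3 apply/lpv|].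
  move=> f; rewrite ltnS leq_eqVlt !rdE /=; case: (eqVneq f e) => [-> _|_ /= /HX] //.
  by rewrite /lpX; case: ltnP => //; lia.
split; [by do 2 apply/PCTv => //; apply/PCTa; do 3 apply/PCTv => //|by do 2 apply/lpv => //; apply/lpa; do 3 apply/lpv|].
move=> f; rewrite ltnS leq_eqVlt !rdE /=; case: (eqVneq f e) => [-> _|_ /= /HX] //.
by rewrite /lpX; case: ltnP => //; lia.
Qed.


Lemma spec_apply s st : PCT s -> lprel s st -> (forall e, e < m -> rd s aX e = lpX st e) ->
  spec (cfor ve vm vd capply_body) s (m * 160 + 15) (fun s' =>
    [/\ PCT s', lprel s' (lpY1 st m, lpZ1 st m, fun e => st.2 e + lpX st e) &
      framed (cfor ve vm vd capply_body) s s']).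
Proof.
move=> HP HR HX.
pose I k s' := [/\ [/\ forall v, v < n -> rd s' aY v = lpY1 st k v,
  forall v, v < n -> rd s' aZ v = lpZ1 st k v,
  forall e, e < m -> rd s' aCNT e = st.2 e + (e < k) * lpX st e &
  forall e, e < m -> rd s' aX e = lpX st e], EdgeA U V PN PD WN WD m s' &
  forall e, e < m -> rd s' aP e = P e].
suff H : spec (cfor ve vm vd capply_body) s (m * 160 + 15) (I m).
  apply: spec_weak (spec_frame _ H) _ _ => // s' [[[A1 A2 A3 A4] _ _] A6]; split=> //.
    exact: PCT_framed A6 HP.
  by split=> //= e He; rewrite A3 // He mul1n.
apply: (@spec_weak _ _ _ _ (m * (143 + 17) + 15) _ (I m)) => //.
case: (HP) => [[[A1 A2 A3 A4 A5] _ A6 _] A7 A8 A9]; case: (HR) => [R1 R2 R3].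
apply: (spec_for (I := I)) => //.
  split; first split; move=> v Hv; rewrite !rdE /=;
    rewrite /lpY1 /lpZ1 ?big_ord0 ?addn0 ?mul0n ?addn0; auto.
move=> e s1 He Hve Hm H1 [[B1 B2 B3 B4] B5 B6].
have [C1 C2 _ _ _] := B5 _ He.
rewrite /capply_body; at1; rewrite Hve B4 //.
have Sv v : lpY1 st e.+1 v = lpY1 st e v + (lpX st e && incb v e) * P e.
  by rewrite /lpY1 big_ord_recr addnA.
have Sz v : lpZ1 st e.+1 v = lpZ1 st e v + (lpX st e && incb v e).
  by rewrite /lpZ1 big_ord_recr addnA.
have Hc f : f != e -> (f < e.+1) = (f < e) by rewrite ltnS leq_eqVlt => /negbTE ->.
apply: spec_if; first lia; rewrite !rdE /= => Hx.
  have {}Hx : lpX st e by move: Hx; case: (lpX st e).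
  do 17 at1; at0; rewrite Hve C1 C2 H1 (B6 _ He) (eq_sym (V e)) (negbTE (UV He)).
  split; first split; move=> v Hv; rewrite !rdE /=.
  - rewrite Sv Hx /incb /= !(eq_sym _ v).
    have := UV He; case: (eqVneq v (V e)) => [->|_]; first by rewrite eq_sym => /negbTE -> ; rewrite B1 ?mul1n //; apply: Vn.
    by case: (eqVneq v (U e)) => [->|_] _; rewrite B1 ?mul1n ?mul0n ?addn0 //; apply: Un.
  - rewrite Sz Hx /incb /= !(eq_sym _ v).
    have := UV He; case: (eqVneq v (V e)) => [->|_]; first by rewrite eq_sym => /negbTE ->; rewrite B2 //; apply: Vn.
    by case: (eqVneq v (U e)) => [->|_] _; rewrite B2 ?addn0 //; apply: Un.
  - case: (eqVneq v e) => [->|Hve']; last by rewrite B3 // Hc.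
    by rewrite B3 // ltnn ltnSn Hx mul0n addn0.
  - exact: B4.
  - exact: B5.
  - exact: B6.
have {}Hx : lpX st e = false by move: Hx; case: (lpX st e).
at0; split; first split; move=> v Hv; rewrite !rdE /=.
- by rewrite Sv Hx mul0n addn0 B1.
- by rewrite Sz Hx addn0 B2.
- rewrite B3 //; case: (eqVneq v e) => [->|Hve']; last by rewrite Hc.
  by rewrite Hx !muln0.
- exact: B4.
- exact: B5.
- exact: B6.
Qed.

Lemma spec_drop s st : PCT s -> lprel s st ->
  spec (cfor ve vn vd cdrop) s (n * 70 + 15) (fun s' =>
    [/\ PCT s', lprel s' (fun v => st.1.1 v - kK, fun v => st.1.2 v - T v, st.2) &
      framed (cfor ve vn vd cdrop) s s']).
Proof.
move=> HP HR.
pose I k s' := [/\ forall v, v < n -> rd s' aY v = if v < k then st.1.1 v - kK else st.1.1 v,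
  forall v, v < n -> rd s' aZ v = if v < k then st.1.2 v - T v else st.1.2 v,
  forall v, v < n -> rd s' aT v = T v & rd s' 0 vK = kK].
case: (HP) => [[[A1 A2 A3 A4 A5] _ A6 _] A7 A8 A9]; case: (HR) => [R1 R2 R3].
suff H : spec (cfor ve vn vd cdrop) s (n * 70 + 15) (I n).
  apply: spec_weak (spec_frame _ H) _ _ => // s' [[B1 B2 B3 B4] B5]; split=> //.
    exact: PCT_framed B5 HP.
  case: (B5) => _ F _; split=> /= v Hv; rewrite ?B1 ?B2 ?Hv //.
  by rewrite F // R3.
apply: (@spec_weak _ _ _ _ (n * (53 + 17) + 15) _ (I n)) => //.
apply: (spec_for (I := I)) => //.
  by split; [move=> v Hv; rewrite !rdE /=; auto..|rewrite !rdE].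
move=> k s1 Hk Hve Hm H1 [B1 B2 B3 B4].
rewrite /cdrop; do 6 at1; at0; rewrite Hve B1 // B2 // B3 // B4 ltnn.
split; last by rewrite !rdE.
- move=> v Hv; rewrite !rdE /= ltnS leq_eqVlt; case: (eqVneq v k) => [->|_] //=; exact: B1.
- move=> v Hv; rewrite !rdE /= ltnS leq_eqVlt; case: (eqVneq v k) => [->|_] //=; exact: B2.
- by move=> v Hv; rewrite !rdE /=; apply: B3.
Qed.

Definition Klp : nat := m * (2 * Kmul L + 310) + n * 70 + 100.

Lemma spec_lp s st : PCT s -> lprel s st ->
  spec clp s (kR * Klp + 50) (fun s' =>
    [/\ PCT s', lprel s' (iter kR lpstep st) & framed clp s s']).
Proof.
move=> HP HR.
suff H : spec clp s (kR * Klp + 50) (fun s' => PCT s' /\ lprel s' (iter kR lpstep st)).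
  by apply: spec_weak (spec_frame _ H) _ _ => // s' [[A1 A1'] A2].
have PCTv s0 x v : PCT s0 -> x \notin evars -> PCT (wr s0 0 x v).
  move=> [B1 B2 B3 B4] Hx; split; first (exact: Env_wr);
    by move=> y Hy; rewrite !rdE /=; auto.
have lpv s0 x v st0 : lprel s0 st0 -> lprel (wr s0 0 x v) st0.
  by move=> [B1 B2 B3]; split=> y Hy; rewrite !rdE /=; auto.
do 2 at1.
have HR0 : rd s 0 vR = kR by case: HP => [[_ []]].
rewrite HR0 addn0.
pose I k s' := [/\ PCT s', lprel s' (iter (kR - k) lpstep st) & k <= kR].
apply: (@spec_weak _ _ _ _ (kR * (m * (2 * Kmul L + 310) + n * 70 + 97 + 3) + 1) _ (I 0)); last 2 first.
- by rewrite /Klp; lia.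
- by move=> s' []; rewrite subn0.
apply: (spec_down (I := I)) => //; first by rewrite !rdE.
  by split=> //; [do 2 apply/PCTv => //|rewrite subnn; do 2 apply/lpv].
move=> k s1 Hk Hi [B1 B2 B3].
apply: (spec_then (spec_decide B1 B2)); first lia; move=> s2 [C1 C2 C3 [F1 _ _]].
apply: (spec_then (spec_apply C1 C2 C3)); first lia; move=> s3 [D1 D2 [F2 _ _]].
apply: (spec_then (spec_drop D1 D2)); first lia; move=> s4 [E1 E2 [F3 _ _]].
have Hone : rd s4 0 vone = 1 by case: E1 => [[[]]].
at0; split; first by rewrite ?rdE /= F3 // F2 // F1 // Hi Hone subn1.
split; [exact: PCTv|apply: lpv|exact: ltnW].
have -> : kR - k = (kR - k.+1).+1 by lia.
by rewrite iterS.
Qed.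

End Env.
End LinearProgram.
Export LinearProgram.

(** * The rounds of random probing as a program *)

Module Probing.
Local Open Scope nat_scope.

(** Legality is kept in the arrays: a probed edge gets count 0, below which no random number lies,
    and [aT] holds the remaining timeout of a vertex, or 0 once it is matched. A legal probe is then
    recognized by three tests for nonzero. *)
Definition cprobe_edge : cmd :=
  CProbe ve vdd ;; CConst mz 0 ;; CStore aCNT ve mz ;;
  CSub vx vx vone ;; CStore aT vu vx ;; CSub vy vy vone ;; CStore aT vv vy ;;
  CIf vdd (CStore aT vu mz ;; CStore aT vv mz) CSkip.

(** The coins are tossed before any test. Each position of the edge sequence therefore consumes
    exactly [vbeta] coins, and decisions at different positions use disjoint blocks. *)
Definition cprobe_body : cmd :=
  ccoins ;; CLoad vx aCNT ve ;; CSub vdd vx vuu ;;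
  CIf vdd (CLoad vu aU ve ;; CLoad vx aT vu ;;
    CIf vx (CLoad vv aV ve ;; CLoad vy aT vv ;; CIf vy cprobe_edge CSkip) CSkip) CSkip.

Definition cprobe (N : nat) : cmd :=
  CConst vit N ;; CWhile vit (cfor ve vm vd cprobe_body ;; CSub vit vit vone).

Section Process.
Variables (I : instance) (cnt : nat -> nat) (kb : nat) (r : seq bool) (coins : nat -> bool).

Definition probe_item (pos e : nat) (h : history) : history :=
  if (uval coins pos kb < cnt e) && legal_probe I h e then rcons h (e, nth false r e) else h.

Fixpoint proc (pos : nat) (l : seq nat) (h : history) : history :=
  if l is e :: l' then proc (pos + kb) l' (probe_item pos e h) else h.

Lemma proc_cat pos l1 l2 h :
  proc pos (l1 ++ l2) h = proc (pos + size l1 * kb) l2 (proc pos l1 h).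
Proof.
elim: l1 pos h => [|e l1 IH] pos h /=; first by rewrite addn0.
by rewrite IH mulSn addnA.
Qed.

End Process.

Lemma legal_history_rcons I h x :
  legal_history I (rcons h x) = legal_history I h && legal_probe I h x.1.
Proof.
rewrite /legal_history size_rcons -addn1 iotaD all_cat /= add0n andbT.
rewrite nth_rcons ltnn eqxx -cats1 take_size_cat //; congr (_ && _).
by apply: eq_in_all => i; rewrite mem_iota /= add0n => Hi; rewrite takel_cat ?nth_cat ?Hi // ltnW.
Qed.

Lemma legal_probe_item I cnt kb r coins pos e h :
  legal_history I h -> legal_history I (probe_item I cnt kb r coins pos e h).
Proof. by rewrite /probe_item; case: ifP => // /andP[_ H] Hh; rewrite legal_history_rcons Hh. Qed.

Lemma legal_proc I cnt kb r coins pos l h :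
  legal_history I h -> legal_history I (proc I cnt kb r coins pos l h).
Proof. by elim: l pos h => //= e l IH pos h H; apply/IH/legal_probe_item. Qed.

Section Probe.
Variables (r : seq bool) (coins : nat -> bool).
Local Notation spec := (spec r coins).
Variables (n m kK kKK kHK kR kb L : nat) (U V PN PD WN WD : nat -> nat).
Variables (I : instance) (cnt : nat -> nat).
Hypothesis Hm : m = nE I.
Hypothesis HU : forall e, e < m -> ends I e = (U e, V e).
Hypothesis Un : forall e, e < m -> U e < n.
Hypothesis Vn : forall e, e < m -> V e < n.
Hypothesis UV : forall e, e < m -> U e != V e.

Local Notation Env := (Env n m kK kKK kHK kR kb L U V PN PD WN WD).

Definition Pinv (h : history) (s : hst) : Prop :=
  [/\ Env s, hh s = h, forall e, e < m -> rd s aCNT e = (if e \in map fst h then 0 else cnt e) &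
    forall v, v < n -> rd s aT v = (if matched I h v then 0 else t_ I v - nprobed I h v)].

Lemma matched_rcons h e o v : matched I (rcons h (e, o)) v = (o && incident I v e) || matched I h v.
Proof. by rewrite /matched has_rcons. Qed.
Lemma nprobed_rcons h e o v : nprobed I (rcons h (e, o)) v = nprobed I h v + incident I v e.
Proof. by rewrite /nprobed -cats1 count_cat /= addn0. Qed.

Lemma Pinv_wr h s x v : Pinv h s -> x \notin evars -> Pinv h (wr s 0 x v).
Proof.
move=> [A1 A2 A3 A4] Hx; split; first (exact: Env_wr); first by rewrite rdE.
  by move=> e He; rewrite rdE /= A3.
by move=> e He; rewrite rdE /= A4.
Qed.

Lemma spec_probe_item s e h : Pinv h s -> e < m -> rd s 0 ve = e ->
  spec cprobe_body s (kb * 31 + 200) (fun s' =>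
    Pinv (probe_item I cnt kb r coins (hc s) e h) s' /\ hc s' = hc s + kb).
Proof.
move=> HP He Hve; case: (HP) => [HE Hh HC HT].
case: (HE) => [[A1 A2 A3 A4 A5] [A6 A7 A8 A9] A10 A11].
have [B1 B2 _ _ _] := A10 _ He.
apply: (spec_then (spec_frame _ (spec_coins r coins A1 A8))) => //; first lia.
move=> s1 [[C1 C2 C3] F]; case: (F) => F1 F2 _.
have HE1 : Env s1 by apply: Env_framed F HE.
have HP1 : Pinv h s1.
  by split=> //; [rewrite C3 | move=> x Hx; rewrite F2 //; auto..].
have Hve1 : rd s1 0 ve = e by rewrite F1.
rewrite -C2; move: (C1) => Huv; have {}C2 : hc s1 = hc s + kb by [].
have Lg : legal_probe I h e = [&& e \notin map fst h, ~~ matched I h (U e), ~~ matched I h (V e),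
    nprobed I h (U e) < t_ I (U e) & nprobed I h (V e) < t_ I (V e)].
  by rewrite /legal_probe HU // -Hm He.
case: HP1 => [_ Hh1 HC1 HT1].
have HP1 : Pinv h s1 by [].
case: (HE1) => [[A1' _ _ _ _] _ A10' _]; have [B1' B2' _ _ _] := A10' _ He.
do 2 at1; rewrite Hve1 HC1 // Huv.
rewrite /probe_item Lg.
apply: spec_if; [lia| |]; rewrite !rdE /= => Hd; last first.
  at0; have -> : (uval coins (hc s) kb < cnt e) && [&& e \notin map fst h, ~~ matched I h (U e),
    ~~ matched I h (V e), nprobed I h (U e) < t_ I (U e) & nprobed I h (V e) < t_ I (V e)] = false.
    by move: Hd; case: (e \in _) => /=; rewrite ?andbF // => Hd; apply/negbTE; rewrite negb_and -leqNgt; lia.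
  split; last by rewrite ?rdE.
  by do 2 apply: Pinv_wr => //.
have [Hnin Hlt] : (e \notin map fst h) /\ uval coins (hc s) kb < cnt e.
  by move: Hd; case: (e \in _) => /=; split=> //; lia.
rewrite Hnin Hlt /=; do 2 at1; rewrite Hve1 B1' HT1 ?Un //.
apply: spec_if; [lia| |]; rewrite !rdE /= => Hd2; last first.
  at0; have -> : [&& ~~ matched I h (U e), ~~ matched I h (V e), nprobed I h (U e) < t_ I (U e) &
     nprobed I h (V e) < t_ I (V e)] = false.
    move: Hd2; case: (matched I h (U e)) => //= Hd2.
    by apply/negbTE; rewrite !negb_and -!leqNgt; lia.
  split; last by rewrite ?rdE.
  by do 4 apply: Pinv_wr => //.
do 2 at1; rewrite Hve1 B2' HT1 ?Vn //.
apply: spec_if; [lia| |]; rewrite !rdE /= => Hd3; last first.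
  at0; have -> : [&& ~~ matched I h (U e), ~~ matched I h (V e), nprobed I h (U e) < t_ I (U e) &
     nprobed I h (V e) < t_ I (V e)] = false.
    move: Hd3; case: (matched I h (V e)) => //= Hd3; first by rewrite !andbF.
    by apply/negbTE; rewrite !negb_and -!leqNgt; lia.
  split; last by rewrite ?rdE.
  by do 6 apply: Pinv_wr => //.
have [M1 M2] : ~~ matched I h (U e) /\ nprobed I h (U e) < t_ I (U e).
  by move: Hd2; case: (matched I h (U e)) => //= Hd2; split=> //; lia.
have [M3 M4] : ~~ matched I h (V e) /\ nprobed I h (V e) < t_ I (V e).
  by move: Hd3; case: (matched I h (V e)) => //= Hd3; split=> //; lia.
rewrite M1 M2 M3 M4 /=.
apply: spec_probe; first lia; rewrite !rdE /= Hve1; set o := nth false r e.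
have inc v : incident I v e = (v == U e) || (v == V e).
  by rewrite /incident HU //= !(eq_sym _ v).
have Env_tail s2 : Env s2 -> forall e' o', Env (logp s2 e' o').
  move=> HE2 e' o'; case: HE2 => [[? ? ? ? ?] [? ? ? ?] X1 X2].
  by split; [split|split|move=> x Hx; rewrite !rd_logp; apply: X1|move=> x Hx; rewrite rd_logp; apply: X2]; rewrite ?rd_logp.
rewrite (negbTE M1) (negbTE M3) in Hd2 Hd3 *.
do 6 at1; rewrite Hve1 A1'.
apply: spec_if; [lia| |]; rewrite !rdE /= => Ho.
  have {}Ho : o = true by move: Ho; case: (o).
  at1; at0; rewrite Ho; split; last by rewrite ?rdE.
  split.
  - do 2 (apply: Env_wra => //); do 2 (apply: Env_wra => //; apply: Env_wr => //); apply: Env_wra => //.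
    by apply: Env_wr => //; apply: Env_tail; do 7 apply: Env_wr => //.
  - by rewrite !rdE Hh1 ?Ho.
  - move=> f Hf; rewrite !rdE /= HC1 // map_rcons mem_rcons inE /=.
    by case: (eqVneq f e).
  - move=> v Hv; rewrite !rdE /= HT1 // matched_rcons nprobed_rcons inc /=.
    by case: (eqVneq v (V e)) => [_|_]; rewrite ?orbT //; case: (eqVneq v (U e)) => [_|_] //=; rewrite addn0.
have {}Ho : o = false by move: Ho; case: (o).
at0; rewrite Ho; split; last by rewrite ?rdE.
split.
- do 2 (apply: Env_wra => //; apply: Env_wr => //); apply: Env_wra => //.
  by apply: Env_wr => //; apply: Env_tail; do 7 apply: Env_wr => //.
- by rewrite !rdE Hh1 ?Ho.
- move=> f Hf; rewrite !rdE /= HC1 // map_rcons mem_rcons inE /=.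
  by case: (eqVneq f e).
- move=> v Hv; rewrite !rdE /= HT1 // matched_rcons nprobed_rcons inc /=.
  case: (eqVneq v (V e)) => [->|_].
    by rewrite orbT (negbTE M3) subnDA.
  by case: (eqVneq v (U e)) => [->|_] /=; rewrite ?(negbTE M1) ?subnDA ?addn0 ?subn0.
Qed.

Lemma spec_probe_phase s N : Pinv [::] s -> hc s = 0 ->
  spec (cprobe N) s (N * (m * (kb * 31 + 217) + 40) + 50) (fun s' =>
    hh s' = proc I cnt kb r coins 0 (flatten (nseq N (iota 0 m))) [::]).
Proof.
move=> HP Hc; at1.
pose hk k := proc I cnt kb r coins 0 (flatten (nseq (N - k) (iota 0 m))) [::].
pose J k s' := [/\ Pinv (hk k) s', hc s' = (N - k) * (m * kb) & k <= N].
apply: (@spec_weak _ _ _ _ (N * (m * (kb * 31 + 200 + 17) + 15 + 7 + 3) + 1) _ (J 0)); last 2 first.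
- nia.
- by move=> s' [[_ -> _ _] _ _]; rewrite /hk subn0.
apply: (spec_down (I := J)); [by rewrite rdE| | |by []].
  by split; rewrite ?rdE // /hk subnn //; apply: Pinv_wr.
move=> k s1 Hk Hit [A1 A2 A3].
pose J1 i s' := Pinv (proc I cnt kb r coins (hc s1) (iota 0 i) (hk k.+1)) s' /\ hc s' = hc s1 + i * kb.
case: (A1) => [[[B1 B2 B3 B4 B5] _ _ _] _ _ _].
have F : spec (cfor ve vm vd cprobe_body) s1 (m * (kb * 31 + 200 + 17) + 15) (J1 m).
  apply: (spec_for (I := J1)) => //.
    by split; [do 2 apply: Pinv_wr => //|rewrite !rdE addn0].
  move=> i s2 Hi Hve HH H1 [C1 C2].
  apply: spec_weak (spec_probe_item C1 Hi Hve) (leqnn _) _ => s3 [D1 D2].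
  split; last by rewrite !rdE D2 C2 mulSn; lia.
  do 2 apply: Pinv_wr => //; rewrite -addn1 iotaD proc_cat /= size_iota add0n.
  by rewrite -C2.
apply: (spec_then (spec_frame _ F)) => //; first lia.
move=> s2 [[C1 C2] [F1 _ _]].
have Hone : rd s2 0 vone = 1 by case: C1 => [[[]]].
at0; split; first by rewrite ?rdE F1 // Hit Hone subn1.
have E : N - k = (N - k.+1) + 1 by lia.
split; last exact: ltnW.
- apply: Pinv_wr => //; move: C1; rewrite /hk E A2; congr Pinv.
  rewrite nseqD flatten_cat /= cats0 proc_cat; congr proc.
  rewrite size_flatten /shape map_nseq size_iota sumn_nseq; lia.
- by rewrite !rdE C2 A2 E mulnDl mul1n.
Qed.

End Probe.
End Probing.
Export Probing.

(** * Moving the input from cells [k] to cells [16 k + 3] *)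

Module Prologue.
Local Open Scope nat_scope.

(* The input occupies the low cells, so no cell is free at the start.  Reversible
   additions turn the two header cells into a far address [S] from which [nV] and
   [nE] can still be recovered; cells 2..9 are saved from [S] on and become registers. *)
Definition fibl : seq bool := nseq 6 true ++ flatten (nseq 4 [:: false; true]).
Definition fwd (t : bool) : instr := if t then IAdd 0 0 1 else IAdd 1 1 0.
Definition bwd (t : bool) : instr := if t then ISub 5 5 6 else ISub 6 6 5.
Definition fib1 (t : bool) (x : nat * nat) : nat * nat :=
  if t then (x.1 + x.2, x.2) else (x.1, x.2 + x.1).

(** Cell 2 is saved first and at once becomes the constant 1, which advances the pointer in cell 0
    for the other seven. *)
Definition stash_code : seq instr :=
  [:: IStore 0 2; IConst 2 1] ++ flatten [seq [:: IAdd 0 0 2; IStore 0 k] | k <- iota 3 7].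

(** The additions are undone on copies in cells 5 and 6. Each subtraction cancels an addition, so
    truncation never occurs. *)
Definition recover_code : seq instr :=
  [:: IConst 3 7; ISub 4 0 3; IConst 3 0; IAdd 5 4 3; IAdd 6 1 3] ++ map bwd (rev fibl).

(** With [len = nV + 6 nE + 2], the extent of the input, this leaves the read pointer [len] in cell
    0, the counter [len - 10] in cell 1 and the write pointer [16 len + 3] in cell 7. *)
Definition setup_code : seq instr :=
  [:: IAdd 0 5 6; IAdd 0 0 6; IAdd 0 0 6; IAdd 0 0 6; IAdd 0 0 6; IAdd 0 0 6;
      IConst 7 8; ISub 1 0 7; IAdd 0 0 2; IAdd 0 0 2;
      IAdd 7 0 0; IAdd 7 7 7; IAdd 7 7 7; IAdd 7 7 7; IAdd 7 7 2; IAdd 7 7 2; IAdd 7 7 2;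
      IConst 8 16].

(** Cells move from the top down: the target [16 k + 3] lies above [k], so among the input cells it
    can only hit ones already moved. Cell 3 contains 0, which makes the last jump unconditional. *)
Definition loop_code (off : nat) : seq instr :=
  [:: IJz 1 (off + 7); ISub 1 1 2; ISub 0 0 2; ISub 7 7 8; ILoad 9 0; IStore 7 9; IJz 3 off].

(** Cell 3 is both the source of the constant 0 and the target of [nV]; it must be overwritten
    last. *)
Definition final_code : seq instr :=
  flatten [seq [:: ILoad (16 * k + 3) 4; IAdd 4 4 2] | k <- iota 2 8] ++
  [:: IAdd 19 6 3; IAdd 3 5 3].

Definition pre_code : seq instr := map fwd fibl ++ stash_code ++ recover_code ++ setup_code.
(** Without edges cell 1 is 0 and control passes directly to the exit. Otherwise there are two
    vertices and an edge, which the address arithmetic relies on. *)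
Definition prologue (fin : nat) : seq instr :=
  IJz 1 fin :: pre_code ++ loop_code (1 + size pre_code) ++ final_code.

Section Prologue.
Variables (P : program) (r : seq bool) (coins : nat -> bool).
Local Notation reach := (reach P r coins).

(** The ten low cells are represented by a list, so straight-line register code is verified by
    evaluating [lowv]. *)
Definition LR (rg : seq nat) (hi : nat -> nat) (st : mstate) : Prop :=
  [/\ forall i, i < 10 -> rmem st i = nth 0 rg i, forall a, 10 <= a -> rmem st a = hi a,
      mhist st = [::] & ncoin st = 0].

Definition lowok (i : instr) : bool :=
  match i with
  | IConst a _ => a < 10
  | IAdd a j k | ISub a j k => [&& a < 10, j < 10 & k < 10]
  | _ => false
  end.
Definition lowv (rg : seq nat) (i : instr) : seq nat :=
  match i with
  | IConst a c => set_nth 0 rg a c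
  | IAdd a j k => set_nth 0 rg a (nth 0 rg j + nth 0 rg k)
  | ISub a j k => set_nth 0 rg a (nth 0 rg j - nth 0 rg k)
  | _ => rg
  end.

Definition ends_at (k : nat) (st : mstate) (off : nat) (Q : mstate -> Prop) : Prop :=
  exists st', [/\ reach k st st', pc st' = off & Q st'].

Lemma ends_trans k1 k2 st o1 o2 (Q1 Q2 : mstate -> Prop) : ends_at k1 st o1 Q1 ->
  (forall st', pc st' = o1 -> Q1 st' -> ends_at k2 st' o2 Q2) -> ends_at (k1 + k2) st o2 Q2.
Proof.
move=> [s1 [R1 P1 H1]] /(_ _ P1 H1) [s2 [R2 P2 H2]].
by exists s2; split=> //; apply: reach_trans R1 R2.
Qed.

Lemma low_step off i st rg hi : nth IHalt P off = i -> pc st = off -> lowok i -> LR rg hi st ->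
  ends_at 1 st off.+1 (LR (lowv rg i) hi).
Proof.
case: st => p m h n c Hi /= Hp Ho [/= A1 A2 A3 A4]; subst p.
exists (step i r coins (MState off m h n c)); split.
- by apply: reachS; rewrite /= Hi; [case: i Ho {Hi} | apply: reach0].
- by case: i Ho {Hi}.
- case: i Ho {Hi} => //= [a k|a j k|a j k]; [move=> Ha|case/and3P=> Ha Hj Hk..];
    split=> //= x Hx; rewrite /upd ?nth_set_nth /= ?(A1 j Hj) ?(A1 k Hk);
    (case: eqP => [E|_] //; first [by rewrite A1 | by rewrite A2 | lia]).
Qed.

Lemma low_steps l off st rg hi : codeat P off l -> pc st = off -> all lowok l -> LR rg hi st ->
  ends_at (size l) st (off + size l) (LR (foldl lowv rg l) hi).
Proof.
elim: l off st rg => [|i l IH] off st rg Hc Hp Ha HL.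
  by exists st; split=> //; [apply: reach0|rewrite addn0].
case/codeat_cons: Hc => Hi Hc; case/andP: Ha => Ho Ha.
have -> : off + size (i :: l) = off.+1 + size l by rewrite addSnnS.
apply: (ends_trans (k1 := 1) (low_step Hi Hp Ho HL)) => st1 P1 Q1.
exact: IH.
Qed.

Lemma lowv_fib (l : seq bool) a b rg :
  foldl lowv [:: a, b & rg] (map fwd l) =
  [:: (foldl (fun x t => fib1 t x) (a, b) l).1, (foldl (fun x t => fib1 t x) (a, b) l).2 & rg].
Proof. by elim: l a b => //= -[] l IH a b /=; rewrite IH. Qed.

Lemma lowv_fibK (l : seq bool) a b a' b' v0 v1 v2 v3 v4 rg :
  foldl (fun x t => fib1 t x) (a, b) l = (a', b') ->
  foldl lowv [:: v0, v1, v2, v3, v4, a', b' & rg] (map bwd (rev l)) =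
  [:: v0, v1, v2, v3, v4, a, b & rg].
Proof.
elim/last_ind: l a' b' => [|l t IH] a' b'; first by move=> [-> ->].
rewrite foldl_rcons rev_rcons /=; case E : (foldl _ _ l) => [x y].
by case: t => -[<- <-] /=; rewrite addnK; apply: IH.
Qed.

Variables (n m : nat) (x : nat -> nat).
Hypothesis n2 : 2 <= n.
Hypothesis m1 : 1 <= m.
Hypothesis x0 : x 0 = n.
Hypothesis x1 : x 1 = m.
Let len := n + 6 * m + 2.
(** The value left in cell 0 by [fibl]: six additions give [n + 6 m], matching the six numbers per
    edge, and four Fibonacci pairs raise this to [34 n + 225 m]. It exceeds [16 len + 40], so the
    saved cells lie beyond all targets. *)
Let S0 := 34 * n + 225 * m.

Lemma stash_ok off st v b : codeat P off stash_code -> pc st = off -> v >= len ->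
  LR (v :: b :: map x (iota 2 8)) x st ->
  ends_at 16 st (off + 16) (LR [:: v + 7; b; 1; x 3; x 4; x 5; x 6; x 7; x 8; x 9]
    (fun a => if v <= a < v + 8 then x (a - v + 2) else x a)).
Proof.
move=> Hc Hp Hv HL; have Hl : 10 <= len by rewrite /len; lia.
pose h k a := if v <= a < v + k then x (a - v + 2) else x a.
have store k j o st1 rg : nth IHalt P o = IStore 0 j -> pc st1 = o -> j = k.+2 -> k < 8 ->
    nth 0 rg 0 = v + k -> nth 0 rg j = x j ->
    LR rg (h k) st1 -> ends_at 1 st1 o.+1 (LR rg (h k.+1)).
  move: st1 => [p mm hh nn c] Hi /= Hp1 Hj Hk E1 E2 [/= A1 A2 A3 A4]; subst p j.
  exists (step (IStore 0 k.+2) r coins (MState o mm hh nn c)); split=> //.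
    by apply: reachS; rewrite /= Hi //; apply: reach0.
  split=> //= a Ha; rewrite /upd A1 ?E1 //.
    by case: eqP => [E|_]; [lia|apply: A1].
  case: eqP => [->|Ne]; first by rewrite A1 // E2 /h; case: ifP => [_|]; [congr x; lia|lia].
  by rewrite A2 // /h; case: ifP; case: ifP => //; lia.
have {}HL : LR (v :: b :: map x (iota 2 8)) (h 0) st.
  case: HL => [B1 B2 B3 B4]; split=> // a Ha; rewrite B2 // /h; case: ifP => //; lia.
case/codeat_cons: Hc => I0 /codeat_cons [I1 Hc].
have -> : off + 16 = off + 1 + 1 + 14 by lia.
rewrite -[ends_at _ _ _ _]/(ends_at (1 + (1 + 14)) st (off + 1 + 1 + 14) (LR _ (h 8))).
apply: (ends_trans (o1 := off.+1)); first by apply: (store 0 2 off st _ I0 Hp _ _ _ _ HL) => //=; lia.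
move=> st1 P1 L1.
apply: (ends_trans (low_step I1 P1 _ L1)) => // st2 P2 L2.
have nx y k : k < 7 ->
    nth 0 [:: y; b; 1; x 3; x 4; x 5; x 6; x 7; x 8; x 9] (9 - k) = x (9 - k).
  by do 7 (case: k => [|k] //).
have key k : k <= 7 -> forall o st2, codeat P o (flatten [seq [:: IAdd 0 0 2; IStore 0 k] | k <- iota (10 - k) k]) ->
    pc st2 = o -> LR [:: v + (7 - k); b; 1; x 3; x 4; x 5; x 6; x 7; x 8; x 9] (h (8 - k)) st2 ->
    ends_at (k * 2) st2 (o + k * 2) (LR [:: v + 7; b; 1; x 3; x 4; x 5; x 6; x 7; x 8; x 9] (h 8)).
  elim: k => [|k IH] Hk o st3 Hc3 P3 L3.
    by exists st3; split=> //; [apply: reach0|rewrite addn0].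
  have E1 : 10 - k.+1 = 9 - k by lia.
  move: Hc3; rewrite E1 /= => /codeat_cons [J0] /codeat_cons [J1 J2].
  rewrite mulSn -[2 + k * 2]/(1 + (1 + k * 2)).
  have -> : o + (1 + (1 + k * 2)) = o.+2 + k * 2 by lia.
  apply: (ends_trans (low_step J0 P3 _ L3)) => // st4 P4 L4.
  apply: (ends_trans (o1 := o.+2)).
    apply: (store (8 - k.+1) (9 - k) o.+1 st4 _ J1 P4 _ _ _ _ L4); [lia|lia|rewrite /=; lia|].
    exact: nx.
  move=> st5 P5 L5; apply: IH => //; first lia.
    by move: J2; rewrite (_ : (9 - k).+1 = 10 - k) //; lia.
  move: L5; rewrite (_ : (8 - k.+1).+1 = 8 - k) /=; last lia.
  by rewrite (_ : v + (7 - k.+1) + 1 = v + (7 - k)) //; lia.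
have -> : off + 1 + 1 + 14 = off.+2 + 7 * 2 by lia.
by apply: (key 7) => //; rewrite addn0.
Qed.

Definition LI (i : nat) (st : mstate) : Prop :=
  [/\ [/\ rmem st 0 = i + 10, rmem st 1 = i, rmem st 2 = 1, rmem st 3 = 0 & rmem st 4 = S0],
      [/\ rmem st 5 = n, rmem st 6 = m, rmem st 7 = 16 * (i + 10) + 3 & rmem st 8 = 16],
      forall k, 10 <= k < i + 10 -> rmem st k = x k,
      forall k, k < 8 -> rmem st (S0 + k) = x (k + 2) &
      [/\ forall k, i + 10 <= k < len -> rmem st (16 * k + 3) = x k, mhist st = [::] & ncoin st = 0]].

Lemma pre_ok off st : codeat P off pre_code -> pc st = off ->
  (forall a, rmem st a = x a) -> mhist st = [::] -> ncoin st = 0 ->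
  ends_at (size pre_code) st (off + size pre_code) (LI (len - 10)).
Proof.
move=> Hc Hp Hx Hh Hn.
have L0 : LR (n :: m :: map x (iota 2 8)) x st.
  split=> //= i Hi; rewrite Hx; case: i Hi => [|[|i]] Hi //=.
  by rewrite -[x i.+2]/(x (2 + i)) -[_ :: _]/(map x (iota 2 8)) (nth_map 0) ?size_iota ?nth_iota //; lia.
rewrite /pre_code !size_cat; move: Hc.
case/codeat_cat=> H1 /codeat_cat [H2] /codeat_cat [H3 H4].
have -> : off + (size (map fwd fibl) + (size stash_code + (size recover_code + size setup_code))) =
   off + size (map fwd fibl) + 16 + size recover_code + size setup_code by rewrite /=; lia.
apply: (ends_trans (low_steps H1 Hp _ L0)) => // st1 P1; rewrite lowv_fib.
set p := foldl _ (n, m) fibl => L1.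
have Ep : p.1 = S0 by rewrite /p /= /S0; lia.
apply: (ends_trans (stash_ok H2 P1 _ L1)); first by rewrite Ep /S0 /len; lia.
move=> st2 P2 L2.
apply: (ends_trans (low_steps H3 _ _ L2)) => // st3 P3.
rewrite /recover_code foldl_cat [foldl _ _ (_ :: _)]/=; rewrite !addnK !addn0.
rewrite (@lowv_fibK fibl n m) -?surjective_pairing // => L3.
have [st4 [R4 P4 L4]] := low_steps H4 P3 (isT : all lowok setup_code) L3.
exists st4; split=> //.
case: L4 => [M1 M2 M3 M4].
have Hlen : len >= 10 by rewrite /len; lia.
have S0len : S0 >= 16 * len + 40 by rewrite /S0 /len; lia.
have G k v : k < 10 -> nth 0 (foldl lowv [:: p.1 + 7; p.2; 1; 0; p.1; n; m; x 7; x 8; x 9] setup_code) k = v ->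
  rmem st4 k = v by move=> Hk <-; apply: M1.
split.
- split; apply: G => //=; rewrite ?Ep // /len; lia.
- split; apply: G => //=; rewrite ?Ep // /len; lia.
- move=> k Hk; rewrite M2; last lia.
  by case: ifP => //; rewrite Ep; lia.
- move=> k Hk; rewrite M2 ?Ep; last lia.
  by case: ifP => [_|]; [congr x; lia|lia].
- by split=> // k; lia.
Qed.

Lemma loop_ok off i st : codeat P off (loop_code off) -> pc st = off -> i <= len - 10 -> LI i st ->
  ends_at (7 * i + 1) st (off + 7) (LI 0).
Proof.
move=> Hc; have [J0 [J1 [J2 [J3 [J4 [J5 [J6 _]]]]]]] :
    nth IHalt P off = IJz 1 (off + 7) /\ nth IHalt P off.+1 = ISub 1 1 2 /\
    nth IHalt P off.+2 = ISub 0 0 2 /\ nth IHalt P off.+3 = ISub 7 7 8 /\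
    nth IHalt P off.+4 = ILoad 9 0 /\ nth IHalt P off.+4.+1 = IStore 7 9 /\
    nth IHalt P off.+4.+2 = IJz 3 off /\ True.
  by case/codeat_cons: Hc => ? /codeat_cons [?] /codeat_cons [?] /codeat_cons [?]
    /codeat_cons [?] /codeat_cons [?] /codeat_cons [? _].
have S0len : S0 >= 16 * len + 40 by rewrite /S0 /len; lia.
elim: i st => [|i IH] [p mm h nn c] /= Hp Hi [/= [A0 A1 A2 A3 A4] [A5 A6 A7 A8] A9 A10 [A11 A12 A13]]; subst p.
  exists (step (IJz 1 (off + 7)) r coins (MState off mm h nn c)); split.
  - by apply: reachS; rewrite /= J0 //; apply: reach0.
  - by rewrite /= A1.
  - by split.
pose m1' := upd (upd (upd (upd mm 1 i) 0 (i + 10)) 7 (16 * (i + 10) + 3)) 9 (x (i + 10)).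
pose m2' := upd m1' (16 * (i + 10) + 3) (x (i + 10)).
have E1 : mm 1 - mm 2 = i by rewrite A1 A2; lia.
have E2 : mm 0 - mm 2 = i + 10 by rewrite A0 A2; lia.
have E3 : mm 7 - mm 8 = 16 * (i + 10) + 3 by rewrite A7 A8; lia.
have [c' R] : exists c', reach 7 (MState off mm h nn c) (MState off m2' h nn c').
  eexists.
  apply: reachS; rewrite /= J0 //= A1 /=.
  apply: reachS; rewrite /= J1 //= E1.
  apply: reachS; rewrite /= J2 //= [X in upd _ 0 X](_ : _ = i + 10) //.
  apply: reachS; rewrite /= J3 //= [X in upd _ 7 X](_ : _ = 16 * (i + 10) + 3) //.
  set mA := upd _ 7 _.
  have EA : mA (i + 10) = x (i + 10).
    rewrite /mA /upd; do 3 (case: eqP => [?|_]; first lia); apply: A9; lia.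
  apply: reachS; rewrite /= J4 //=; rewrite (_ : mA 0 = i + 10) // EA.
  set mB := upd _ 9 _.
  apply: reachS; rewrite /= J5 //=; rewrite (_ : mB 7 = 16 * (i + 10) + 3) // (_ : mB 9 = x (i + 10)) //.
  apply: reachS; rewrite /= J6 //=.
  set mC := upd _ (16 * (i + 10) + 3) _.
  rewrite (_ : mC 3 = 0) /=; first exact: reach0.
  by rewrite /mC /upd; case: eqP => [?|_]; [lia|].
rewrite (_ : 7 * i.+1 + 1 = 7 + (7 * i + 1)); last lia.
have [st' [R' P' Q']] : ends_at (7 * i + 1) (MState off m2' h nn c') (off + 7) (LI 0).
  apply: IH => //; first lia.
  have lo a : a < 10 -> m2' a = m1' a by move=> Ha; rewrite /m2' /upd; case: eqP => // ?; lia.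
  have hi a : 10 <= a -> a != 16 * (i + 10) + 3 -> m2' a = mm a.
    move=> Ha /eqP Hne; rewrite /m2' /m1' /upd.
    by do 5 (case: eqP => [?|_]; first lia).
  split=> /=.
  - by split; rewrite lo.
  - by split; rewrite lo.
  - by move=> k Hk; rewrite hi ?A9 //; lia.
  - by move=> k Hk; rewrite hi ?A10 //; lia.
  - split=> // k Hk; case: (eqVneq k (i + 10)) => [->|Hne].
      by rewrite /m2' /upd eqxx.
    by rewrite hi ?A11 //; lia.
by exists st'; split=> //; apply: reach_trans R R'.
Qed.

Lemma final_ok off st : codeat P off final_code -> pc st = off -> LI 0 st ->
  ends_at 18 st (off + 18) (fun st' =>
    [/\ forall k, k < len -> rmem st' (16 * k + 3) = x k, mhist st' = [::] & ncoin st' = 0]).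
Proof.
move=> Hc Hp [[A0 A1 A2 A3 A4] [A5 A6 A7 A8] A9 A10 [A11 A12 A13]].
have S0len : S0 >= 16 * len + 40 by rewrite /S0 /len; lia.
pose F j (s : mstate) := [/\ rmem s 2 = 1, rmem s 3 = 0, rmem s 4 = S0 + j,
   rmem s 5 = n /\ rmem s 6 = m & [/\ forall k, k < 8 -> rmem s (S0 + k) = x (k + 2),
   forall k, 2 <= k < j + 2 -> rmem s (16 * k + 3) = x k,
   forall k, 10 <= k < len -> rmem s (16 * k + 3) = x k, mhist s = [::] & ncoin s = 0]].
have key k : k <= 8 -> forall o st2, codeat P o (flatten [seq [:: ILoad (16 * k + 3) 4; IAdd 4 4 2] | k <- iota (10 - k) k]) ->
    pc st2 = o -> F (8 - k) st2 -> ends_at (k * 2) st2 (o + k * 2) (F 8).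
  elim: k => [|k IH] Hk o st3 Hc3 P3 L3.
    by exists st3; split=> //; [apply: reach0|rewrite addn0].
  have E1 : 10 - k.+1 = 9 - k by lia.
  move: Hc3; rewrite E1 /= => /codeat_cons [J0] /codeat_cons [J1 J2].
  have J2' : codeat P o.+2 (flatten [seq [:: ILoad (16 * k + 3) 4; IAdd 4 4 2] | k <- iota (10 - k) k]).
    by move: J2; rewrite (_ : (9 - k).+1 = 10 - k) //; lia.
  case: st3 P3 L3 => p mm h nn c /= -> [/= B1 B2 B3 [B4 B5] [B6 B7 B8 B9 B10]].
  have E2 : 9 - k = (7 - k) + 2 by lia.
  pose m1' := upd mm (16 * (9 - k) + 3) (x (9 - k)).
  pose m2' := upd m1' 4 (S0 + (8 - k)).
  have lo a : a != 4 -> a != 16 * (9 - k) + 3 -> m2' a = mm a.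
    by rewrite /m2' /m1' /upd => /negbTE -> /negbTE ->.
  have [c' R] : exists c', reach 2 (MState o mm h nn c) (MState o.+2 m2' h nn c').
    eexists; apply: reachS; rewrite /= J0 //= B3 (_ : 8 - k.+1 = 7 - k); last lia.
    rewrite B6 -?E2; last lia.
    apply: reachS; rewrite /= J1 //=.
    rewrite (_ : upd mm (16 * (9 - k) + 3) (x (9 - k)) 4 = S0 + (7 - k)); last first.
      by rewrite /upd; case: eqP => [?|_]; [lia|rewrite B3; lia].
    rewrite (_ : upd mm (16 * (9 - k) + 3) (x (9 - k)) 2 = 1); last first.
      by rewrite /upd; case: eqP => [?|_]; [lia|].
    rewrite (_ : S0 + (7 - k) + 1 = S0 + (8 - k)); last lia.
    exact: reach0.
  rewrite mulSn (_ : o + (2 + k * 2) = o.+2 + k * 2); last lia.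
  have [st' [R' P' Q']] : ends_at (k * 2) (MState o.+2 m2' h nn c') (o.+2 + k * 2) (F 8).
    apply: IH => //; first lia.
    split=> /=; [by rewrite lo //; lia|by rewrite lo //; lia|by []|by rewrite !lo //; lia|].
    split=> // j Hj.
    - by rewrite lo ?B6 //; lia.
    - case: (eqVneq j (9 - k)) => [->|Hne].
        by rewrite /m2' /m1' /upd eqxx; case: eqP => // ?; lia.
      by rewrite lo ?B7 //; lia.
    - by rewrite lo ?B8 //; lia.
  by exists st'; split=> //; apply: reach_trans R R'.
case/codeat_cat: Hc => H1 H2.
rewrite -[18]/(8 * 2 + 2) addnA.
apply: (ends_trans (key 8 _ _ _ H1 Hp _)) => //.
  split=> //; first by rewrite A4 addn0.
  by split=> // k; lia.
move=> [p mm h nn c] /= P1 [/= B1 B2 B3 [B4 B5] [B6 B7 B8 B9 B10]].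
case/codeat_cons: H2 => J0 /codeat_cons [J1 _]; rewrite -[size _]/16 in J0 J1; subst p.
pose m2' := upd (upd mm 19 m) 3 n.
have [c' R] : exists c', reach 2 (MState (off + 16) mm h nn c) (MState (off + 16).+2 m2' h nn c').
  eexists; apply: reachS; rewrite /= J0 //= B5 B2 addn0.
  by apply: reachS; rewrite /= J1 //= /upd /= B4 B2 addn0; apply: reach0.
exists (MState (off + 16).+2 m2' h nn c'); split=> //=; first lia.
split=> // k Hk; rewrite /m2' /upd; case: k Hk => [|[|k]] Hk; rewrite ?x0 ?x1 //.
case: eqP => [?|_]; first lia; case: eqP => [?|_]; first lia.
case: (ltnP k.+2 10) => Hk10; first by apply: B7; lia.
by apply: B8; lia.
Qed.

Definition pro_steps : nat := 1 + (size pre_code + (7 * (len - 10) + 1 + 18)).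

Lemma prologue_ok fin st : codeat P 0 (prologue fin) -> pc st = 0 ->
  (forall a, rmem st a = x a) -> mhist st = [::] -> ncoin st = 0 ->
  ends_at pro_steps st (size (prologue fin)) (fun st' =>
    [/\ forall k, k < len -> rmem st' (16 * k + 3) = x k, mhist st' = [::] & ncoin st' = 0]).
Proof.
case/codeat_cons => J0 Hc Hp Hx Hh Hn; move: Hc; rewrite -[1]/(0 + 1).
case/codeat_cat => H1 /codeat_cat [H2 H3].
have [c' R] : exists c', reach 1 st (MState 1 (rmem st) (mhist st) (ncoin st) c').
  eexists; apply: reachS; rewrite Hp J0 //= Hx x1 Hp.
  by case: m m1 => // k _ /=; apply: reach0.
have -> : size (prologue fin) = 1 + size pre_code + 7 + 18 by rewrite /= ?size_cat.
apply: (ends_trans (o1 := 1) (Q1 := fun s => [/\ forall a, rmem s a = x a, mhist s = [::] & ncoin s = 0])).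
  by eexists; split; [exact: R| |].
move=> st1 P1 [X1 X2 X3].
apply: (ends_trans (pre_ok H1 P1 X1 X2 X3)) => st2 P2 Q2.
apply: (ends_trans (loop_ok H2 P2 (leqnn _) Q2)) => st3 P3 Q3.
exact: final_ok H3 P3 Q3.
Qed.

End Prologue.
End Prologue.
Export Prologue.

Module Coins.
Local Open Scope ring_scope.

(** * Expectation over realizations and over coins *)

Definition Er (I : instance) (f : seq bool -> rat) : rat :=
  \sum_(r : (nE I).-tuple bool) real_prob I r * f r.

Lemma ErD I f g : Er I (fun r => f r + g r) = Er I f + Er I g.
Proof. by rewrite /Er -big_split; apply: eq_bigr => r _; rewrite mulrDr. Qed.

Lemma ErZ I c f : Er I (fun r => c * f r) = c * Er I f.
Proof. by rewrite /Er mulr_sumr; apply: eq_bigr => r _; rewrite mulrCA. Qed.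

Lemma eq_Er I (f g : seq bool -> rat) : (forall r : (nE I).-tuple bool, f r = g r) -> Er I f = Er I g.
Proof. by move=> H; apply: eq_bigr => r _; rewrite H. Qed.

Lemma Er_sum I n (f : nat -> seq bool -> rat) :
  Er I (fun r => \sum_(i < n) f i r) = \sum_(i < n) Er I (f i).
Proof. by rewrite /Er exchange_big /=; apply: eq_bigr => r _; rewrite mulr_sumr. Qed.

(** Flipping bit [e] pairs the realizations with and without [e]. The function [f] agrees on a pair,
    and the two probabilities are in the ratio [p_e : 1 - p_e]. *)
Lemma Er_fresh I e (f : seq bool -> rat) : (e < nE I)%N ->
  (forall r r' : (nE I).-tuple bool,
     (forall i, i != e -> nth false r i = nth false r' i) -> f r = f r') ->
  Er I (fun r => (nth false r e)%:R * f r) = p_ I e * Er I f.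
Proof.
move=> He Hf; pose oe := Ordinal He.
pose flip (r : (nE I).-tuple bool) : (nE I).-tuple bool :=
  [tuple (if i == oe then ~~ tnth r i else tnth r i) | i < nE I].
have flipK : involutive flip.
  by move=> r; apply: eq_from_tnth => i; rewrite !tnth_mktuple; case: (i == oe); rewrite ?negbK.
have nthf (r : (nE I).-tuple bool) (i : 'I_(nE I)) : nth false r i = tnth r i.
  exact/esym/tnth_nth.
have flip_e r : nth false (flip r) e = ~~ nth false r e.
  by rewrite -[e]/(val oe) !nthf tnth_mktuple eqxx.
have ff r : f (flip r) = f r.
  apply: Hf => i Hi; case: (ltnP i (nE I)) => Hi'; last by rewrite !nth_default ?size_tuple.
  by rewrite -[i]/(val (Ordinal Hi')) !nthf tnth_mktuple -val_eqE /= (negbTE Hi).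
have rp (r : (nE I).-tuple bool) : nth false r e -> p_ I e * real_prob I (flip r) = (1 - p_ I e) * real_prob I r.
  move=> Hr; rewrite /real_prob (bigD1 oe) // [in RHS](bigD1 oe) //.
  rewrite -[nat_of_ord oe]/e flip_e Hr -[~~ true]/false.
  rewrite mulrCA; congr (_ * (_ * _)); apply: eq_bigr => i Hi.
  by rewrite !nthf tnth_mktuple (negbTE Hi).
have split_e (g : (nE I).-tuple bool -> rat) :
    \sum_r g r = \sum_(r : (nE I).-tuple bool | nth false r e) (g r + g (flip r)).
  rewrite (bigID (fun r : (nE I).-tuple bool => nth false r e)) /= big_split; congr (_ + _).
  rewrite (reindex_inj (inv_inj flipK)) /=; apply: eq_bigl => r.
  by rewrite flip_e negbK.
rewrite /Er !split_e mulr_sumr; apply: eq_bigr => r Hr.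
rewrite flip_e Hr /= mul0r mulr0 addr0 mul1r ff mulrDr !mulrA rp //; ring.
Qed.

Fixpoint Ec (n : nat) (F : seq bool -> rat) : rat :=
  if n is n'.+1 then (Ec n' (fun l => F (true :: l)) + Ec n' (fun l => F (false :: l))) / 2%:R
  else F [::].

Lemma EcE n (F : seq bool -> rat) : (2%:R ^+ n)^-1 * (\sum_(cs : n.-tuple bool) F cs) = Ec n F.
Proof.
elim: n F => [|n IH] F /=.
  by rewrite invr1 mul1r (big_pred1 [tuple]) // => t; apply/esym/eqP/(tuple0 t).
pose h (x : bool * n.-tuple bool) : n.+1.-tuple bool := [tuple of x.1 :: x.2].
have hb : bijective h.
  exists (fun t : n.+1.-tuple bool => (thead t, [tuple of behead t])).
    by move=> [b t]; rewrite /h /=; congr (_, _); apply: val_inj.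
  by move=> t; rewrite /h [t in RHS]tuple_eta; apply: val_inj.
have E : \sum_(cs : n.+1.-tuple bool) F cs =
    \sum_(t : n.-tuple bool) F (true :: t) + \sum_(t : n.-tuple bool) F (false :: t).
  rewrite (reindex h) /=; last exact: onW_bij.
  rewrite -(pair_big xpredT xpredT (fun b (t : n.-tuple bool) => F (b :: t))) /=.
  by rewrite big_bool.
have N0 : (2%:R : rat) ^+ n != 0 by rewrite expf_neq0.
by rewrite E -!IH exprS; field.
Qed.

Lemma eq_Ec n F G : (forall l, size l = n -> F l = G l) -> Ec n F = Ec n G.
Proof.
elim: n F G => [|n IH] F G H /=; first exact: H.
by congr ((_ + _) / _); apply: IH => l Hl; apply: H; rewrite /= Hl.
Qed.

Lemma Ec_const n c : Ec n (fun=> c) = c.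
Proof. by elim: n => //= n ->; field. Qed.

Lemma Ec_cat a b F : Ec (a + b) F = Ec a (fun l1 => Ec b (fun l2 => F (l1 ++ l2))).
Proof. by elim: a F => //= a IH F; rewrite !IH. Qed.

Lemma uval_cons b l n : (n <= size l)%N ->
  uval (nth false (b :: l)) 0 n.+1 = (b * 2 ^ n + uval (nth false l) 0 n)%N.
Proof.
elim: n => [|n IH] Hn; first by case: b; rewrite /= ?muln0.
by rewrite -[LHS]/(2 * uval (nth false (b :: l)) 0 n.+1 + nth false l n)%N IH ?(ltnW Hn) //
  -[uval (nth false l) 0 n.+1]/(2 * uval (nth false l) 0 n + nth false l n)%N expnS mulnDr mulnCA addnA.
Qed.

(** The first coin selects the upper or lower half of the range, so by induction the number is
    uniform. *)
Lemma Ec_uval n (G : nat -> rat) :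
  Ec n (fun l => G (uval (nth false l) 0 n)) = (2%:R ^+ n)^-1 * \sum_(u < 2 ^ n) G u.
Proof.
elim: n G => [|n IH] G; first by rewrite /= expr0 invr1 mul1r expn0 big_ord1.
rewrite /Ec -/Ec.
rewrite (@eq_Ec _ _ (fun l => G (2 ^ n + uval (nth false l) 0 n)%N)); last first.
  by move=> l Hl; rewrite uval_cons ?Hl // mul1n.
rewrite (@eq_Ec _ (fun l => G (uval _ 0 n.+1)) (fun l => G (uval (nth false l) 0 n))); last first.
  by move=> l Hl; rewrite uval_cons ?Hl // mul0n.
rewrite (IH (fun u => G (2 ^ n + u)%N)) IH -mulrDr exprS invfM addrC mulrC mulrA; congr (_ * _).
by rewrite expnS mul2n -addnn big_split_ord.
Qed.

Lemma sum_threshold N c (a b : rat) : (c <= N)%N ->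
  \sum_(u < N) (if (u < c)%N then a else b) = c%:R * a + (N%:R - c%:R) * b.
Proof.
move=> Hc; rewrite -(subnKC Hc) big_split_ord /= (eq_bigr (fun=> a)); last by move=> i _; rewrite ltn_ord.
rewrite [X in _ + X](eq_bigr (fun=> b)); last by move=> i _; rewrite ltnNge leq_addr.
by rewrite !sumr_const !card_ord natrD [c%:R + _]addrC addrK !mulr_natl.
Qed.

(** * The probing process as a probability tree *)

Section Tree.
Variables (I : instance) (q : nat -> rat).

(** An intermediate stage: [Vr] has averaged out the coins but still reads the realization, while
    [PT] draws each outcome at the moment of the probe. *)
Fixpoint Vr (F : history -> rat) (r : seq bool) (l : seq nat) (h : history) : rat :=
  if l is f :: l' then
    q f * Vr F r l' (if legal_probe I h f then rcons h (f, nth false r f) else h)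
    + (1 - q f) * Vr F r l' h
  else F h.

Fixpoint PT (F : history -> rat) (l : seq nat) (h : history) : rat :=
  if l is f :: l' then
    q f * (if legal_probe I h f then
             p_ I f * PT F l' (rcons h (f, true)) + (1 - p_ I f) * PT F l' (rcons h (f, false))
           else PT F l' h)
    + (1 - q f) * PT F l' h
  else F h.

Lemma proc_shift cnt kb r coins pos l h :
  proc I cnt kb r coins pos l h = proc I cnt kb r (fun i => coins (pos + i)%N) 0 l h.
Proof.
have U d p b : uval coins (d + p) b = uval (fun i => coins (d + i)%N) p b.
  by elim: b => //= b ->; rewrite addnA.
suff H p d : proc I cnt kb r coins (d + p) l h = proc I cnt kb r (fun i => coins (d + i)%N) p l h.
  by rewrite -(H 0%N) addn0.
elim: l p h => //= e l IH p h.
by rewrite -addnA IH /probe_item U.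
Qed.

Lemma Ec_proc (cnt : nat -> nat) kb r F l h B :
  (forall e, e \in l -> (cnt e <= 2 ^ kb)%N) ->
  (forall e, e \in l -> q e = (cnt e)%:R / 2%:R ^+ kb) -> (size l * kb <= B)%N ->
  Ec B (fun cs => F (proc I cnt kb r (nth false cs) 0 l h)) = Vr F r l h.
Proof.
elim: l h B => [|e l IH] h B Hc Hq HB; first by rewrite /= Ec_const.
have -> : B = (kb + (B - kb))%N by move: HB; rewrite /= mulSn; lia.
rewrite Ec_cat.
pose G (u : nat) := if (u < cnt e)%N then
  Vr F r l (if legal_probe I h e then rcons h (e, nth false r e) else h) else Vr F r l h.
rewrite (@eq_Ec _ _ (fun l1 => G (uval (nth false l1) 0 kb))); last first.
  move=> l1 Hl1.
  have E l2 : proc I cnt kb r (nth false (l1 ++ l2)) 0 (e :: l) h =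
      proc I cnt kb r (nth false l2) 0 l
        (if (uval (nth false l1) 0 kb < cnt e)%N && legal_probe I h e
         then rcons h (e, nth false r e) else h).
    rewrite /= proc_shift /probe_item add0n.
    have -> : uval (nth false (l1 ++ l2)) 0 kb = uval (nth false l1) 0 kb.
      have : (kb <= size l1)%N by rewrite Hl1.
      elim: (kb) => //= b IHb Hb; rewrite IHb ?(ltnW Hb) // nth_cat add0n Hb //.
    set h' := if _ then _ else _.
    have X (c1 c2 : nat -> bool) ll hh : c1 =1 c2 ->
        proc I cnt kb r c1 0 ll hh = proc I cnt kb r c2 0 ll hh.
      move=> Ec12; elim: ll 0%N hh => //= e' ll IHl p hh; rewrite IHl /probe_item.
      suff -> : uval c1 p kb = uval c2 p kb by [].
      by elim: (kb) => //= b ->; rewrite Ec12.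
    by apply: X => i; rewrite nth_cat Hl1 ltnNge leq_addr /= addKn.
  rewrite (@eq_Ec _ _ (fun l2 => F (proc I cnt kb r (nth false l2) 0 l
        (if (uval (nth false l1) 0 kb < cnt e)%N && legal_probe I h e
         then rcons h (e, nth false r e) else h)))); last by move=> l2 _; rewrite E.
  rewrite IH; first by rewrite /G; case: (_ < _)%N; case: (legal_probe _ _ _).
  - by move=> f Hf; apply: Hc; rewrite inE Hf orbT.
  - by move=> f Hf; apply: Hq; rewrite inE Hf orbT.
  - by move: HB; rewrite /= mulSn; lia.
rewrite Ec_uval /G sum_threshold ?Hc ?mem_head // natrX /= Hq ?mem_head //.
have : (2%:R : rat) ^+ kb != 0 by rewrite expf_neq0.
by move=> ?; field.
Qed.

(** A probed edge is never probed again, so its bit is no longer read once it is in the history. *)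
Lemma Vr_indep F f (r r' : seq bool) l h : (forall i, i != f -> nth false r i = nth false r' i) ->
  f \in map fst h -> Vr F r l h = Vr F r' l h.
Proof.
move=> Hr; elim: l h => //= e l IH h Hf; rewrite (IH h) //; congr (_ * _ + _).
case: ifP => [/and5P[_ Hn _ _ _]|_]; last exact: IH.
have Hne : e != f by apply: contraNneq Hn => ->.
by rewrite -(Hr e) //; apply: IH; rewrite map_rcons mem_rcons inE Hf orbT.
Qed.

Hypothesis wfI : wf_instance I.

(** At a legal probe, both continuations already have [f] in their history and do not depend on its
    bit. Writing the value as [1_f A + B - 1_f B], [Er_fresh] turns each indicator into [p_f]. *)
Lemma Er_Vr F l h : Er I (fun r => Vr F r l h) = PT F l h * Er I (fun=> 1).
Proof.
elim: l h => [|f l IH] h /=; first by rewrite -ErZ; apply: eq_Er => r; rewrite mulr1.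
transitivity (q f * Er I (fun r => Vr F r l (if legal_probe I h f
    then rcons h (f, nth false r f) else h)) + (1 - q f) * Er I (fun r => Vr F r l h)).
  by rewrite -!ErZ -ErD.
rewrite IH; case: ifP => [Hl|_]; last by rewrite IH; ring.
have Hf : (f < nE I)%N by case/and5P: Hl.
have -> : Er I (fun r => Vr F r l (rcons h (f, nth false r f))) =
  Er I (fun r => (nth false r f)%:R * Vr F r l (rcons h (f, true)))
  + (Er I (fun r => Vr F r l (rcons h (f, false)))
     - Er I (fun r => (nth false r f)%:R * Vr F r l (rcons h (f, false)))).
  rewrite -[X in _ + (_ + X)]mulN1r -ErZ -!ErD; apply: eq_Er => r.
  by case: (nth false r f) => /=; ring.
have Hm o : f \in map fst (rcons h (f, o)) by rewrite map_rcons mem_rcons mem_head.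
by rewrite !Er_fresh // => [|r r' H|r r' H]; rewrite ?IH; [ring|apply: Vr_indep H _..].
Qed.

End Tree.

Lemma p_bounds I e : wf_instance I -> (e < nE I)%N -> 0 < p_ I e <= 1.
Proof.
case/and5P=> /eqP H1 _ _ _ /and4P[_ /allP H _ _] He.
by apply: H; rewrite mem_nth // H1.
Qed.

Lemma real_prob_ge0 I (r : seq bool) : wf_instance I -> 0 <= real_prob I r.
Proof.
move=> W; apply: prodr_ge0 => e _; have /andP[p0 p1] := p_bounds W (ltn_ord e).
by case: ifP => _; rewrite ?subr_ge0 // ltW.
Qed.

Lemma Er1 I : Er I (fun=> 1) = 1.
Proof.
rewrite /Er; under eq_bigr do rewrite mulr1.
have -> : \sum_(r : (nE I).-tuple bool) real_prob I r =
  \sum_(g : {ffun 'I_(nE I) -> bool}) \prod_(e < nE I) (if g e then p_ I e else 1 - p_ I e).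
  pose to (g : {ffun 'I_(nE I) -> bool}) : (nE I).-tuple bool := [tuple g i | i < nE I].
  have tb : bijective to.
    exists (fun t : (nE I).-tuple bool => [ffun i => tnth t i]).
      by move=> g; apply/ffunP => i; rewrite ffunE tnth_mktuple.
    by move=> t; apply: eq_from_tnth => i; rewrite tnth_mktuple ffunE.
  rewrite (reindex to); last exact: onW_bij.
  apply: eq_bigr => g _; apply: eq_bigr => e _.
  by rewrite -(tnth_nth false) tnth_mktuple.
rewrite -(bigA_distr_bigA (fun (i : 'I_(nE I)) (b : bool) => if b then p_ I i else 1 - p_ I i)).
by rewrite big1 // => i _; rewrite big_bool /=; ring.
Qed.

Lemma le_Er I (f g : seq bool -> rat) : wf_instance I -> (forall r : (nE I).-tuple bool, f r <= g r) -> Er I f <= Er I g.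
Proof. by move=> W H; apply: ler_sum => r _; rewrite ler_wpM2l ?real_prob_ge0. Qed.
End Coins.
Export Coins.

Module Arrivals.
Local Open Scope ring_scope.

(** * Arrivals at one vertex *)

Section Arrivals.
Variable q : nat -> rat.

(* Expectation of [g (n + number of arrivals)] on the event that no arriving edge exists. *)
Fixpoint Ev (p : nat -> rat) (g : nat -> rat) (l : seq nat) (n : nat) : rat :=
  if l is f :: l' then q f * (1 - p f) * Ev p g l' n.+1 + (1 - q f) * Ev p g l' n else g n.

Definition qok (p : nat -> rat) (l : seq nat) : Prop :=
  forall f, f \in l -> 0 <= q f <= 1 /\ 0 <= p f <= 1.

Lemma qok_cons p f l : qok p (f :: l) -> [/\ 0 <= q f, q f <= 1, 0 <= p f, p f <= 1 & qok p l].
Proof.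
move=> H; have [/andP[a b] /andP[c d]] := H f (mem_head _ _).
by split=> // g Hg; apply: H; rewrite inE Hg orbT.
Qed.

Lemma Ev_le p g g' l n : qok p l -> (forall k, g k <= g' k) -> Ev p g l n <= Ev p g' l n.
Proof.
elim: l n => [|f l IH] n /= => [_|/qok_cons[a b c d H]] Hg; first exact: Hg.
by apply: lerD; apply: ler_wpM2l; rewrite ?mulr_ge0 ?subr_ge0 //; apply: IH.
Qed.

Lemma Ev_ge0 p g l n : qok p l -> (forall k, 0 <= g k) -> 0 <= Ev p g l n.
Proof.
elim: l n => [|f l IH] n /= => [_|/qok_cons[a b c d H]] Hg; first exact: Hg.
by apply: addr_ge0; rewrite ?mulr_ge0 ?subr_ge0 ?IH.
Qed.

Lemma Ev_antip p p' g l n : qok p l -> qok p' l -> (forall k, 0 <= g k) ->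
  (forall f, f \in l -> p f <= p' f) -> Ev p' g l n <= Ev p g l n.
Proof.
elim: l n => [|f l IH] n //= /qok_cons[a b c d H] /qok_cons[_ _ c' d' H'] Hg Hp.
have IH' k : Ev p' g l k <= Ev p g l k.
  by apply: IH => // x Hx; apply: Hp; rewrite inE Hx orbT.
apply: lerD; last by rewrite ler_wpM2l ?subr_ge0.
apply: ler_pM => //; rewrite ?mulr_ge0 ?subr_ge0 ?Ev_ge0 //.
by rewrite ler_wpM2l // lerD2l lerN2 Hp ?mem_head.
Qed.

Lemma Ev_cat p g l1 l2 n : Ev p g (l1 ++ l2) n = Ev p (Ev p g l2) l1 n.
Proof. by elim: l1 n => //= f l1 IH n; rewrite !IH. Qed.

Lemma Ev_anti p g l n : qok p l -> (forall k, 0 <= g k) -> (forall k, g k.+1 <= g k) ->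
  Ev p g l n.+1 <= Ev p g l n.
Proof.
elim: l n => [|f l IH] n /= => [_|/qok_cons[a b c d H]] Hg Ha; first exact: Ha.
by apply: lerD; apply: ler_wpM2l; rewrite ?mulr_ge0 ?subr_ge0 ?IH.
Qed.

Lemma Ev_drop p g l n : qok p l -> (forall k, 0 <= g k) -> (forall k, g k.+1 <= g k) ->
  Ev p g l n <= g n.
Proof.
elim: l n => [|f l IH] n //= /qok_cons[a b c d H] Hg Ha.
apply: (@le_trans _ _ ((q f * (1 - p f) + (1 - q f)) * Ev p g l n)).
  by rewrite [leRHS]mulrDl lerD2r ler_wpM2l ?mulr_ge0 ?subr_ge0 // Ev_anti.
apply: (@le_trans _ _ (Ev p g l n)); last exact: IH.
by rewrite -[leRHS]mul1r ler_wpM2r ?Ev_ge0 //; nra.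
Qed.

Lemma Ev_prefix p g l1 l2 n : qok p (l1 ++ l2) -> (forall k, 0 <= g k) ->
  (forall k, g k.+1 <= g k) -> Ev p g (l1 ++ l2) n <= Ev p g l1 n.
Proof.
move=> H Hg Ha; rewrite Ev_cat; apply: Ev_le => [f Hf|k].
  by apply: H; rewrite mem_cat Hf.
by apply: Ev_drop => // f Hf; apply: H; rewrite mem_cat Hf orbT.
Qed.

Lemma Ev_lin p c g g' l n : Ev p (fun k => g k - c * g' k) l n = Ev p g l n - c * Ev p g' l n.
Proof. by elim: l n => //= f l IH n; rewrite !IH; ring. Qed.

Lemma Ev_shift p g l n : Ev p g l n.+1 = Ev p (fun k => g k.+1) l n.
Proof. by elim: l n => //= f l IH n; rewrite !IH. Qed.

Lemma Ev_add p g g' l n : Ev p (fun k => g k + g' k) l n = Ev p g l n + Ev p g' l n.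
Proof. by elim: l n => //= f l IH n; rewrite !IH; ring. Qed.

Lemma eq_Ev p g g' l n : g =1 g' -> Ev p g l n = Ev p g' l n.
Proof. by move=> H; elim: l n => //= f l IH n; rewrite !IH. Qed.

(** A binomial moment of the number of arrivals, restricted to the event that no arriving edge
    exists. *)
Definition Mom p r l : rat := Ev p (fun k => 'C(k, r)%:R) l 0.

Lemma Mom0_cons p f l : Mom p 0 (f :: l) = (1 - q f * p f) * Mom p 0 l.
Proof.
rewrite /Mom /= Ev_shift (@eq_Ev _ _ (fun k => 'C(k, 0)%:R)); last by move=> k; rewrite !bin0.
ring.
Qed.

Lemma MomS_cons p r f l :
  Mom p r.+1 (f :: l) = (1 - q f * p f) * Mom p r.+1 l + q f * (1 - p f) * Mom p r l.
Proof.
rewrite /Mom /= Ev_shift (@eq_Ev _ _ (fun k => 'C(k, r.+1)%:R + 'C(k, r)%:R)); last first.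
  by move=> k; rewrite binS natrD.
rewrite Ev_add; ring.
Qed.

(** Conditioned on no arriving edge existing, arrivals stay independent, with probabilities
    [q (1 - p) / (1 - q p) <= c]. Their binomial moments are elementary symmetric sums, bounded by
    the Poisson value [S ^ r / r!]. *)
Lemma Mom_le p (c : nat -> rat) r l : qok p l ->
  (forall f, f \in l -> 0 <= c f /\ q f * (1 - p f) <= c f * (1 - q f * p f)) ->
  Mom p r l <= Mom p 0 l * (\sum_(f <- l) c f) ^+ r / r`!%:R.
Proof.
have M0 ll : qok p ll -> 0 <= Mom p 0 ll by move=> H; apply: Ev_ge0.
elim: l r => [|f l IH] r.
  move=> _ _; rewrite big_nil /Mom /=; case: r => [|r]; first by rewrite expr0 fact0 invr1 !mulr1.
  by rewrite bin0n exprS mul0r mulr0 mul0r.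
case/qok_cons=> a b c1 d H Hc.
have [cf0 cf1] := Hc f (mem_head _ _).
have Hc' g : g \in l -> 0 <= c g /\ q g * (1 - p g) <= c g * (1 - q g * p g).
  by move=> Hg; apply: Hc; rewrite inE Hg orbT.
have S0 : 0 <= \sum_(g <- l) c g by rewrite big_seq; apply: sumr_ge0 => g /Hc' [].
have qp1 : 0 <= 1 - q f * p f by nra.
case: r => [|r].
  by rewrite expr0 fact0 invr1 !mulr1.
rewrite MomS_cons Mom0_cons big_cons.
set S := \sum_(g <- l) c g in S0 *; set x := 1 - q f * p f in qp1 cf1 *.
have I1 := IH r.+1 H Hc'; have I2 := IH r H Hc'.
rewrite -/S in I1 I2.
apply: (@le_trans _ _ (x * (Mom p 0 l * S ^+ r.+1 / r.+1`!%:R) +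
    c f * x * (Mom p 0 l * S ^+ r / r`!%:R))).
  apply: lerD; first by rewrite ler_wpM2l.
  have H0 : 0 <= Mom p r l by apply: Ev_ge0.
  by apply: ler_pM => //; rewrite mulr_ge0 ?subr_ge0.
have F0 : (r`!%:R : rat) != 0 by rewrite pnatr_eq0 -lt0n fact_gt0.
have F1 : (r.+1%:R : rat) != 0 by rewrite pnatr_eq0.
have -> : x * (Mom p 0 l * S ^+ r.+1 / r.+1`!%:R) + c f * x * (Mom p 0 l * S ^+ r / r`!%:R) =
   x * Mom p 0 l * (S ^+ r.+1 + r.+1%:R * c f * S ^+ r) / r.+1`!%:R.
  by rewrite factS natrM; field; rewrite F0 -natr1 in F1 *; rewrite ?F1 ?F0 // addrC F1.
rewrite ler_wpM2r ?invr_ge0 ?ler0n // ler_wpM2l ?mulr_ge0 ?M0 //.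
(* What remains is [S ^ (r+1) + (r+1) c S ^ r <= (c + S) ^ (r+1)], two terms of the binomial
   expansion. *)
elim: (r) => [|k IHk]; first by rewrite expr1 expr0 expr1; lra.
rewrite [leRHS]exprS; apply: (@le_trans _ _ ((c f + S) * (S ^+ k.+1 + k.+1%:R * c f * S ^+ k))).
  have Sk : 0 <= S ^+ k by rewrite exprn_ge0.
  have K0 : 0 <= (k.+1%:R : rat) by rewrite ler0n.
  have P0 : 0 <= k.+1%:R * (c f * c f * S ^+ k) by rewrite !mulr_ge0.
  rewrite -(natr1 k.+1) !exprS; move: P0; set z := k.+1%:R; set y := S ^+ k => P0; nra.
by rewrite ler_wpM2l // addr_ge0.
Qed.

(** The Weierstrass inequality for the product of the factors [1 - q f * p f]. *)
Lemma Mom0_ge p l : qok p l -> 1 - \sum_(f <- l) q f * p f <= Mom p 0 l.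
Proof.
elim: l => [|f l IH] /=; first by rewrite big_nil /Mom /= subr0.
case/qok_cons=> a b c d H; rewrite Mom0_cons big_cons.
have S0 : 0 <= \sum_(g <- l) q g * p g.
  by rewrite big_seq; apply: sumr_ge0 => g /H [/andP[? _] /andP[? _]]; rewrite mulr_ge0.
have := IH H; set S := \sum_(g <- l) _ in S0 * => I1.
have qp : 0 <= q f * p f by rewrite mulr_ge0.
have qp1 : q f * p f <= 1 by nra.
nra.
Qed.

Lemma Mom0_rounds p F k : Mom p 0 (flatten (nseq k F)) = Mom p 0 F ^+ k.
Proof.
have C l1 l2 : Mom p 0 (l1 ++ l2) = Mom p 0 l1 * Mom p 0 l2.
  elim: l1 => [|f l1 IH]; first by rewrite {2}/Mom /= mul1r.
  by rewrite cat_cons !Mom0_cons IH mulrA.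
by elim: k => [|k IH] //=; rewrite C IH exprS.
Qed.

Lemma sum_rounds (c : nat -> rat) F k :
  \sum_(f <- flatten (nseq k F)) c f = k%:R * \sum_(f <- F) c f.
Proof.
elim: k => [|k IH]; first by rewrite big_nil mul0r.
by rewrite /= big_cat IH -natr1 /=; ring.
Qed.

Definition below (t : nat) : nat -> rat := fun n => (n < t)%N%:R.

Lemma below_ge0 t k : 0 <= below t k. Proof. by rewrite ler0n. Qed.
Lemma below_anti t k : below t k.+1 <= below t k.
Proof. by rewrite /below ler_nat; case: (ltnP k.+1 t) => // H; rewrite (ltnW H). Qed.

(** Markov's inequality for a binomial moment: for [n >= t] the quotient of the two coefficients is
    at least 1. *)
Lemma below_moment t r n : (r <= t)%N -> 1 - 'C(t, r)%:R^-1 * 'C(n, r)%:R <= below t n.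
Proof.
move=> Hr; have C0 : (0 : rat) < 'C(t, r)%:R by rewrite ltr0n bin_gt0.
rewrite /below; case: ltnP => Hn.
  by rewrite /= lerBlDr lerDl mulr_ge0 ?invr_ge0 ?ler0n.
rewrite subr_le0 mulrC ler_pdivlMr // mul1r ler_nat.
exact: leq_bin2l.
Qed.

Variables (p : nat -> rat) (F : seq nat) (d x : rat) (t : nat).
Hypothesis d01 : 0 < d < 1.
Hypothesis HF : forall f, f \in F -> 0 <= q f <= d /\ 0 <= p f <= 1.
Hypothesis Hp : \sum_(f <- F) q f * p f <= d.
Hypothesis Hq : \sum_(f <- F) q f <= d * (t%:R - x).
Hypothesis x0 : 0 <= x <= 1.

(* Raising all [p f] by a common fraction makes the matching constraint tight, which
   is the worst case and leaves a load of at most [t - 1 - x] for the timeout. *)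
Lemma arrivals_ge r k : (r <= t)%N -> (0 < r)%N ->
  (1 - d) ^+ k * (1 - (k%:R * (d / (1 - d)) * Num.max 0 (t%:R - 1 - x)) ^+ r / (t ^_ r)%:R)
  <= Ev p (below t) (flatten (nseq k F)) 0.
Proof.
move=> Hr r0; case/andP: d01 => d0 d1; case/andP: x0 => xge0 xle1.
move: (Hp) (Hq); set sm := \sum_(f <- F) q f * p f; set sL := \sum_(f <- F) q f => Hp' Hq'.
(* The fraction that raises the sum of [q f * p' f] to exactly [d]. If the whole load is at most
   [d], all [p'] become 1 and no failing arrival is left. *)
pose th : rat := if sL <= d then 1 else (d - sm) / (sL - sm).
have th01 : 0 <= th <= 1.
  rewrite /th; case: (leP sL d) => [_|HL]; first by rewrite ler01 lexx.
  have D : 0 < sL - sm by lra.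
  by apply/andP; split; [apply: divr_ge0; lra|rewrite ler_pdivrMr // mul1r; lra].
case/andP: th01 => th0 th1.
pose p' f := p f + (1 - p f) * th.
have sp' : \sum_(f <- F) q f * p' f = sm + (sL - sm) * th.
  rewrite /sL /sm -sumrB mulr_suml -big_split /=; apply: eq_bigr => f _; rewrite /p'; ring.
have s1p' : \sum_(f <- F) q f * (1 - p' f) = (sL - sm) * (1 - th).
  rewrite /sL /sm -sumrB mulr_suml; apply: eq_bigr => f _; rewrite /p'; ring.
have sp'd : \sum_(f <- F) q f * p' f <= d.
  rewrite sp' /th; case: (leP sL d) => HL; first lra.
  have D : sL - sm != 0 by apply/lt0r_neq0; lra.
  by rewrite mulrCA divff // mulr1; lra.
have s1p'd : \sum_(f <- F) q f * (1 - p' f) <= d * Num.max 0 (t%:R - 1 - x).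
  rewrite s1p' /th; case: (leP sL d) => HL.
    by rewrite subrr mulr0; apply: mulr_ge0; [exact: ltW|rewrite le_max lexx].
  have D : sL - sm != 0 by apply/lt0r_neq0; lra.
  rewrite mulrBr mulr1 mulrCA divff // mulr1.
  apply: (@le_trans _ _ (d * (t%:R - 1 - x))); first lra.
  by rewrite ler_pM2l // le_max lexx orbT.
have p'01 f : f \in F -> p f <= p' f /\ 0 <= p' f <= 1.
  by move=> /HF [/andP[? ?] /andP[? ?]]; rewrite /p'; split; [nra|apply/andP; split; nra].
have inF f : f \in flatten (nseq k F) -> f \in F.
  by case/flattenP => s; rewrite mem_nseq => /andP[_ /eqP ->].
have ok : qok p (flatten (nseq k F)).
  by move=> f /inF /HF [/andP[? ?] ?]; split=> //; apply/andP; split=> //; lra.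
have ok' : qok p' (flatten (nseq k F)).
  by move=> f /inF Hf; case: (HF Hf) => [/andP[? ?] ?]; case: (p'01 _ Hf) => ? ?; split=> //; apply/andP; split=> //; lra.
have ok'F : qok p' F.
  by move=> f Hf; case: (HF Hf) => [/andP[? ?] ?]; case: (p'01 _ Hf) => ? ?; split=> //; apply/andP; split=> //; lra.
set MM := Num.max 0 (t%:R - 1 - x) in s1p'd *.
set a := _ ^+ r / _.
(* For [a > 1] the claimed bound is not positive. Otherwise [1 - a >= 0], and [Mom p' 0] can be
   replaced by its lower bound [(1 - d) ^ k]. *)
have [a1|a1] := leP a 1; last first.
  apply: (@le_trans _ _ 0); last by apply: Ev_ge0 => // n; apply: below_ge0.
  by apply: mulr_ge0_le0; [apply: exprn_ge0; lra|lra].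
apply: (@le_trans _ _ (Ev p' (below t) (flatten (nseq k F)) 0)); last first.
  by apply: Ev_antip => // f /inF /p'01 [].
apply: (@le_trans _ _ (Ev p' (fun n => 'C(n, 0)%:R - 'C(t, r)%:R^-1 * 'C(n, r)%:R) (flatten (nseq k F)) 0)); last first.
  by apply: Ev_le => // y; rewrite bin0; apply: below_moment.
rewrite Ev_lin -/(Mom p' 0 _) -/(Mom p' r _).
(* Admissible in [Mom_le], since [q f <= d] gives [1 - d <= 1 - q f * p' f]. *)
pose c f := q f * (1 - p' f) / (1 - d).
have d10 : 0 < 1 - d by lra.
have M := @Mom_le p' c r _ ok'.
have MM0 : 0 <= MM by rewrite /MM le_max lexx.
have sc : \sum_(f <- flatten (nseq k F)) c f <= k%:R * (d / (1 - d)) * MM.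
  rewrite sum_rounds -!mulrA ler_wpM2l ?ler0n // /c -mulr_suml mulrA mulrAC.
  by rewrite ler_pM2r ?invr_gt0.
have sc0 : 0 <= \sum_(f <- flatten (nseq k F)) c f.
  rewrite big_seq; apply: sumr_ge0 => f /inF Hf; case: (HF Hf) => [/andP[? ?] ?].
  case: (p'01 _ Hf) => _ /andP[? ?].
  by rewrite /c !mulr_ge0 ?invr_ge0 ?subr_ge0 //; lra.
have cb f : f \in flatten (nseq k F) -> 0 <= c f /\ q f * (1 - p' f) <= c f * (1 - q f * p' f).
  move=> /inF Hf; case: (HF Hf) => [/andP[q0 q1] _]; case: (p'01 _ Hf) => _ /andP[p0 p1].
  have c0 : 0 <= c f by rewrite /c !mulr_ge0 ?invr_ge0 ?subr_ge0 //; lra.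
  split=> //; have -> : q f * (1 - p' f) = c f * (1 - d) by rewrite /c divfK // lt0r_neq0.
  by rewrite ler_wpM2l //; nra.
have {}M := M cb.
have M0 : (1 - d) ^+ k <= Mom p' 0 (flatten (nseq k F)).
  have Mf : 1 - d <= Mom p' 0 F by apply: le_trans (Mom0_ge ok'F); lra.
  by rewrite Mom0_rounds lerXn2r ?nnegrE //; lra.
set m0 := Mom p' 0 _ in M M0 *.
have m00 : 0 <= m0 by apply: le_trans M0; rewrite exprn_ge0 // ltW.
have tf : ('C(t, r)%:R : rat)^-1 * (r`!%:R)^-1 = (t ^_ r)%:R^-1 by rewrite -bin_ffact natrM invfM.
have Mt : 'C(t, r)%:R^-1 * Mom p' r (flatten (nseq k F)) <= m0 * a.
  apply: (@le_trans _ _ ('C(t, r)%:R^-1 * (m0 * (\sum_(f <- flatten (nseq k F)) c f) ^+ r / r`!%:R))).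
    by rewrite ler_wpM2l ?invr_ge0 ?ler0n.
  rewrite [leLHS](_ : _ = m0 * ((\sum_(f <- flatten (nseq k F)) c f) ^+ r / (t ^_ r)%:R)).
    apply: ler_wpM2l => //; rewrite /a; apply: ler_wpM2r; first by rewrite invr_ge0 ler0n.
    by rewrite lerXn2r ?nnegrE // !mulr_ge0 ?ler0n ?invr_ge0 // ltW.
  by rewrite -tf; ring.
apply: (@le_trans _ _ (m0 * (1 - a))); first by rewrite ler_wpM2r // subr_ge0.
by rewrite mulrBr mulr1 lerD2l lerN2.
Qed.

End Arrivals.
End Arrivals.
Export Arrivals.

(** * The probability that a given edge is matched *)

Module Rounds.
Local Open Scope ring_scope.

Lemma wf_ends I e : wf_instance I -> (e < nE I)%N ->
  [/\ ((ends I e).1 < nV I)%N, ((ends I e).2 < nV I)%N & (ends I e).1 != (ends I e).2].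
Proof.
case/and5P=> _ _ _ /allP H _ He.
by have /and3P := H (ends I e) (mem_nth _ He).
Qed.

(** Parallel edges are excluded by the distinct unordered pairs. This separates the arrivals at the
    two ends of [e] and makes them independent. *)
Lemma wf_simple I e f : wf_instance I -> (e < nE I)%N -> (f < nE I)%N -> f != e ->
  incident I (ends I e).1 f -> ~~ incident I (ends I e).2 f.
Proof.
move=> W He Hf Hne H1; apply/negP => H2.
have [_ _ uv] := wf_ends W He.
case/and5P: W => _ _ _ _ /and4P[Hu _ _ _].
move/negP: Hne; apply; rewrite -(nth_uniq (upair (0%N, 0%N)) _ _ Hu) ?size_map //.
rewrite !(nth_map (0%N, 0%N)) // -!/(ends I _) /upair.
move: H1 H2 uv; rewrite /incident; case: (ends I e) (ends I f) => [u v] [a b] /=.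
case/orP=> /eqP -> /orP[] /eqP -> //; rewrite ?eqxx // => _.
by rewrite minnC maxnC.
Qed.

Section OneEdge.
Variables (I : instance) (q : nat -> rat) (d : rat) (e : nat).
Hypothesis wfI : wf_instance I.
Hypothesis d01 : 0 < d < 1.
Hypothesis q0d : forall f, (f < nE I)%N -> 0 <= q f <= d.
Hypothesis He : (e < nE I)%N.

Local Notation u := (ends I e).1.
Local Notation v := (ends I e).2.
Local Notation p := (p_ I).

Definition Fe (h : history) : rat := ((e, true) \in h)%:R.

Definition lts (l : seq nat) : bool := all (fun f => (f < nE I)%N) l.

Lemma q01 f : (f < nE I)%N -> 0 <= q f <= 1.
Proof. by move=> /q0d /andP[a b]; case/andP: d01 => _ d1; apply/andP; split; lra. Qed.

Lemma p01 f : (f < nE I)%N -> 0 <= p f <= 1.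
Proof. by move=> Hf; have /andP[a b] := p_bounds wfI Hf; rewrite (ltW a). Qed.

Lemma PT_ge0 l h : lts l -> 0 <= PT I q Fe l h.
Proof.
elim: l h => [|f l IH] h /= => [_|/andP[Hf Hl]]; first by rewrite ler0n.
have /andP[q0 q1] := q01 Hf; have /andP[p0 p1] := p01 Hf.
by apply: addr_ge0; apply: mulr_ge0; rewrite ?subr_ge0 ?IH //; case: ifP => _; rewrite ?addr_ge0 ?mulr_ge0 ?subr_ge0 ?IH.
Qed.

Lemma PT_one l h : lts l -> (e, true) \in h -> PT I q Fe l h = 1.
Proof.
elim: l h => [|f l IH] h /= => [_|/andP[Hf Hl]] Hh; first by rewrite /Fe Hh.
by case: ifP => _; rewrite !IH ?mem_rcons ?inE ?Hh ?orbT //; ring.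
Qed.

Definition pu (f : nat) : bool := (f != e) && incident I u f.
Definition pv (f : nat) : bool := (f != e) && incident I v f.

(** A pessimistic process in which two counters replace the history: each arrival at an end of [e]
    uses one unit of timeout and must not exist, and the first arrival of [e] settles the matter. *)
Fixpoint Phi (l : seq nat) (a b : nat) : rat :=
  if l is f :: l' then
    if f == e then q e * p e * (below (t_ I u) a * below (t_ I v) b) + (1 - q e) * Phi l' a b
    else if incident I u f then q f * (1 - p f) * Phi l' a.+1 b + (1 - q f) * Phi l' a b
    else if incident I v f then q f * (1 - p f) * Phi l' a b.+1 + (1 - q f) * Phi l' a b
    else Phi l' a b
  else 0.

Lemma Phi_ge0 l a b : lts l -> 0 <= Phi l a b.
Proof.
have /andP[qe0 qe1] := q01 He; have /andP[pe0 pe1] := p01 He.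
elim: l a b => [|f l IH] a b //= /andP[Hf Hl].
have /andP[q0 q1] := q01 Hf; have /andP[p0 p1] := p01 Hf.
by do ?[case: ifP => _]; rewrite ?addr_ge0 ?mulr_ge0 ?subr_ge0 ?below_ge0 ?IH.
Qed.

Lemma Phi_anti l a b : lts l -> Phi l a.+1 b <= Phi l a b /\ Phi l a b.+1 <= Phi l a b.
Proof.
have /andP[qe0 qe1] := q01 He; have /andP[pe0 pe1] := p01 He.
elim: l a b => [|f l IH] a b //= /andP[Hf Hl].
have /andP[q0 q1] := q01 Hf; have /andP[p0 p1] := p01 Hf.
have [A1 A2] := IH a b Hl; have [B1 B2] := IH a.+1 b Hl; have [C1 C2] := IH a b.+1 Hl.
do ?[case: ifP => _]; split=> //; apply: lerD; apply: ler_wpM2l; rewrite ?mulr_ge0 ?subr_ge0 //.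
- by apply: ler_wpM2r; rewrite ?below_ge0 ?below_anti.
- by apply: ler_wpM2l; rewrite ?below_ge0 ?below_anti.
Qed.

(** An arrival that is in fact illegal, being already probed or blocked at its other end, leaves the
    true history unchanged; by [Phi_anti] this is no worse for [e] than the counted probe. Edges
    away from [e] do not touch its endpoints at all. *)
Lemma PT_ge_Phi l h : lts l -> ~~ matched I h u -> ~~ matched I h v -> e \notin map fst h ->
  Phi l (nprobed I h u) (nprobed I h v) <= PT I q Fe l h.
Proof.
elim: l h => [|f l IH] h /= => [_|/andP[Hf Hl]] Mu Mv Hh; first by rewrite ler0n.
have /andP[q0 q1] := q01 Hf; have /andP[p0 p1] := p01 Hf.
have IHh := IH h Hl Mu Mv Hh.
have Hq : (1 - q f) * Phi l (nprobed I h u) (nprobed I h v) <= (1 - q f) * PT I q Fe l h.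
  by apply: ler_wpM2l => //; rewrite subr_ge0.
case: (eqVneq f e) => [E|Hne].
  rewrite E in Hq q0 q1 p0 p1 *; apply: lerD => //; rewrite -mulrA; apply: ler_wpM2l => //.
  have -> : legal_probe I h e = (nprobed I h u < t_ I u)%N && (nprobed I h v < t_ I v)%N.
    by rewrite /legal_probe He Hh Mu Mv.
  rewrite /below; case: (_ < _)%N; case: (_ < _)%N => /=; rewrite ?mul0r ?mulr0 ?mulr1 ?PT_ge0 //.
  rewrite (PT_one (h := rcons h (e, true))) ?mem_rcons ?mem_head // mulr1 lerDl.
  by rewrite mulr_ge0 ?subr_ge0 ?PT_ge0.
have fr o : ~~ (o && incident I u f) -> ~~ (o && incident I v f) ->
  Phi l (nprobed I h u + incident I u f) (nprobed I h v + incident I v f) <= PT I q Fe l (rcons h (f, o)).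
  move=> H1 H2; rewrite -!(@nprobed_rcons I h f o); apply: IH => //.
  - by rewrite matched_rcons negb_or H1.
  - by rewrite matched_rcons negb_or H2.
  - by rewrite map_rcons mem_rcons inE eq_sym negb_or Hne.
have [An1 An2] := Phi_anti (nprobed I h u) (nprobed I h v) Hl.
have Pos a b := Phi_ge0 a b Hl.
have PPos hh := PT_ge0 hh Hl.
case: (boolP (incident I u f)) => Hu.
  have Hv := wf_simple wfI He Hf Hne Hu.
  apply: lerD => //; rewrite -mulrA; apply: ler_wpM2l => //.
  have := fr false isT isT; rewrite Hu (negbTE Hv) addn1 addn0 => F.
  case: ifP => _.
    apply: (@le_trans _ _ ((1 - p f) * PT I q Fe l (rcons h (f, false)))).
      by apply: ler_wpM2l; rewrite ?subr_ge0.
    by rewrite lerDr mulr_ge0.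
  apply: le_trans IHh; apply: le_trans An1.
  by rewrite -[leRHS]mul1r; apply: ler_wpM2r => //; lra.
case: (boolP (incident I v f)) => Hv.
  apply: lerD => //; rewrite -mulrA; apply: ler_wpM2l => //.
  have := fr false isT isT; rewrite (negbTE Hu) Hv addn1 addn0 => F.
  case: ifP => _.
    apply: (@le_trans _ _ ((1 - p f) * PT I q Fe l (rcons h (f, false)))).
      by apply: ler_wpM2l; rewrite ?subr_ge0.
    by rewrite lerDr mulr_ge0.
  apply: le_trans IHh; apply: le_trans An2.
  by rewrite -[leRHS]mul1r; apply: ler_wpM2r => //; lra.
have F o : Phi l (nprobed I h u) (nprobed I h v) <= PT I q Fe l (rcons h (f, o)).
  by have := fr o; rewrite (negbTE Hu) (negbTE Hv) !andbF !addn0; apply.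
set X := if _ then _ else _.
have HX : Phi l (nprobed I h u) (nprobed I h v) <= X.
  rewrite /X; case: ifP => _ //.
  have := F true; have := F false; set A := PT _ _ _ _ _; set B := PT _ _ _ _ _; set P0 := Phi _ _ _.
  by move=> H1 H2; nra.
by move: HX IHh; set A := X; set B := PT _ _ _ _ _; set P0 := Phi _ _ _ => H1 H2; nra.
Qed.

Definition al (pr : pred nat) (t : nat) (pre : seq nat) (a : nat) : rat :=
  Ev q p (below t) (filter pr pre) a.
Local Notation alu := (al pu (t_ I u)).
Local Notation alv := (al pv (t_ I v)).

(** Splits [Phi] by the position of the first arrival of [e]: it missed its earlier positions in
    [pre], and each end survived [pre], independently of the other. *)
Fixpoint Ssum (pre l : seq nat) (a b : nat) : rat :=
  if l is f :: l' then
    (f == e)%:R * ((1 - q e) ^+ count_mem e pre * (alu pre a * alv pre b)) + Ssum (rcons pre f) l' a b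
  else 0.

(** [Ssum] extends its prefix at the end, [Phi] consumes its list from the front; this lemma
    reconciles the two orders. *)
Lemma Ssum_cons f pre l a b : (f < nE I)%N ->
  Ssum (f :: pre) l a b =
  if f == e then (1 - q e) * Ssum pre l a b
  else if incident I u f then q f * (1 - p f) * Ssum pre l a.+1 b + (1 - q f) * Ssum pre l a b
  else if incident I v f then q f * (1 - p f) * Ssum pre l a b.+1 + (1 - q f) * Ssum pre l a b
  else Ssum pre l a b.
Proof.
move=> Hf; elim: l pre a b => [|g l IH] pre a b /=.
  by do ?[case: ifP => _]; rewrite ?mulr0 ?addr0.
rewrite !IH /al /= {1 2}/pu {1 2}/pv; case: (eqVneq f e) => [->|Hne] /=.
  by rewrite add1n exprS; ring.
rewrite add0n; case: (boolP (incident I u f)) => Hu /=.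
  by rewrite (negbTE (wf_simple wfI He Hf Hne Hu)) /=; ring.
by case: (boolP (incident I v f)) => Hv /=; ring.
Qed.

Lemma Phi_Ssum l a b : lts l -> Phi l a b = q e * p e * Ssum [::] l a b.
Proof.
elim: l a b => [|f l IH] a b /= => [_|/andP[Hf Hl]]; first by rewrite mulr0.
rewrite !IH // (Ssum_cons [::]) // {1 2}/al /= mul1r.
by do ?[case: ifP => _] => /=; ring.
Qed.

Lemma al_ge0 pr t pre a : lts pre -> 0 <= al pr t pre a.
Proof.
move=> /allP Hl; apply: Ev_ge0 => [f|k]; last exact: below_ge0.
by rewrite mem_filter => /andP[_ /Hl Hf]; split; [apply: q01|apply: p01].
Qed.

Lemma Ssum_ge0 pre l a b : lts pre -> lts l -> 0 <= Ssum pre l a b.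
Proof.
have /andP[qe0 qe1] := q01 He.
elim: l pre => [|f l IH] pre //= Hp /andP[Hf Hl].
apply: addr_ge0; last by apply: IH => //; rewrite /lts all_rcons Hf.
by rewrite !mulr_ge0 ?ler0n ?al_ge0 // exprn_ge0 // subr_ge0.
Qed.

Lemma Ssum_cat pre l1 l2 a b : Ssum pre (l1 ++ l2) a b = Ssum pre l1 a b + Ssum (pre ++ l1) l2 a b.
Proof.
elim: l1 pre => [|f l1 IH] pre /=; first by rewrite cats0 add0r.
by rewrite IH cat_rcons addrA.
Qed.

Local Notation rnd k := (flatten (nseq k (iota 0 (nE I)))).

Lemma lts_iota a n : (a + n <= nE I)%N -> lts (iota a n).
Proof. by move=> H; apply/allP => f; rewrite mem_iota => /andP[_ Hf]; apply: leq_trans H. Qed.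

Lemma lts_rnd k : lts (rnd k).
Proof.
by elim: k => //= k IH; rewrite /lts all_cat; apply/andP; split; [apply: lts_iota|apply: IH].
Qed.

Lemma rnd_rcons k : rnd k ++ iota 0 (nE I) = rnd k.+1.
Proof. by rewrite -addn1 nseqD flatten_cat /= cats0. Qed.

Lemma iota_split : iota 0 (nE I) = iota 0 e ++ e :: iota e.+1 (nE I - e.+1).
Proof.
have E : nE I = (e + (1 + (nE I - e.+1)))%N by move: He; lia.
by rewrite {1}E iotaD.
Qed.

Lemma count_rnd k : count_mem e (rnd k) = k.
Proof.
have C1 : count_mem e (iota 0 (nE I)) = 1%N by rewrite count_uniq_mem ?iota_uniq // mem_iota He.
by elim: k => //= k IH; rewrite count_cat IH C1.
Qed.

Lemma al_prefix pr t l1 l2 a : lts (l1 ++ l2) -> al pr t (l1 ++ l2) a <= al pr t l1 a.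
Proof.
move=> /allP Hl; rewrite /al filter_cat; apply: Ev_prefix => [f|k|k].
- by rewrite -filter_cat mem_filter => /andP[_ /Hl Hf]; split; [apply: q01|apply: p01].
- exact: below_ge0.
- exact: below_anti.
Qed.

(** Where [e] stands inside a round is made irrelevant by prolonging the prefix to the end of that
    round, which only lowers survival ([al_prefix]). Hence [k] misses of [e] but [k + 1] rounds of
    arrivals. *)
Lemma Ssum_rounds k N : \sum_(j < N) (1 - q e) ^+ (k + j) * (alu (rnd (k + j).+1) 0 * alv (rnd (k + j).+1) 0)
  <= Ssum (rnd k) (rnd N) 0 0.
Proof.
have /andP[qe0 qe1] := q01 He.
elim: N k => [|N IH] k; first by rewrite big_ord0.
rewrite big_ord_recl -[rnd N.+1]/(iota 0 (nE I) ++ rnd N) Ssum_cat rnd_rcons.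
have -> : (k + nat_of_ord (@ord0 N) = k)%N by rewrite addn0.
apply: lerD; last first.
  apply: le_trans (IH k.+1); apply: ler_sum => j _.
  by have -> : (k + nat_of_ord (lift ord0 j) = k.+1 + j)%N by rewrite /= /bump /=; lia.
have L1 : lts (rnd k ++ iota 0 e) by rewrite /lts all_cat -!/(lts _) lts_rnd lts_iota //= ltnW.
rewrite [X in _ <= Ssum _ X _ _]iota_split Ssum_cat -[leLHS]add0r; apply: lerD.
  by apply: Ssum_ge0; [apply: lts_rnd|apply: lts_iota; rewrite /= ltnW].
rewrite /= eqxx mul1r count_cat count_rnd -[leLHS]addr0; apply: lerD; last first.
  apply: Ssum_ge0; last by apply: lts_iota; rewrite subnKC.
  by rewrite /lts all_rcons He.
have -> : count_mem e (iota 0 e) = 0%N.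
  by apply/count_memPn; rewrite mem_iota /= add0n ltnn.
rewrite addn0; apply: ler_wpM2l; first by rewrite exprn_ge0 // subr_ge0.
have Lr := lts_rnd k.+1.
have E : rnd k.+1 = (rnd k ++ iota 0 e) ++ e :: iota e.+1 (nE I - e.+1).
  by rewrite -rnd_rcons iota_split catA.
rewrite -[iota 0 (nE I) ++ rnd k]/(rnd k.+1) E; rewrite E in Lr.
by apply: ler_pM; rewrite ?al_ge0 ?al_prefix.
Qed.

Hypothesis capm : forall x, (x < nV I)%N -> \sum_(f < nE I | incident I x f) q f * p f <= d.
Hypothesis capt : forall x, (x < nV I)%N -> \sum_(f < nE I | incident I x f) q f <= d * (t_ I x)%:R.

Lemma wf_tmo x : (x < nV I)%N -> (0 < t_ I x)%N.
Proof.
move=> Hx; case/and5P: wfI => _ _ /eqP H3 _ /and4P[_ _ _ /allP H].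
by apply: H; rewrite mem_nth // H3.
Qed.

(** The edge [e] itself takes up [q e / d] of the timeout, so the other edges at the vertex load it
    by at most [d (t - q e / d)] per round. *)
Lemma vertex_ge x r k : (x < nV I)%N -> incident I x e -> (r <= t_ I x)%N -> (0 < r)%N ->
  (1 - d) ^+ k * (1 - (k%:R * (d / (1 - d)) * Num.max 0 ((t_ I x)%:R - 1 - q e / d)) ^+ r
                        / (t_ I x ^_ r)%:R)
  <= al (fun f => (f != e) && incident I x f) (t_ I x) (rnd k) 0.
Proof.
move=> Hx Hinc Hr r0; case/andP: (d01) => d0 d1.
have /andP[qe0 qed] := q0d He.
rewrite /al filter_flatten map_nseq; set F := filter _ _.
have inF f : f \in F -> (f < nE I)%N by rewrite mem_filter mem_iota => /andP[_ /andP[_]].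
have sumF (g : nat -> rat) : \sum_(f <- F) g f = \sum_(f < nE I | incident I x f) g f - g e.
  rewrite /F big_filter (_ : iota 0 (nE I) = index_iota 0 (nE I)) ?big_mkord; last by rewrite /index_iota subn0.
  rewrite [in RHS](bigD1 (Ordinal He)) //= [g e + _]addrC addrK.
  by apply: eq_bigl => f; rewrite andbC -val_eqE.
apply: arrivals_ge => //.
- by move=> f /inF Hf; split; [apply: q0d|apply: p01].
- rewrite (sumF (fun f => q f * p f)); have /andP[p0 _] := p01 He.
  have := capm Hx; have : 0 <= q e * p e by rewrite mulr_ge0.
  lra.
- rewrite sumF mulrBr mulrCA divff ?mulr1; last exact: lt0r_neq0.
  by have := capt Hx; lra.
- by apply/andP; split; [apply: divr_ge0 => //; apply: ltW|rewrite ler_pdivrMr // mul1r].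
Qed.

Local Notation s k := (k%:R * (d / (1 - d))).

(** For [t >= 2] the second moment suffices, as [(t - 1) ^ 2 <= t (t - 1)]. For [t = 1] the tight
    matching constraint leaves no load at all. *)
Lemma vertex_small x k : (x < nV I)%N -> incident I x e ->
  (1 - d) ^+ k * (1 - s k ^+ 2) <= al (fun f => (f != e) && incident I x f) (t_ I x) (rnd k) 0.
Proof.
move=> Hx Hinc; case/andP: (d01) => d0 d1; have /andP[qe0 qed] := q0d He.
have X0 : 0 <= q e / d by apply: divr_ge0 => //; apply: ltW.
have X1 : q e / d <= 1 by rewrite ler_pdivrMr // mul1r.
have D0 : 0 <= (1 - d) ^+ k by rewrite exprn_ge0 // subr_ge0 ltW.
have := wf_tmo Hx; case E : (t_ I x) => [|[|t]] // _.
  have := @vertex_ge x 1 k Hx Hinc; rewrite E => /(_ isT isT); apply: le_trans.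
  rewrite subrr sub0r [Num.max 0 _]max_l; last lra.
  by rewrite mulr0 expr1 mul0r subr0 mulr1 -[leRHS]mulr1 ler_wpM2l // lerBlDr lerDl sqr_ge0.
have := @vertex_ge x 2 k Hx Hinc; rewrite E => /(_ isT isT); apply: le_trans.
apply: ler_wpM2l => //; rewrite lerD2l lerN2 !ffactnS ffactn0 muln1 natrM /= -!natr1.
have y0 : (0 : rat) <= t%:R by rewrite ler0n.
move: X0 X1; set X := q e / d; set y := t%:R in y0 *; set S := s k => X0 X1.
rewrite [Num.max 0 _]max_r; last lra.
rewrite ler_pdivrMr; last by nra.
rewrite exprMn; apply: ler_wpM2l; first exact: sqr_ge0.
nra.
Qed.

(** Now the remaining load is at most [t - 3/2]. For [t = 2] the second moment gives
    [(1/2) ^ 2 / 2 = 1/8]; for [t >= 3] the third moment works because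
    [(t - 3/2) ^ 3 <= t (t - 1) (t - 2)]. *)
Lemma vertex_large x k : (x < nV I)%N -> incident I x e -> d / 2%:R <= q e ->
  (1 - d) ^+ k * (1 - Num.max (s k ^+ 2 / 8%:R) (s k ^+ 3)) <=
  al (fun f => (f != e) && incident I x f) (t_ I x) (rnd k) 0.
Proof.
move=> Hx Hinc Hh; case/andP: (d01) => d0 d1; have /andP[qe0 qed] := q0d He.
have X0 : 1 / 2%:R <= q e / d by rewrite ler_pdivlMr //; lra.
have X1 : q e / d <= 1 by rewrite ler_pdivrMr // mul1r.
have D0 : 0 <= (1 - d) ^+ k by rewrite exprn_ge0 // subr_ge0 ltW.
have S0 : 0 <= s k by rewrite mulr_ge0 ?ler0n // divr_ge0 ?subr_ge0 // ltW.
have := wf_tmo Hx; case E : (t_ I x) => [|[|[|t]]] // _.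
- have := @vertex_ge x 1 k Hx Hinc; rewrite E => /(_ isT isT); apply: le_trans.
  rewrite subrr sub0r [Num.max 0 _]max_l; last lra.
  rewrite mulr0 expr1 mul0r subr0 mulr1 -[leRHS]mulr1 ler_wpM2l // lerBlDr lerDl.
  by rewrite le_max exprn_ge0 // orbT.
- have := @vertex_ge x 2 k Hx Hinc; rewrite E => /(_ isT isT); apply: le_trans.
  apply: ler_wpM2l => //; rewrite lerD2l lerN2 le_max; apply/orP; left.
  rewrite !ffactnS ffactn0 muln1 natrM /=.
  move: X0 X1 S0; set X := q e / d; set S := s k => X0 X1 S0.
  rewrite [Num.max 0 _]max_r; last lra.
  rewrite exprMn -mulrA; apply: ler_wpM2l; first exact: sqr_ge0.
  by rewrite expr2; nra.
- have := @vertex_ge x 3 k Hx Hinc; rewrite E => /(_ isT isT); apply: le_trans.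
  apply: ler_wpM2l => //; rewrite lerD2l lerN2 le_max; apply/orP; right.
  rewrite !ffactnS ffactn0 muln1 !natrM /= -!natr1.
  have y0 : (0 : rat) <= t%:R by rewrite ler0n.
  move: X0 X1 S0; set X := q e / d; set y := t%:R in y0 *; set S := s k => X0 X1 S0.
  rewrite [Num.max 0 _]max_r; last lra.
  have P3 : 0 < (y + 1 + 1 + 1) * ((y + 1 + 1) * (y + 1)) by rewrite !mulr_gt0 //; lra.
  rewrite ler_pdivrMr // exprMn; apply: ler_wpM2l; first exact: exprn_ge0.
  have Z0 : 0 <= y + 1 + 1 + 1 - 1 - X by lra.
  have Z1 : y + 1 + 1 + 1 - 1 - X <= y + 3%:R / 2%:R by lra.
  apply: (@le_trans _ _ ((y + 3%:R / 2%:R) ^+ 3)); first by rewrite lerXn2r ?nnegrE //; lra.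
  by rewrite !exprS expr0 mulr1; nra.
Qed.

(** The first two hypotheses serve the cases [q e <= d/2] and [q e > d/2]. In the former [e] misses
    [k] rounds with probability at least [(1 - d/2) ^ k] but only [vertex_small] applies; in the
    latter this drops to [(1 - d) ^ k], with the better [vertex_large]. *)
Lemma edge_ge N kap :
  kap <= \sum_(k < N) (1 - d / 2%:R) ^+ k * ((1 - d) ^+ k.+1 * (1 - s k.+1 ^+ 2)) ^+ 2 ->
  kap <= \sum_(k < N) (1 - d) ^+ k * ((1 - d) ^+ k.+1 * (1 - Num.max (s k.+1 ^+ 2 / 8%:R) (s k.+1 ^+ 3))) ^+ 2 ->
  (forall k, (k <= N)%N -> 0 <= s k <= 1) ->
  q e * p e * kap <= PT I q Fe (rnd N) [::].
Proof.
move=> N1 N2 Hs; case/andP: (d01) => d0 d1; have /andP[qe0 qed] := q0d He.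
have /andP[pe0 pe1] := p01 He; have [un vn _] := wf_ends wfI He.
have iu : incident I u e by rewrite /incident eqxx.
have iv : incident I v e by rewrite /incident eqxx orbT.
have D0 k : 0 <= (1 - d) ^+ k by rewrite exprn_ge0 // subr_ge0 ltW.
apply: le_trans (PT_ge_Phi (h := [::]) (lts_rnd N) isT isT isT).
rewrite /nprobed /= Phi_Ssum ?lts_rnd //; apply: ler_wpM2l; first by rewrite mulr_ge0.
apply: le_trans (Ssum_rounds 0 N).
case: (leP (q e) (d / 2%:R)) => Hq.
  apply: (le_trans N1); apply: ler_sum => k _; rewrite add0n.
  have /andP[s0 s1] := Hs k.+1 (ltn_ord k).
  have B0 : 0 <= (1 - d) ^+ k.+1 * (1 - s k.+1 ^+ 2).
    by rewrite mulr_ge0 ?D0 // subr_ge0 exprn_ile1.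
  apply: ler_pM; rewrite ?exprn_ge0 ?sqr_ge0 //; first lra.
    by rewrite lerXn2r ?nnegrE; lra.
  by rewrite expr2; apply: ler_pM => //; apply: vertex_small.
apply: (le_trans N2); apply: ler_sum => k _; rewrite add0n.
have /andP[s0 s1] := Hs k.+1 (ltn_ord k).
have B0 : 0 <= (1 - d) ^+ k.+1 * (1 - Num.max (s k.+1 ^+ 2 / 8%:R) (s k.+1 ^+ 3)).
  rewrite mulr_ge0 ?D0 // subr_ge0 ge_max exprn_ile1 // andbT.
  by have : s k.+1 ^+ 2 <= 1 by [rewrite exprn_ile1]; lra.
apply: ler_pM; rewrite ?exprn_ge0 ?sqr_ge0 //; first lra.
  by rewrite lerXn2r ?nnegrE; lra.
by rewrite expr2; apply: ler_pM => //; apply: vertex_large => //; apply: ltW.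
Qed.

End OneEdge.
End Rounds.
Export Rounds.

Module Numerics.
Local Open Scope ring_scope.
Delimit Scope Z_scope with BZ.

(** * Numerical bounds *)

(* Locked, as are the constants below: unary arithmetic must never be run on them. *)
Definition z2r : Z -> rat := locked (fun z => (int_of_Z z)%:~R).

Lemma z2rD x y : z2r (Z.add x y) = z2r x + z2r y.
Proof. by rewrite /z2r -lock -[Z.add x y]/(x + y) rmorphD /= rmorphD. Qed.
Lemma z2rM x y : z2r (Z.mul x y) = z2r x * z2r y.
Proof. by rewrite /z2r -lock -[Z.mul x y]/(x * y) rmorphM /= rmorphM. Qed.
Lemma z2rN x : z2r (Z.opp x) = - z2r x.
Proof. by rewrite /z2r -lock -[Z.opp x]/(- x) rmorphN /= rmorphN. Qed.
Lemma z2rB x y : z2r (Z.sub x y) = z2r x - z2r y.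
Proof. by rewrite -Z.add_opp_r z2rD z2rN. Qed.
Lemma z2r_ge0 x : Z.le Z0 x -> 0 <= z2r x.
Proof. by rewrite /z2r -lock; case: x => [|p|p] // _; rewrite /= -?pmulrn ?ler0n. Qed.
Lemma z2r_le x y : Z.le x y -> z2r x <= z2r y.
Proof. by move=> H; rewrite -subr_ge0 -z2rB; apply: z2r_ge0; lia. Qed.
Lemma z2r_div x y : Z.lt Z0 y -> z2r (Z.div x y) * z2r y <= z2r x.
Proof. by move=> H; rewrite -z2rM; apply: z2r_le; rewrite Z.mul_comm; apply: Z.mul_div_le. Qed.
Lemma z2r1 : z2r 1%BZ = 1.
Proof. by rewrite /z2r -lock. Qed.
Lemma z2r0 : z2r 0%BZ = 0.
Proof. by rewrite /z2r -lock. Qed.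
Lemma z2r_nat n : z2r (Z.of_nat n) = n%:R.
Proof.
elim: n => [|n IH]; first by rewrite /z2r -lock.
by rewrite Nat2Z.inj_succ -Z.add_1_r z2rD IH z2r1 natr1.
Qed.

(* Horner evaluation of [sum_k g^k a_(j+k)] in fixed point, rounding down. *)
Fixpoint horner_Z (aZ : Z -> Z) (gZ sc : Z) (n : nat) (j : Z) : Z :=
  if n is n'.+1 then
    Z.add (aZ j) (Z.div (Z.mul gZ (horner_Z aZ gZ sc n' (Z.add j 1%BZ))) sc)
  else Z0.

(** All partial values are nonnegative, so rounding each coefficient, the ratio and each quotient
    down keeps the result a lower bound. *)
Lemma horner_Z_le (a : nat -> rat) (g : rat) aZ gZ sc n j :
  Z.lt Z0 sc -> Z.le Z0 gZ -> z2r gZ <= z2r sc * g ->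
  (forall k, (k < j + n)%N -> Z.le Z0 (aZ (Z.of_nat k)) /\ z2r (aZ (Z.of_nat k)) <= z2r sc * a k) ->
  Z.le Z0 (horner_Z aZ gZ sc n (Z.of_nat j)) /\
  z2r (horner_Z aZ gZ sc n (Z.of_nat j)) <= z2r sc * \sum_(k < n) g ^+ k * a (j + k)%N.
Proof.
move=> sc0 g0 Hg; elim: n j => [|n IH] j Ha /=.
  by split; rewrite ?big_ord0 ?mulr0 ?z2r0.
have E : Z.add (Z.of_nat j) 1 = Z.of_nat j.+1 by lia.
rewrite E; have [|H1 H2] := IH j.+1; first by move=> k Hk; apply: Ha; lia.
have [A1 A2] := Ha j ltac:(lia).
set T := horner_Z _ _ _ _ _ in H1 H2 *.
have scr : 0 < z2r sc.
  rewrite lt_def z2r_ge0 ?andbT; last lia.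
  by apply/eqP => E0; move: (@z2r_le 1%BZ sc ltac:(lia)); rewrite E0 z2r1 ler10.
split; first by apply: Z.add_nonneg_nonneg => //; apply: Z.div_pos => //; lia.
rewrite z2rD big_ord_recl expr0 mul1r addn0 mulrDr; apply: lerD => //.
have D := @z2r_div (Z.mul gZ T) sc sc0; rewrite z2rM in D.
rewrite -(ler_pM2r scr); apply: (le_trans D).
have -> : \sum_(i < n) g ^+ lift ord0 i * a (j + lift ord0 i)%N =
   g * \sum_(k < n) g ^+ k * a (j.+1 + k)%N.
  rewrite mulr_sumr; apply: eq_bigr => i _.
  by rewrite /= /bump /= add1n exprS addnS addSn mulrA.
set S := \sum_(k < n) _ in H2 *.
have g0r : 0 <= z2r gZ by apply: z2r_ge0.
have T0r : 0 <= z2r T by apply: z2r_ge0.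
apply: (@le_trans _ _ (z2r gZ * (z2r sc * S))); first by rewrite ler_wpM2l.
have sS : 0 <= z2r sc * S by apply: le_trans H2.
apply: (@le_trans _ _ (z2r sc * g * (z2r sc * S))); first by rewrite ler_wpM2r.
by rewrite le_eqVlt; apply/orP; left; apply/eqP; ring.
Qed.

(** This is [(1 + 2/512) / 1024]. The constant [Dz = 262144 - 257] is the numerator of [1 - dz], so
    that [sk k = 257 k / Dz]. *)
Definition dz : rat := locked (257%:R / (512%:R * 512%:R)).
Lemma dzE : dz = 257%:R / (512%:R * 512%:R). Proof. by rewrite /dz -lock. Qed.
Definition Dz : Z := 261887%BZ.
Definition scz : Z := (2 ^ 40)%BZ.
Definition sq (x : Z) : Z := Z.mul x x.
(** For [s = n / Dz], the fixed-point value of [(1 - s^2)^2]; [t2Z] and [t3Z] do the same for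
    [(1 - s^3)^2] and [(1 - s^2/8)^2]. The maximum [b2] turns into the minimum in [a2Z]. *)
Definition t1Z (n : Z) : Z := Z.div (Z.mul scz (sq (Z.sub (sq Dz) (sq n)))) (sq (sq Dz)).
Definition t2Z (n : Z) : Z :=
  Z.div (Z.mul scz (sq (Z.sub (Z.mul (sq Dz) Dz) (Z.mul (sq n) n)))) (sq (Z.mul (sq Dz) Dz)).
Definition t3Z (n : Z) : Z :=
  Z.div (Z.mul scz (sq (Z.sub (Z.mul 8 (sq Dz)) (sq n)))) (Z.mul 64 (sq (sq Dz))).
Definition a1Z (j : Z) : Z := t1Z (Z.mul 257 (Z.add j 1)).
Definition a2Z (j : Z) : Z :=
  Z.min (t3Z (Z.mul 257 (Z.add j 1))) (t2Z (Z.mul 257 (Z.add j 1))).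

Definition sk (k : nat) : rat := k%:R * (dz / (1 - dz)).
Definition b2 (s : rat) : rat := Num.max (s ^+ 2 / 8%:R) (s ^+ 3).

Lemma z2r_pos (p : positive) : z2r (Zpos p) = (Pos.to_nat p)%:R.
Proof. by rewrite -positive_nat_Z z2r_nat. Qed.

Definition dD : rat := z2r Dz.
Lemma dD_neq0 : dD != 0.
Proof. by rewrite /dD /Dz z2r_pos pnatr_eq0; lia. Qed.

Lemma z2r_lit (p : positive) (n : nat) : Pos.to_nat p = n -> z2r (Zpos p) = n%:R.
Proof. by rewrite z2r_pos => ->. Qed.

(* Numerals are split into small factors, since [nat] literals are unary. *)
Lemma z257 : z2r 257 = 257%:R. Proof. exact: z2r_lit. Qed.
Lemma z512' : z2r 512 = 512%:R. Proof. exact: z2r_lit. Qed.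
Lemma z1024' : z2r 1024 = 1024%:R. Proof. exact: z2r_lit. Qed.
Lemma z278 : z2r 278 = 278%:R. Proof. exact: z2r_lit. Qed.
Lemma z8 : z2r 8 = 8%:R. Proof. exact: z2r_lit. Qed.
Lemma z64 : z2r 64 = 64%:R. Proof. exact: z2r_lit. Qed.

Lemma dD_val : dD = 512%:R * 512%:R - 257%:R.
Proof.
have E : Dz = Z.sub (Z.mul 512 512) 257 by [].
by rewrite /dD E z2rB z2rM z257 z512'.
Qed.

Lemma A_neq0 : (512%:R * 512%:R : rat) != 0.
Proof. by have h : (512%:R : rat) != 0; [rewrite pnatr_eq0 | exact: (mulf_neq0 h h)]. Qed.

Lemma ratio_shift (A B k : rat) : A != 0 -> A - B != 0 -> k * (B / A / (1 - B / A)) = B * k / (A - B).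
Proof. by move=> H1 H2; field; rewrite ?H1 ?H2. Qed.

Lemma skE k : sk k = (257%:R * k%:R) / dD.
Proof.
rewrite /sk dzE; have := dD_neq0; rewrite dD_val => H.
exact: (ratio_shift _ A_neq0 H).
Qed.

Lemma nZ_val k : z2r (Z.mul 257 (Z.add (Z.of_nat k) 1)) = 257%:R * k.+1%:R.
Proof. by rewrite z2rM z2rD z2r_nat z2r1 z257 natr1. Qed.

Lemma div_lb x y (v : rat) : Z.lt Z0 y -> z2r x <= v * z2r y -> z2r (Z.div x y) <= v.
Proof.
move=> y0 H; have y0r : 0 < z2r y.
  rewrite lt_def z2r_ge0 ?andbT; last lia.
  by apply/eqP => E0; move: (@z2r_le 1%BZ y ltac:(lia)); rewrite E0 z2r1 ler10.
by rewrite -(ler_pM2r y0r); apply: le_trans H; apply: z2r_div.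
Qed.

Lemma term1 (s D w : rat) : D != 0 ->
  s * ((D * D - w * w) * (D * D - w * w)) = s * (1 - (w / D) ^+ 2) ^+ 2 * (D * D * (D * D)).
Proof. by move=> H; field. Qed.
Lemma term2 (s D w : rat) : D != 0 ->
  s * ((D * D * D - w * w * w) * (D * D * D - w * w * w)) =
  s * (1 - (w / D) ^+ 3) ^+ 2 * (D * D * D * (D * D * D)).
Proof. by move=> H; field. Qed.
Lemma term3 (s D w : rat) : D != 0 ->
  s * ((8%:R * (D * D) - w * w) * (8%:R * (D * D) - w * w)) =
  s * (1 - (w / D) ^+ 2 / 8%:R) ^+ 2 * (64%:R * (D * D * (D * D))).
Proof. by move=> H; field. Qed.

Lemma t1Z_le w : Z.le Z0 (t1Z w) /\ z2r (t1Z w) <= z2r scz * (1 - (z2r w / dD) ^+ 2) ^+ 2.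
Proof.
split; first by apply: Z.div_pos; [apply: Z.mul_nonneg_nonneg; [|apply: Z.square_nonneg]|].
apply: div_lb; first by [].
by rewrite /sq !z2rM !z2rB !z2rM -/dD (term1 _ _ dD_neq0).
Qed.
Lemma t2Z_le w : Z.le Z0 (t2Z w) /\ z2r (t2Z w) <= z2r scz * (1 - (z2r w / dD) ^+ 3) ^+ 2.
Proof.
split; first by apply: Z.div_pos; [apply: Z.mul_nonneg_nonneg; [|apply: Z.square_nonneg]|].
apply: div_lb; first by [].
by rewrite /sq !z2rM !z2rB !z2rM -/dD (term2 _ _ dD_neq0).
Qed.
Lemma t3Z_le w : Z.le Z0 (t3Z w) /\ z2r (t3Z w) <= z2r scz * (1 - (z2r w / dD) ^+ 2 / 8%:R) ^+ 2.
Proof.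
split; first by apply: Z.div_pos; [apply: Z.mul_nonneg_nonneg; [|apply: Z.square_nonneg]|].
apply: div_lb; first by [].
by rewrite (z2rM 64) z64 /sq !z2rM !z2rB !z2rM z8 -/dD (term3 _ _ dD_neq0).
Qed.

Lemma a1Z_le k : Z.le Z0 (a1Z (Z.of_nat k)) /\
  z2r (a1Z (Z.of_nat k)) <= z2r scz * (1 - sk k.+1 ^+ 2) ^+ 2.
Proof. by rewrite skE -nZ_val; apply: t1Z_le. Qed.

Lemma a2Z_le k : Z.le Z0 (a2Z (Z.of_nat k)) /\
  z2r (a2Z (Z.of_nat k)) <= z2r scz * (1 - b2 (sk k.+1)) ^+ 2.
Proof.
rewrite skE -nZ_val /b2.
have [A1 A2] := t3Z_le (Z.mul 257 (Z.add (Z.of_nat k) 1)).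
have [B1 B2] := t2Z_le (Z.mul 257 (Z.add (Z.of_nat k) 1)).
split; first exact: Z.min_glb.
rewrite maxEle; case: ifP => _.
  exact: le_trans (z2r_le (Z.le_min_r _ _)) B2.
exact: le_trans (z2r_le (Z.le_min_l _ _)) A2.
Qed.

(* The ratios [(1 - d/2) (1 - d)^2] and [(1 - d)^3]. *)
Definition g1Z : Z := Z.div (Z.mul scz (Z.mul (524288 - 257) (sq (262144 - 257)))) (Z.mul 524288 (sq 262144)).
Definition g2Z : Z := Z.div (Z.mul scz (Z.mul (262144 - 257) (sq (262144 - 257)))) (Z.mul 262144 (sq 262144)).

Lemma z512 : z2r 262144 = (512%:R * 512%:R).
Proof. by have -> : 262144%BZ = Z.mul 512 512 by []; rewrite z2rM z512'. Qed.
Lemma z1024 : z2r 524288 = (1024%:R * 512%:R).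
Proof. by have -> : 524288%BZ = Z.mul 1024 512 by []; rewrite z2rM z512' z1024'. Qed.

Lemma ratio1 (s A B : rat) : A != 0 ->
  s * ((2%:R * A - B) * ((A - B) * (A - B))) =
  s * ((1 - B / A / 2%:R) * (1 - B / A) ^+ 2) * (2%:R * A * (A * A)).
Proof. by move=> H; field. Qed.
Lemma ratio2 (s A B : rat) : A != 0 ->
  s * ((A - B) * ((A - B) * (A - B))) = s * (1 - B / A) ^+ 3 * (A * (A * A)).
Proof. by move=> H; field. Qed.

Lemma z2r_num (S A2 A B : Z) :
  z2r (Z.mul S (Z.mul (Z.sub A2 B) (sq (Z.sub A B)))) =
  z2r S * ((z2r A2 - z2r B) * ((z2r A - z2r B) * (z2r A - z2r B))).
Proof. by rewrite /sq !z2rM !z2rB. Qed.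
Lemma z2r_den (A2 A : Z) : z2r (Z.mul A2 (sq A)) = z2r A2 * (z2r A * z2r A).
Proof. by rewrite /sq !z2rM. Qed.

Lemma le_ratio1 (s A A2 B : rat) : A != 0 -> A2 = 2%:R * A ->
  s * ((A2 - B) * ((A - B) * (A - B))) <= s * ((1 - B / A / 2%:R) * (1 - B / A) ^+ 2) * (A2 * (A * A)).
Proof. by move=> A0 ->; rewrite (ratio1 _ _ A0). Qed.
Lemma le_ratio2 (s A B : rat) : A != 0 ->
  s * ((A - B) * ((A - B) * (A - B))) <= s * (1 - B / A) ^+ 3 * (A * (A * A)).
Proof. by move=> A0; rewrite (ratio2 _ _ A0). Qed.
Lemma double_mul (x y z : rat) : y = 2%:R * x -> y * z = 2%:R * (x * z).
Proof. by move=> ->; rewrite mulrA. Qed.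
Lemma num1024 : 1024%:R = 2%:R * 512%:R :> rat.
Proof. by rewrite -natrM. Qed.

Lemma g1Z_le : z2r g1Z <= z2r scz * ((1 - dz / 2%:R) * (1 - dz) ^+ 2).
Proof.
rewrite dzE; apply: div_lb; first by [].
rewrite z2r_num z2r_den z257 z512 z1024.
exact: (le_ratio1 _ _ A_neq0 (double_mul _ num1024)).
Qed.
Lemma g2Z_le : z2r g2Z <= z2r scz * (1 - dz) ^+ 3.
Proof.
rewrite dzE; apply: div_lb; first by [].
rewrite z2r_num z2r_den z257 z512; exact: (le_ratio2 _ _ A_neq0).
Qed.

Lemma dz_bounds : 0 < dz <= 1 / 1000%:R.
Proof. by rewrite dzE; apply/andP; split; lra. Qed.

(** The sums are checked against 278 and not 277; the surplus pays for the factor split off in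
    [rounds_shift]. *)
Lemma horner1 : Z.le (Z.mul scz 278) (horner_Z a1Z g1Z scz 1000 (Z.of_nat 0)).
Proof. by apply/Z.leb_le; vm_compute. Qed.
Lemma horner2 : Z.le (Z.mul scz 278) (horner_Z a2Z g2Z scz 1000 (Z.of_nat 0)).
Proof. by apply/Z.leb_le; vm_compute. Qed.

Lemma scz_gt0 : 0 < z2r scz.
Proof.
rewrite lt_def z2r_ge0 ?andbT //.
by apply/eqP => E0; move: (@z2r_le 1%BZ scz ltac:(by [])); rewrite E0 z2r1 ler10.
Qed.

Lemma scz_pos : Z.lt Z0 scz. Proof. by []. Qed.
Lemma g1Z_ge0 : Z.le Z0 g1Z. Proof. by apply/Z.leb_le; vm_compute. Qed.
Lemma g2Z_ge0 : Z.le Z0 g2Z. Proof. by apply/Z.leb_le; vm_compute. Qed.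

(** The terms contain [(1 - d) ^ (k+1)] squared, the computed series only the power [k]. The missing
    factor [(1 - d) ^ 2 >= 1 - 2 d >= 1 - 1/500] costs [c / 500]. *)
Lemma rounds_shift N (b : nat -> rat) (g d c K : rat) : 0 < d <= 1 / 1000%:R ->
  0 <= c -> K + c / 500%:R <= c ->
  c <= \sum_(k < N) (g * (1 - d) ^+ 2) ^+ k * b (0 + k)%N ^+ 2 ->
  K <= \sum_(k < N) g ^+ k * ((1 - d) ^+ k.+1 * b k) ^+ 2.
Proof.
move=> /andP[d0 d1] c0 Hc.
set S := \sum_(k < N) (g * _) ^+ k * _ => cS.
apply: (@le_trans _ _ ((1 - d) ^+ 2 * S)).
  apply: (@le_trans _ _ ((1 - d) ^+ 2 * c)); last exact: (ler_wpM2l (sqr_ge0 _) cS).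
  have -> : (1 - d) ^+ 2 * c = c - 2%:R * (c * d) + c * d ^+ 2 by ring.
  have x0 := mulr_ge0 c0 (sqr_ge0 d).
  have := ler_wpM2l c0 d1; move: x0; move: (c * d ^+ 2) (c * d) => x y; lra.
rewrite /S mulr_sumr; apply: ler_sum => k _.
have -> : (g * (1 - d) ^+ 2) ^+ k = g ^+ k * ((1 - d) ^+ k) ^+ 2 by rewrite exprMn -exprM mulnC exprM.
rewrite le_eqVlt; apply/orP; left; apply/eqP; rewrite add0n [(1 - d) ^+ k.+1]exprS.
move: ((1 - d) ^+ k) (g ^+ k) => x y; ring.
Qed.

Lemma num277 : 277%:R + 278%:R / 500%:R <= 278%:R :> rat. Proof. lra. Qed.
Lemma num278 : 0 <= 278%:R :> rat. Proof. exact: ler0n. Qed.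

Lemma rounds_horner sc c aZ gZ N (b : nat -> rat) (g d K : rat) :
  Z.lt Z0 sc -> 0 < z2r sc -> 0 <= z2r c -> K + z2r c / 500%:R <= z2r c ->
  Z.le Z0 gZ -> z2r gZ <= z2r sc * (g * (1 - d) ^+ 2) ->
  (forall k, Z.le Z0 (aZ (Z.of_nat k)) /\ z2r (aZ (Z.of_nat k)) <= z2r sc * b k ^+ 2) ->
  Z.le (Z.mul sc c) (horner_Z aZ gZ sc N (Z.of_nat 0)) -> 0 < d <= 1 / 1000%:R ->
  K <= \sum_(k < N) g ^+ k * ((1 - d) ^+ k.+1 * b k) ^+ 2.
Proof.
move=> sc0 scr c0 Hc g0 Hg Ha Hh Hd.
have [_ H] := @horner_Z_le (fun k => b k ^+ 2) _ _ _ _ N 0 sc0 g0 Hg (fun k _ => Ha k).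
have {H} := le_trans (z2r_le Hh) H; rewrite z2rM (ler_pM2l scr); exact: (rounds_shift Hd c0 Hc).
Qed.

Lemma z278_ge0 : 0 <= z2r 278. Proof. rewrite z278; exact: num278. Qed.
Lemma z278_gap : 277%:R + z2r 278 / 500%:R <= z2r 278. Proof. rewrite z278; exact: num277. Qed.

Lemma rounds1 : 277%:R <= \sum_(k < 1000) (1 - dz / 2%:R) ^+ k *
  ((1 - dz) ^+ k.+1 * (1 - sk k.+1 ^+ 2)) ^+ 2.
Proof. exact: (rounds_horner scz_pos scz_gt0 z278_ge0 z278_gap g1Z_ge0 g1Z_le a1Z_le horner1 dz_bounds). Qed.

Lemma rounds2 : 277%:R <= \sum_(k < 1000) (1 - dz) ^+ k *
  ((1 - dz) ^+ k.+1 * (1 - b2 (sk k.+1))) ^+ 2.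
Proof.
have H : z2r g2Z <= z2r scz * ((1 - dz) * (1 - dz) ^+ 2) by rewrite -exprS; apply: g2Z_le.
exact: (rounds_horner scz_pos scz_gt0 z278_ge0 z278_gap g2Z_ge0 H a2Z_le horner2 dz_bounds).
Qed.

Lemma frac01 (x D : rat) : 0 <= x -> 0 < D -> x <= D -> 0 <= x / D <= 1.
Proof.
move=> x0 D0 xD; apply/andP; split; first exact: divr_ge0 x0 (ltW D0).
by rewrite ler_pdivrMr // mul1r.
Qed.

(** This is why there are 1000 rounds and not 1024: [257 * 1000 < 261887], while at 1024 the
    survival bounds would already be negative. *)
Lemma sk_le1 k : (k <= 1000)%N -> 0 <= sk k <= 1.
Proof.
move=> Hk; have k0 : (0 : rat) <= k%:R by exact: ler0n.
have k1 : (k%:R : rat) <= 1000%:R by rewrite ler_nat.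
clear Hk; rewrite skE dD_val; apply: frac01; lra.
Qed.
End Numerics.
Export Numerics.

Module Marginals.
Local Open Scope ring_scope.

(** * The probing marginals of a strategy are LP-feasible *)

Lemma run_strat_ext S r fuel h : exists h', run_strat S r fuel h = h ++ h'.
Proof.
elim: fuel h => [|f IH] h /=; first by exists [::]; rewrite cats0.
case: (S h) => [e|]; last by exists [::]; rewrite cats0.
by have [h' ->] := IH (rcons h (e, nth false r e)); rewrite cat_rcons; eexists.
Qed.

Lemma run_strat_outcome S r fuel h :
  all (fun x => x.2 == nth false r x.1) h -> all (fun x => x.2 == nth false r x.1) (run_strat S r fuel h).
Proof.
elim: fuel h => [|f IH] h //= Hh; case: (S h) => [e|] //.
by apply: IH; rewrite all_rcons /= eqxx.
Qed.

(** Two runs whose realizations differ only at [e] coincide until [e] is probed, and at that moment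
    both probe it. *)
Lemma run_strat_fresh S (r r' : seq bool) e fuel h :
  (forall i, i != e -> nth false r i = nth false r' i) ->
  (e \in map fst (run_strat S r fuel h)) = (e \in map fst (run_strat S r' fuel h)).
Proof.
move=> Hr; elim: fuel h => [|f IH] h //=; case: (S h) => [e'|] //.
case: (eqVneq e' e) => [->|Hne]; last by rewrite (Hr _ Hne).
have [h1 ->] := run_strat_ext S r f (rcons h (e, nth false r e)).
have [h2 ->] := run_strat_ext S r' f (rcons h (e, nth false r' e)).
by rewrite !map_cat !mem_cat !map_rcons !mem_rcons !mem_head.
Qed.

Lemma legal_uniq I h : legal_history I h -> uniq (map fst h).
Proof.
elim/last_ind: h => // h x IH; rewrite legal_history_rcons => /andP[/IH Hu Hl].
by rewrite map_rcons rcons_uniq Hu andbT; case/and5P: Hl.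
Qed.

Lemma legal_lt I h e : legal_history I h -> e \in map fst h -> (e < nE I)%N.
Proof.
elim/last_ind: h => // h x IH; rewrite legal_history_rcons => /andP[/IH Hu Hl].
by rewrite map_rcons mem_rcons inE => /orP[/eqP ->|/Hu //]; case/andP: Hl.
Qed.

Lemma legal_matched I h v : legal_history I h ->
  (count (fun x => x.2 && incident I v x.1) h <= 1)%N.
Proof.
elim/last_ind: h => // h x IH; rewrite legal_history_rcons => /andP[/IH Hu Hl].
rewrite -cats1 count_cat /= addn0; case: (boolP (x.2 && _)) => Hx; last by rewrite addn0.
suff -> : count (fun x => x.2 && incident I v x.1) h = 0%N by [].
apply/eqP; rewrite -leqn0 leqNgt -has_count.
case/andP: Hx => _ Hi; case/and5P: Hl => _ _ H1 H2 _.
by case/orP: Hi => /eqP <-.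
Qed.

Lemma legal_nprobed I h v : legal_history I h -> (nprobed I h v <= t_ I v)%N.
Proof.
elim/last_ind: h => // h x IH; rewrite legal_history_rcons => /andP[/IH Hu Hl].
rewrite /nprobed -cats1 count_cat /= addn0; case: (boolP (incident _ _ _)) => Hx; last by rewrite addn0.
rewrite addn1; case/and5P: Hl => _ _ _ _ /andP[H1 H2].
by case/orP: Hx => /eqP <-.
Qed.

Lemma sum_history I h (F : nat -> rat) : legal_history I h ->
  \sum_(x <- h) F x.1 = \sum_(e < nE I) (nat_of_ord e \in map fst h)%:R * F e.
Proof.
move=> Hl; rewrite -(big_map fst xpredT) /=.
have -> : \sum_(i <- map fst h) F i = \sum_(i <- [seq e <- iota 0 (nE I) | e \in map fst h]) F i.
  apply: perm_big; apply: uniq_perm; first exact: legal_uniq Hl.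
    by rewrite filter_uniq ?iota_uniq.
  move=> e; rewrite mem_filter mem_iota /= add0n.
  by case: (boolP (e \in map fst h)) => // /(legal_lt Hl) ->.
rewrite big_filter big_mkcond (_ : iota 0 (nE I) = index_iota 0 (nE I)) ?big_mkord; last by rewrite /index_iota subn0.
by apply: eq_bigr => e _; case: ifP => _; rewrite ?mul1r ?mul0r.
Qed.

Section Marginals.
Variables (I : instance) (S : strategy).
Hypothesis wfI : wf_instance I.
Hypothesis valS : valid_strategy I S.

Definition probed (r : seq bool) (e : nat) : rat := (e \in map fst (strat_hist I S r))%:R.
Definition marg (e : nat) : rat := Er I (fun r => probed r e).

(** The decision to probe [e] is taken before its existence is revealed, so the two are independent.
    This is what makes both the value and the matching constraint linear in [marg]. *)
Lemma Er_probed e : (e < nE I)%N ->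
  Er I (fun r => (nth false r e)%:R * probed r e) = p_ I e * marg e.
Proof.
move=> He; apply: Er_fresh => // r r' Hr.
by rewrite /probed /strat_hist (run_strat_fresh _ _ _ Hr).
Qed.

Lemma strat_outcome r : all (fun x => x.2 == nth false r x.1) (strat_hist I S r).
Proof. exact: run_strat_outcome. Qed.

Lemma sum_outcome (r : (nE I).-tuple bool) (F : nat -> rat) :
  \sum_(x <- strat_hist I S r | x.2) F x.1 =
  \sum_(e < nE I) F e * ((nth false r e)%:R * probed r e).
Proof.
rewrite big_mkcond big_seq.
rewrite (eq_bigr (fun x => (nth false r x.1)%:R * F x.1)); last first.
  by move=> x /(allP (strat_outcome r)) /eqP ->; case: ifP => _; rewrite ?mul1r ?mul0r.
rewrite -big_seq (sum_history (fun e => (nth false r e)%:R * F e) (valS r)).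
by apply: eq_bigr => e _; rewrite /probed; ring.
Qed.

Lemma strat_valueE : strat_value I S = \sum_(e < nE I) w_ I e * p_ I e * marg e.
Proof.
rewrite /strat_value -/(Er I (fun r => hvalue I (strat_hist I S r))).
rewrite (@eq_Er _ _ (fun r => \sum_(e < nE I) w_ I e * ((nth false r e)%:R * probed r e))); last first.
  by move=> r; apply: sum_outcome.
rewrite (Er_sum I (nE I) (fun e r => w_ I e * ((nth false r e)%:R * probed r e))).
by apply: eq_bigr => e _; rewrite ErZ Er_probed // mulrA.
Qed.

Lemma marg_bounds e : 0 <= marg e <= 1.
Proof.
apply/andP; split.
  by apply: sumr_ge0 => r _; rewrite mulr_ge0 ?real_prob_ge0 ?ler0n.
by rewrite -(Er1 I); apply: le_Er => // r; rewrite /probed lern1 leq_b1.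
Qed.

Lemma marg_matching v : \sum_(e < nE I | incident I v e) p_ I e * marg e <= 1.
Proof.
rewrite big_mkcond /= (eq_bigr (fun e : 'I_(nE I) =>
  Er I (fun r => (incident I v e)%:R * ((nth false r e)%:R * probed r e)))); last first.
  by move=> e _; rewrite ErZ Er_probed //; case: ifP => _; rewrite ?mul1r ?mul0r.
rewrite -(Er_sum I (nE I) (fun e r => (incident I v e)%:R * ((nth false r e)%:R * probed r e))) -[leRHS](Er1 I).
apply: le_Er => // r.
rewrite -(sum_outcome r (fun e => (incident I v e)%:R)).
have := legal_matched v (valS r).
rewrite -(@ler_nat rat); apply: le_trans.
rewrite -sum1_count big_mkcond [in leRHS]big_mkcond natr_sum; apply: ler_sum => x _.
by case: x.2 => //=; case: ifP.
Qed.

Lemma marg_timeout v : \sum_(e < nE I | incident I v e) marg e <= (t_ I v)%:R.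
Proof.
rewrite big_mkcond /= (eq_bigr (fun e : 'I_(nE I) =>
  Er I (fun r => (incident I v e)%:R * probed r e))); last first.
  by move=> e _; rewrite ErZ; case: ifP => _; rewrite ?mul1r ?mul0r.
rewrite -(Er_sum I (nE I) (fun e r => (incident I v e)%:R * probed r e)).
rewrite [leRHS](_ : _ = Er I (fun=> (t_ I v)%:R * 1)); last by rewrite ErZ Er1 mulr1.
apply: le_Er => // r; rewrite mulr1.
have := legal_nprobed v (valS r); rewrite -(@ler_nat rat); apply: le_trans.
rewrite (eq_bigr (fun e : 'I_(nE I) => (nat_of_ord e \in map fst (strat_hist I S r))%:R * (incident I v e)%:R)); last first.
  by move=> e _; rewrite mulrC.
rewrite -(sum_history (fun e => (incident I v e)%:R) (valS r)).
rewrite /nprobed -sum1_count [in leRHS]big_mkcond natr_sum; apply: ler_sum => x _.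
by case: ifP.
Qed.

End Marginals.
End Marginals.
Export Marginals.

Module Subgradient.
Local Open Scope ring_scope.

(** * The dual subgradient method *)

Section Subgradient.
Variables (n m kK kKK : nat) (U V T P C : nat -> nat).
Hypothesis m0 : (0 < m)%N.
Hypothesis K0 : (0 < kK)%N.
Hypothesis KKE : kKK = (kK * kK)%N.
Hypothesis Un : forall e, (e < m)%N -> (U e < n)%N.
Hypothesis Vn : forall e, (e < m)%N -> (V e < n)%N.
Hypothesis UV : forall e, (e < m)%N -> U e != V e.
Hypothesis PK : forall e, (e < m)%N -> (P e <= kK)%N.

Local Notation step := (lpstep m kK kKK U V T P C).
Local Notation X := (lpX kKK U V P C).
Local Notation inc := (incb U V).
Local Notation st0 := ((fun=> 0%N, fun=> 0%N, fun=> 0%N) : lpst).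

(** The potential of the method: with the weight [kKK = kK ^ 2], the quadratic error of one
    iteration is at most [(m kK) ^ 2] for either kind of multiplier. *)
Definition Psi (st : lpst) : rat :=
  \sum_(v < n) ((st.1.1 v)%:R ^+ 2 + kKK%:R * (st.1.2 v)%:R ^+ 2).

Lemma sum_inc (f : nat -> rat) e : (e < m)%N ->
  \sum_(v < n) (inc v e)%:R * f v = f (U e) + f (V e).
Proof.
move=> He; have neq := UV He.
rewrite (bigD1 (Ordinal (Un He))) //= (bigD1 (Ordinal (Vn He))) /=; last by rewrite -val_eqE /= eq_sym.
rewrite /incb !eqxx orbT !mul1r addrA big1 ?addr0 // => v /andP[H1 H2].
by rewrite -!val_eqE /= in H1 H2; rewrite eq_sym (negbTE H1) eq_sym (negbTE H2) mul0r.
Qed.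

Lemma exchange_inc (f g : nat -> rat) :
  \sum_(v < n) f v * (\sum_(e < m) (inc v e)%:R * g e) = \sum_(e < m) g e * (f (U e) + f (V e)).
Proof.
under eq_bigr => v _ do rewrite mulr_sumr.
rewrite exchange_big /=; apply: eq_bigr => e _.
rewrite -(sum_inc f (ltn_ord e)) mulr_sumr; apply: eq_bigr => v _; ring.
Qed.

(** Timeouts may be exponentially large and would spoil the step size. But one of at least [m] never
    binds, and its multiplier stays 0. *)
Definition Zok (st : lpst) : Prop := forall v, (m <= T v)%N -> st.1.2 v = 0%N.

Lemma sumX_le st v : (\sum_(e < m) (X st e && inc v e) <= m)%N.
Proof.
rewrite -[leqRHS]muln1 -[in leqRHS](card_ord m) -sum_nat_const.
by apply: leq_sum => e _; apply: leq_b1.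
Qed.

Lemma sumPX_le st v : (\sum_(e < m) (X st e && inc v e) * P e <= m * kK)%N.
Proof.
rewrite -[in leqRHS](card_ord m) -sum_nat_const.
by apply: leq_sum => e _; case: (_ && _); rewrite ?mul1n ?mul0n // PK.
Qed.

Lemma Zok_step st : Zok st -> Zok (step st).
Proof.
move=> H v Hv; rewrite /lpstep /= /lpZ1 H // add0n.
by apply/eqP; rewrite subn_eq0; apply: leq_trans Hv; apply: sumX_le.
Qed.

(** Expanding the square leaves [(l - k) ^ 2 <= b ^ 2], and truncation at 0 can only decrease it. *)
Lemma trunc_sq (a l k b : nat) : (l <= b)%N -> (k <= b)%N ->
  ((a + l - k)%N%:R : rat) ^+ 2 <= a%:R ^+ 2 + 2%:R * a%:R * (l%:R - k%:R) + b%:R ^+ 2.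
Proof.
move=> Hl Hk.
have la : (l%:R : rat) <= b%:R by rewrite ler_nat.
have ka : (k%:R : rat) <= b%:R by rewrite ler_nat.
have l0 : (0 : rat) <= l%:R by rewrite ler0n.
have k0 : (0 : rat) <= k%:R by rewrite ler0n.
have a0 : (0 : rat) <= a%:R by rewrite ler0n.
case: (leqP k (a + l)) => H; first by rewrite natrB // natrD; nra.
have -> : (a + l - k = 0)%N by lia.
have : (a%:R + l%:R : rat) <= k%:R by rewrite -natrD ler_nat ltnW.
rewrite expr0n /=; nra.
Qed.

Definition feas (x : nat -> rat) : Prop :=
  [/\ forall e, (e < m)%N -> 0 <= x e <= 1,
      forall v, (v < n)%N -> \sum_(e < m) (inc v e)%:R * ((P e)%:R * x e) <= kK%:R &
      forall v, (v < n)%N -> \sum_(e < m) (inc v e)%:R * x e <= (T v)%:R].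

Definition gap : rat := 2%:R * n%:R * (m%:R * kK%:R) ^+ 2.

(** The cross terms are multipliers times (load minus capacity). Feasibility of [x] bounds its
    priced load by the priced capacity, and edge by edge the selection satisfies
    [(X - x) price <= (X - x) C]. *)
Lemma Psi_step st x : Zok st -> feas x ->
  Psi (step st) <= Psi st + 2%:R * (\sum_(e < m) (C e)%:R * ((X st e)%:R - x e)) + gap.
Proof.
move=> HZ [x01 xP xT].
pose y v : rat := (st.1.1 v)%:R; pose z v : rat := (st.1.2 v)%:R.
pose Xr e : rat := (X st e)%:R.
have LY v : ((\sum_(e < m) (X st e && inc v e) * P e)%N%:R : rat) =
    \sum_(e < m) (inc v e)%:R * ((P e)%:R * Xr e).
  by rewrite natr_sum; apply: eq_bigr => e _; rewrite /Xr natrM; case: (X st e); case: (inc v e) => /=; ring.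
have LZ v : ((\sum_(e < m) (X st e && inc v e))%N%:R : rat) = \sum_(e < m) (inc v e)%:R * Xr e.
  by rewrite natr_sum; apply: eq_bigr => e _; rewrite /Xr; case: (X st e); case: (inc v e) => /=; ring.
have KK0 : (0 : rat) <= kKK%:R by rewrite ler0n.
have S1 : Psi (step st) <= \sum_(v < n) (y v ^+ 2 + kKK%:R * z v ^+ 2 +
    2%:R * (y v * (\sum_(e < m) (inc v e)%:R * ((P e)%:R * Xr e) - kK%:R) +
            kKK%:R * (z v * (\sum_(e < m) (inc v e)%:R * Xr e - (T v)%:R))) +
    2%:R * (m%:R * kK%:R) ^+ 2).
  apply: ler_sum => v _; rewrite /= /lpY1 /lpZ1 -LY -LZ /y /z.
  have A1 := @trunc_sq (st.1.1 v) _ kK _ (sumPX_le st v) (leq_pmull kK m0).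
  have A2 : ((st.1.2 v + \sum_(e < m) (X st e && inc v e) - T v)%N%:R : rat) ^+ 2 <=
     (st.1.2 v)%:R ^+ 2 + 2%:R * (st.1.2 v)%:R *
       ((\sum_(e < m) (X st e && inc v e))%N%:R - (T v)%:R) + m%:R ^+ 2.
    (* If [T v > m], the old multiplier is 0 by [Zok], and so is the new one, as at most [m] edges
       are selected. *)
    case: (leqP (T v) m) => Ht; first exact: trunc_sq (sumX_le st v) Ht.
    have := sumX_le st v; rewrite HZ ?(ltnW Ht) // add0n => H.
    rewrite (_ : (_ - T v = 0)%N) ?expr0n /= ?mulr0 ?mul0r ?add0r ?sqr_ge0 //.
    by apply/eqP; rewrite subn_eq0 (leq_trans H) // ltnW.
  have A3 := ler_wpM2l KK0 A2.
  rewrite natrM in A1.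
  apply: (le_trans (lerD A1 A3)); rewrite KKE natrM.
  rewrite le_eqVlt; apply/orP; left; apply/eqP; ring.
apply: (le_trans S1).
rewrite !big_split /= sumr_const card_ord -/(Psi st) /gap.
have -> : 2%:R * (m%:R * kK%:R) ^+ 2 *+ n = 2%:R * n%:R * (m%:R * kK%:R) ^+ 2 :> rat.
  by rewrite -mulr_natl; ring.
rewrite lerD2r -big_split /= -/(Psi st) lerD2l -mulr_sumr ler_pM2l //.
pose pr e : rat := (P e)%:R * (y (U e) + y (V e)) + kKK%:R * (z (U e) + z (V e)).
have E (w : nat -> rat) : \sum_(v < n) (y v * (\sum_(e < m) (inc v e)%:R * ((P e)%:R * w e)) +
    kKK%:R * (z v * (\sum_(e < m) (inc v e)%:R * w e))) = \sum_(e < m) w e * pr e.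
  rewrite big_split /= -mulr_sumr (exchange_inc y (fun e => (P e)%:R * w e)) (exchange_inc z w).
  by rewrite mulr_sumr -big_split /=; apply: eq_bigr => e _; rewrite /pr; ring.
have -> : \sum_(v < n) (y v * (\sum_(e < m) (inc v e)%:R * ((P e)%:R * Xr e) - kK%:R) +
            kKK%:R * (z v * (\sum_(e < m) (inc v e)%:R * Xr e - (T v)%:R))) =
   \sum_(e < m) Xr e * pr e - \sum_(v < n) (y v * kK%:R + kKK%:R * (z v * (T v)%:R)).
  by rewrite -E -sumrB; apply: eq_bigr => v _; ring.
have xle : \sum_(e < m) x e * pr e <= \sum_(v < n) (y v * kK%:R + kKK%:R * (z v * (T v)%:R)).
  rewrite -E; apply: ler_sum => v _; apply: lerD.
    by apply: ler_wpM2l; rewrite ?ler0n //; apply: xP.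
  by apply: ler_wpM2l => //; apply: ler_wpM2l; rewrite ?ler0n //; apply: xT.
have Xle : \sum_(e < m) (Xr e - x e) * pr e <= \sum_(e < m) (C e)%:R * (Xr e - x e).
  apply: ler_sum => e _; have /andP[xe0 xe1] := x01 e (ltn_ord e).
  have Epr : pr e = ((st.1.1 (U e) + st.1.1 (V e)) * P e + (st.1.2 (U e) + st.1.2 (V e)) * kKK)%N%:R.
    by rewrite natrD !natrM !natrD /pr /y /z; ring.
  rewrite mulrC /Xr Epr /lpX; case: ltnP => Hc /=.
    by apply: ler_wpM2r; rewrite ?subr_ge0 // ler_nat ltnW.
  by rewrite !sub0r !mulrN lerN2; apply: ler_wpM2r; rewrite ?ler_nat.
have := Xle; rewrite (eq_bigr (fun e : 'I_m => Xr e * pr e - x e * pr e)); last by move=> e _; rewrite mulrBl.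
rewrite sumrB; lra.
Qed.

(** Used twice: [x = 0] bounds the multipliers, hence the violation of the constraints; an arbitrary
    feasible [x], together with [Psi >= 0], bounds the loss in value. *)
Lemma Psi_iter k x : feas x ->
  Psi (iter k step st0) <=
  2%:R * (\sum_(e < m) (C e)%:R * (((iter k step st0).2 e)%:R - k%:R * x e)) + k%:R * gap
  /\ Zok (iter k step st0).
Proof.
move=> Hx; elim: k => [|k [IH1 IH2]].
  split=> //; rewrite mul0r addr0 /Psi !big1 ?mulr0 // => i _ /=; first by rewrite mul0r subrr mulr0.
  by rewrite expr0n /= mulr0 addr0.
rewrite iterS; split; last exact: Zok_step.
apply: (le_trans (Psi_step IH2 Hx)); set st := iter k step st0 in IH1 IH2 *.
have -> : \sum_(e < m) (C e)%:R * (((step st).2 e)%:R - k.+1%:R * x e) =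
  \sum_(e < m) (C e)%:R * ((st.2 e)%:R - k%:R * x e) + \sum_(e < m) (C e)%:R * ((X st e)%:R - x e).
  by rewrite -big_split /=; apply: eq_bigr => e _; rewrite natrD -natr1; ring.
rewrite -natr1; lra.
Qed.

(** A multiplier accumulates load minus capacity, and truncation only raises it; so it dominates the
    total excess. *)
Lemma load_iter k v :
  (\sum_(e < m) inc v e * (P e * (iter k step st0).2 e) <= k * kK + (iter k step st0).1.1 v)%N /\
  (\sum_(e < m) inc v e * (iter k step st0).2 e <= k * T v + (iter k step st0).1.2 v)%N.
Proof.
elim: k => [|k [IH1 IH2]].
  by rewrite !big1 // => e _; rewrite /= ?muln0.
rewrite iterS; set st := iter k step st0 in IH1 IH2 *; rewrite /= /lpY1 /lpZ1.
have -> : (\sum_(e < m) inc v e * (P e * (st.2 e + X st e)))%N =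
   (\sum_(e < m) inc v e * (P e * st.2 e) + \sum_(e < m) (X st e && inc v e) * P e)%N.
  by rewrite -big_split /=; apply: eq_bigr => e _; case: (X st e); case: (inc v e) => /=; lia.
have -> : (\sum_(e < m) inc v e * (st.2 e + X st e))%N =
   (\sum_(e < m) inc v e * st.2 e + \sum_(e < m) (X st e && inc v e))%N.
  by rewrite -big_split /=; apply: eq_bigr => e _; case: (X st e); case: (inc v e) => /=; lia.
rewrite !mulSn; lia.
Qed.

Lemma cnt_iter k e : ((iter k step st0).2 e <= k)%N.
Proof. by elim: k => // k IH; rewrite iterS /=; case: (X _ e) => /=; lia. Qed.

End Subgradient.
End Subgradient.
Export Subgradient.

(** * Accuracy of the computed LP solution *)

Module Quality.
Local Open Scope ring_scope.

Section Quality.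
Variables (n m M h kK kKK kHK kR A B : nat) (U V PN PD WN WD T P C : nat -> nat).
Hypothesis m0 : (0 < m)%N.
Hypothesis hgt2 : (2 < h)%N.
Hypothesis KE : kK = (h * M)%N.
Hypothesis KKE : kKK = (kK * kK)%N.
Hypothesis HKE : kHK = (h * M ^ 3 * kK)%N.
Hypothesis RE : kR%:R = 8%:R * h%:R ^+ 3 * M%:R ^+ 4 :> rat.
Hypothesis HM : (n + m < M)%N.
Hypothesis Un : forall e, (e < m)%N -> (U e < n)%N.
Hypothesis Vn : forall e, (e < m)%N -> (V e < n)%N.
Hypothesis UV : forall e, (e < m)%N -> U e != V e.
Hypothesis PNPD : forall e, (e < m)%N -> (0 < PN e <= PD e)%N.
Hypothesis WD0 : forall e, (e < m)%N -> (0 < WD e)%N.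
Hypothesis T0 : forall v, (v < n)%N -> (0 < T v)%N.
Hypothesis HAB : maxfrac PN PD WN WD A B m.
Hypothesis HC : forall e, (e < m)%N -> goodC kK kHK PN PD WN WD A B e (C e).
Hypothesis HP : forall e, (e < m)%N -> goodP kK PN PD e (P e).

Local Notation st := (iter kR (lpstep m kK kKK U V T P C) ((fun=> 0%N, fun=> 0%N, fun=> 0%N) : lpst)).
Local Notation cnt := (st.2).
Local Notation inc := (incb U V).
Definition pr (e : nat) : rat := (PN e)%:R / (PD e)%:R.
Definition vr (e : nat) : rat := pr e * ((WN e)%:R / (WD e)%:R).

Let M0 : (0 < M)%N. Proof. by move: HM; lia. Qed.
Let K0 : (0 < kK)%N. Proof. by rewrite KE muln_gt0 M0 andbT; move: hgt2; lia. Qed.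
Let hr : (2 : rat) < h%:R. Proof. by rewrite ltr_nat. Qed.
Let h0 : (0 : rat) < h%:R. Proof. by move: hr; lra. Qed.
Let Mr : (0 : rat) < M%:R. Proof. by rewrite ltr0n. Qed.
Let Kr : (0 : rat) < kK%:R. Proof. by rewrite ltr0n. Qed.
Let KrE : (kK%:R : rat) = h%:R * M%:R. Proof. by rewrite KE natrM. Qed.
Let Rr : (0 : rat) < kR%:R. Proof. by rewrite RE; apply: mulr_gt0; [apply: mulr_gt0; [|apply: exprn_gt0]|apply: exprn_gt0]. Qed.
Let PDr e : (e < m)%N -> (0 : rat) < (PD e)%:R.
Proof. by move=> /PNPD /andP[a b]; rewrite ltr0n (leq_trans a). Qed.
Let WDr e : (e < m)%N -> (0 : rat) < (WD e)%:R. Proof. by move=> /WD0; rewrite ltr0n. Qed.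

Lemma P_bounds e : (e < m)%N -> (P e)%:R <= kK%:R * pr e <= (P e)%:R + 1.
Proof.
move=> He; have d0 := PDr He; have /andP[H1 H2] := HP He.
rewrite /pr mulrA ler_pdivlMr // ler_pdivrMr // natr1 -!natrM !ler_nat mulnC [(kK * _)%N]mulnC.
by rewrite ltnW //= mulnC.
Qed.

Let PK e : (e < m)%N -> (P e <= kK)%N.
Proof.
move=> He; have /andP[H1 _] := HP He; have /andP[a b] := PNPD He.
rewrite -(leq_pmul2r (leq_trans a b)); apply: (leq_trans (ltnW H1)).
by rewrite mulnC leq_mul2l b orbT.
Qed.

Definition cm : rat := A%:R / B%:R.

Let B0 : (0 : rat) < B%:R. Proof. by rewrite ltr0n; case: HAB. Qed.

Lemma vr_le e : (e < m)%N -> vr e <= cm.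
Proof.
move=> He; have d0 := PDr He; have w0 := WDr He; case: HAB => _ /(_ _ He) H _.
rewrite /vr /cm /pr mulf_div ler_pdivrMr ?mulr_gt0 // mulrAC ler_pdivlMr //.
by rewrite -!natrM ler_nat.
Qed.

Lemma C_bounds e : (e < m)%N -> exists2 ct : nat, (C e)%:R = ct%:R * kHK%:R :> rat &
  [/\ ct%:R <= kK%:R :> rat, vr e * kK%:R <= ct%:R * cm & ct%:R * cm <= vr e * kK%:R + cm].
Proof.
move=> He; have d0 := PDr He; have w0 := WDr He; have [q [Cq C1 C2]] := HC He.
have D0 : (0 : rat) < B%:R * ((PD e)%:R * (WD e)%:R) by rewrite !mulr_gt0.
have E1 : vr e * kK%:R = (B * PN e * WN e * kK)%N%:R / (B%:R * ((PD e)%:R * (WD e)%:R)).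
  rewrite /vr /pr !natrM; field.
  by rewrite !lt0r_neq0.
have E2 (x : nat) : x%:R * cm = (x * (A * PD e * WD e))%N%:R / (B%:R * ((PD e)%:R * (WD e)%:R)).
  rewrite /cm !natrM; field.
  by rewrite !lt0r_neq0.
have cm0 : 0 <= cm by rewrite /cm divr_ge0 ?ler0n.
exists q; first by rewrite Cq natrM.
split.
- rewrite ler_nat; case: (posnP q) => [->//|q0].
  have := C2 q0; case: HAB => _ /(_ _ He) H _.
  have H' : (B * PN e * WN e * kK <= kK * (A * PD e * WD e))%N.
    by rewrite mulnC leq_mul2l; apply/orP; right; move: H; rewrite (mulnC _ B) !mulnA.
  move=> H2; have := leq_trans H2 H'; rewrite ltn_mul2r => /andP[_]; lia.
- by rewrite E1 E2 ler_pM2r ?invr_gt0 // ler_nat.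
- case: (posnP q) => [->|q0].
    by rewrite mul0r addr_ge0 // mulr_ge0 ?ler0n // /vr /pr !mulr_ge0 ?invr_ge0 ?ler0n.
  rewrite -{1}(prednK q0) -natr1 mulrDl mul1r lerD2r E1 E2 ler_pM2r ?invr_gt0 // ler_nat.
  exact: ltnW (C2 q0).
Qed.

Lemma cnt_le e : (cnt e)%:R <= kR%:R :> rat.
Proof. by rewrite ler_nat; apply: cnt_iter. Qed.

Let feas0 : feas n m kK U V T P (fun=> 0).
Proof. by split=> [e _|v _|v _]; rewrite ?lexx ?ler01 // big1 ?ler0n // => e _; rewrite !mulr0. Qed.

Let mM : (m%:R : rat) <= M%:R. Proof. by rewrite ler_nat; lia. Qed.
Let nM : (n%:R : rat) <= M%:R. Proof. by rewrite ler_nat; lia. Qed.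
Let M1 : (1 : rat) <= M%:R. Proof. by rewrite ler1n. Qed.
Let HKrE : (kHK%:R : rat) = h%:R * M%:R ^+ 3 * kK%:R.
Proof. by rewrite HKE natrM natrM natrX. Qed.

Let nmm : (n%:R * m%:R ^+ 2 : rat) <= M%:R ^+ 3.
Proof.
rewrite [leRHS]exprS; apply: ler_pM; rewrite ?ler0n ?exprn_ge0 ?ler0n //.
by rewrite lerXn2r ?nnegrE ?ler0n.
Qed.

(** With [x = 0] the total drift is at most [4 h M^4 R K^2], and [R = 8 h^3 M^4] turns
    [(R K / h) ^ 2] into [8 h M^4 R K^2]. *)
Lemma Psi_final : Psi n kKK st <= (kR%:R * kK%:R / h%:R) ^+ 2.
Proof.
have [H _] := Psi_iter C m0 K0 KKE Un Vn UV PK kR feas0.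
apply: (le_trans H).
have S1 : \sum_(e < m) (C e)%:R * ((cnt e)%:R - kR%:R * 0) <= m%:R * (kK%:R * kHK%:R * kR%:R) :> rat.
  rewrite (_ : m%:R * _ = \sum_(e < m) (kK%:R * kHK%:R * kR%:R)); last first.
    by rewrite sumr_const card_ord mulr_natl.
  apply: ler_sum => e _; rewrite mulr0 subr0; apply: ler_pM; rewrite ?ler0n ?cnt_le //.
  by have [ct -> [H1 _ _]] := C_bounds (ltn_ord e); rewrite ler_wpM2r ?ler0n.
have S2 : 2%:R * (m%:R * (kK%:R * kHK%:R * kR%:R)) + kR%:R * gap n m kK <=
  kR%:R * kK%:R ^+ 2 * (4%:R * h%:R * M%:R ^+ 4) :> rat.
  rewrite /gap HKrE.
  have -> : 2%:R * (m%:R * (kK%:R * (h%:R * M%:R ^+ 3 * kK%:R) * kR%:R)) +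
     kR%:R * (2%:R * n%:R * (m%:R * kK%:R) ^+ 2) =
     kR%:R * kK%:R ^+ 2 * (2%:R * (h%:R * (m%:R * M%:R ^+ 3)) + 2%:R * (n%:R * m%:R ^+ 2)) :> rat by ring.
  apply: ler_wpM2l; first by rewrite mulr_ge0 ?ler0n ?exprn_ge0.
  have H1 : m%:R * M%:R ^+ 3 <= M%:R ^+ 4 :> rat by rewrite [leRHS]exprS ler_wpM2r ?exprn_ge0 ?ler0n.
  have H2 : M%:R ^+ 3 <= M%:R ^+ 4 :> rat by rewrite ler_weXn2l.
  have W0 : 0 <= (M%:R : rat) ^+ 4 by rewrite exprn_ge0 ?ler0n.
  have H3 := ler_wpM2l (ltW h0) H1; have H4 : M%:R ^+ 4 <= h%:R * M%:R ^+ 4 :> rat.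
    by rewrite -[leLHS]mul1r ler_wpM2r //; move: hr; lra.
  move: (nmm) H2 H3 H4; lra.
apply: (@le_trans _ _ (kR%:R * kK%:R ^+ 2 * (4%:R * h%:R * M%:R ^+ 4))); first lra.
have hn : (h%:R : rat) != 0 by rewrite lt0r_neq0.
rewrite [leRHS](_ : _ = kR%:R * kK%:R ^+ 2 * (kR%:R / (h%:R * h%:R))); last by field.
apply: ler_wpM2l; first by rewrite mulr_ge0 ?ler0n ?exprn_ge0.
rewrite ler_pdivlMr; last by rewrite mulr_gt0.
have W0 : 0 <= (M%:R : rat) ^+ 4 * h%:R ^+ 3 by rewrite mulr_ge0 ?exprn_ge0 ?ler0n.
rewrite RE; have -> : 4%:R * h%:R * M%:R ^+ 4 * (h%:R * h%:R) = 4%:R * (M%:R ^+ 4 * h%:R ^+ 3) :> rat by ring.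
have -> : 8%:R * h%:R ^+ 3 * M%:R ^+ 4 = 8%:R * (M%:R ^+ 4 * h%:R ^+ 3) :> rat by ring.
lra.
Qed.

Lemma Psi_coord v : (v < n)%N ->
  (st.1.1 v)%:R <= kR%:R * kK%:R / h%:R :> rat /\ (st.1.2 v)%:R <= kR%:R / h%:R :> rat.
Proof.
move=> Hv; have H := Psi_final.
have S0 : 0 <= \sum_(i < n | i != Ordinal Hv) ((st.1.1 i)%:R ^+ 2 + kKK%:R * (st.1.2 i)%:R ^+ 2 : rat).
  by apply: sumr_ge0 => i _; rewrite addr_ge0 ?mulr_ge0 ?sqr_ge0 ?ler0n.
move: H; rewrite /Psi (bigD1 (Ordinal Hv)) //=; set Y := (st.1.1 v)%:R; set Z := (st.1.2 v)%:R => H.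
have Y0 : 0 <= Y :> rat by rewrite ler0n.
have Z0 : 0 <= Z :> rat by rewrite ler0n.
have R5 : 0 <= kR%:R * kK%:R / h%:R :> rat by rewrite !mulr_ge0 ?invr_ge0 ?ler0n.
have Y2 : 0 <= Y ^+ 2 by rewrite sqr_ge0.
have Z2 : 0 <= kKK%:R * Z ^+ 2 by rewrite mulr_ge0 ?ler0n ?sqr_ge0.
split.
  by rewrite -(@ler_pXn2r _ 2) ?nnegrE //; lra.
rewrite -(ler_pM2l Kr) -(@ler_pXn2r _ 2) ?nnegrE ?mulr_ge0 ?invr_ge0 ?ler0n //.
rewrite [(kK%:R * Z) ^+ 2](_ : _ = kKK%:R * Z ^+ 2); last by rewrite KKE natrM; ring.
rewrite (_ : kK%:R * (kR%:R / h%:R) = kR%:R * kK%:R / h%:R); last by ring.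
lra.
Qed.

(** Two errors of [1/h] each: rounding the probabilities costs [m R <= M R = K R / h], and the final
    multiplier is at most [R K / h]. *)
Lemma load_matching v : (v < n)%N ->
  \sum_(e < m) (inc v e)%:R * (pr e * (cnt e)%:R) <= kR%:R * (1 + 2%:R / h%:R) :> rat.
Proof.
move=> Hv; have [HY _] := Psi_coord Hv.
have [L1 _] := load_iter U V T P C m0 K0 KKE kR v.
move: L1; rewrite -(@ler_nat rat) natr_sum natrD natrM => L1.
have S1 : kK%:R * \sum_(e < m) (inc v e)%:R * (pr e * (cnt e)%:R) <=
   \sum_(e < m) (inc v e * (P e * cnt e))%N%:R + m%:R * kR%:R :> rat.
  rewrite (_ : m%:R * kR%:R = \sum_(e < m) kR%:R); last by rewrite sumr_const card_ord mulr_natl.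
  rewrite mulr_sumr -big_split /=; apply: ler_sum => e _.
  have /andP[_ Hp] := P_bounds (ltn_ord e); have c0 : (0 : rat) <= (cnt e)%:R by rewrite ler0n.
  have c1 := cnt_le e; rewrite !natrM; case: (inc v e) => /=; last by rewrite !mul0r mulr0 add0r ler0n.
  rewrite !mul1r mulrA; apply: (@le_trans _ _ (((P e)%:R + 1) * (cnt e)%:R)).
    by rewrite ler_wpM2r.
  by rewrite mulrDl mul1r lerD2l.
rewrite -(ler_pM2l Kr); apply: (le_trans S1).
have : m%:R * kR%:R <= M%:R * kR%:R :> rat by rewrite ler_wpM2r ?ler0n.
have -> : M%:R = kK%:R / h%:R :> rat by rewrite KrE; field; rewrite lt0r_neq0.
move: L1 HY; set x := \sum_(e < m) _; set y := (st.1.1 v)%:R; set K := kK%:R; set R := kR%:R.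
have -> : R * K / h%:R = R * K * h%:R^-1 by []. 
by move=> u1 u2 u3; lra.
Qed.

Lemma load_timeout v : (v < n)%N ->
  \sum_(e < m) (inc v e)%:R * (cnt e)%:R <= kR%:R * (1 + 2%:R / h%:R) * (T v)%:R :> rat.
Proof.
move=> Hv; have [_ HZ] := Psi_coord Hv.
have [_ L1] := load_iter U V T P C m0 K0 KKE kR v.
move: L1; rewrite -(@ler_nat rat) natr_sum natrD natrM => L1.
have t1 : (1 : rat) <= (T v)%:R by rewrite ler1n T0.
apply: (@le_trans _ _ (kR%:R * (T v)%:R + (st.1.2 v)%:R)).
  apply: le_trans L1; apply: ler_sum => e _; by rewrite natrM.
have : kR%:R * 1 <= kR%:R * (T v)%:R :> rat by rewrite ler_wpM2l ?ler0n.
move: HZ; set z := (st.1.2 v)%:R; set R := kR%:R; set t := (T v)%:R => u1 u2.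
have hi : 0 <= (h%:R : rat)^-1 by rewrite invr_ge0 ler0n.
have u3 := ler_wpM2r hi u2; have u4 : 0 <= R * (h%:R)^-1 by rewrite mulr_ge0 ?ler0n.
 have -> : R * (1 + 2%:R / h%:R) * t = R * t + 2%:R * (R * t * (h%:R)^-1) by ring.
 move: u1 u3 u4; rewrite mulr1; lra.
Qed.

Definition feasI (x : nat -> rat) : Prop :=
  [/\ forall e, (e < m)%N -> 0 <= x e <= 1,
      forall v, (v < n)%N -> \sum_(e < m) (inc v e)%:R * (pr e * x e) <= 1 &
      forall v, (v < n)%N -> \sum_(e < m) (inc v e)%:R * x e <= (T v)%:R].

(** Again two errors of [cm / h]: the weights are rounded up by at most one unit [cm / K] on each of
    [m <= M = K / h] edges, and [kHK] is so large that [gap <= 2 kHK M]. *)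
Lemma value_gap x : feasI x ->
  kR%:R * \sum_(e < m) vr e * x e <= \sum_(e < m) vr e * (cnt e)%:R + kR%:R * cm * (2%:R / h%:R).
Proof.
move=> [x01 xP xT].
have Hf : feas n m kK U V T P x.
  split=> // v Hv; rewrite -[leRHS]mulr1; apply: le_trans (ler_wpM2l (ltW Kr) (xP v Hv)).
  rewrite mulr_sumr; apply: ler_sum => e _; have /andP[Hp _] := P_bounds (ltn_ord e).
  have /andP[xe0 _] := x01 e (ltn_ord e).
  rewrite [leRHS]mulrCA; apply: ler_wpM2l; rewrite ?ler0n // mulrA; exact: ler_wpM2r.
have [H _] := Psi_iter C m0 K0 KKE Un Vn UV PK kR Hf.
have P0 : 0 <= Psi n kKK st.
  by apply: sumr_ge0 => v _; rewrite addr_ge0 ?mulr_ge0 ?sqr_ge0 ?ler0n.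
have cm0 : 0 <= cm by rewrite /cm divr_ge0 ?ler0n.
have HK0 : (0 : rat) < kHK%:R by rewrite HKrE !mulr_gt0 ?exprn_gt0.
have S1 : cm * (\sum_(e < m) (C e)%:R * ((cnt e)%:R - kR%:R * x e)) <=
  kHK%:R * (kK%:R * (\sum_(e < m) vr e * (cnt e)%:R - kR%:R * \sum_(e < m) vr e * x e) + m%:R * (cm * kR%:R)).
  rewrite (_ : m%:R * (cm * kR%:R) = \sum_(e < m) cm * kR%:R); last by rewrite sumr_const card_ord mulr_natl.
  rewrite !mulr_sumr -sumrB mulr_sumr -big_split /= mulr_sumr; apply: ler_sum => e _.
  have [ct -> [_ c1 c2]] := C_bounds (ltn_ord e).
  have -> : cm * (ct%:R * kHK%:R * ((cnt e)%:R - kR%:R * x e)) =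
    kHK%:R * (ct%:R * cm * (cnt e)%:R - ct%:R * cm * (kR%:R * x e)) by ring.
  rewrite ler_pM2l //.
  have /andP[xe0 _] := x01 e (ltn_ord e).
  have c0 : (0 : rat) <= (cnt e)%:R by rewrite ler0n.
  have h1 := ler_wpM2r c0 c2.
  have h2 : vr e * kK%:R * (kR%:R * x e) <= ct%:R * cm * (kR%:R * x e).
    by rewrite ler_wpM2r // mulr_ge0 ?ler0n.
  have h3 : cm * (cnt e)%:R <= cm * kR%:R by rewrite ler_wpM2l ?cnt_le.
  move: h1 h2 h3; rewrite mulrDl; lra.
have G : gap n m kK <= 2%:R * kHK%:R * M%:R.
  rewrite /gap HKrE exprMn; have := ler_wpM2l (ltW (mulr_gt0 Kr Kr)) nmm.
  have -> : 2%:R * (h%:R * M%:R ^+ 3 * kK%:R) * M%:R = 2%:R * (kK%:R * kK%:R * M%:R ^+ 3) :> rat.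
    by rewrite {2}KrE; ring.
  have -> : 2%:R * n%:R * (m%:R ^+ 2 * kK%:R ^+ 2) = 2%:R * (kK%:R * kK%:R * (n%:R * m%:R ^+ 2)) :> rat by ring.
  by move: (_ * _) (_ * M%:R ^+ 3) => y1 y2; lra.
set S := \sum_(e < m) (C e)%:R * _ in H S1.
have H1 : - (kR%:R * kHK%:R * M%:R) <= S.
  have := ler_wpM2l (ltW Rr) G; move: H P0; set g := kR%:R * gap _ _ _; set y := Psi _ _ _.
  by set q := kR%:R * (_ * _ * _) => h1 h2 h3; have -> : kR%:R * kHK%:R * M%:R = q / 2%:R; [rewrite /q; field|lra].
have H2 := ler_wpM2l cm0 H1; have {H2 S1} H3 := le_trans H2 S1.
set b := \sum_(e < m) _ in H3 *; set a := \sum_(e < m) _ in H3 *.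
have {}H3 : - (cm * kR%:R * M%:R) <= kK%:R * (b - kR%:R * a) + m%:R * (cm * kR%:R).
  rewrite -(ler_pM2l HK0); apply: le_trans H3.
  by rewrite le_eqVlt; apply/orP; left; apply/eqP; ring.
have mm : m%:R * (cm * kR%:R) <= M%:R * (cm * kR%:R) by rewrite ler_wpM2r // mulr_ge0 ?ler0n.
rewrite -(ler_pM2l Kr) mulrDr.
have -> : kK%:R * (kR%:R * cm * (2%:R / h%:R)) = 2%:R * (M%:R * (cm * kR%:R)) by rewrite KrE; field; rewrite lt0r_neq0.
move: H3 mm; rewrite mulrBr [cm * kR%:R * M%:R]mulrC.
by set q1 := M%:R * _; set q2 := m%:R * _; lra.
Qed.

(** The additive error is a fraction of [cm], the value of the best single edge. That edge alone is
    feasible, because [p <= 1] and all timeouts are positive, so the error can be charged to the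
    solution itself. *)
Lemma lp_value x : feasI x ->
  (1 - 2%:R / h%:R) * (kR%:R * \sum_(e < m) vr e * x e) <= \sum_(e < m) vr e * (cnt e)%:R.
Proof.
move=> Hx; have H1 := value_gap Hx.
have V0 e : (e < m)%N -> 0 <= vr e.
  by move=> He; rewrite /vr /pr !mulr_ge0 ?invr_ge0 ?ler0n.
case: (HAB) => _ _ [A0|[g Hg [EA EB]]].
  have c0 : cm = 0 by rewrite /cm A0 mul0r.
  have Z e : (e < m)%N -> vr e = 0.
    by move=> He; apply/eqP; rewrite eq_le V0 // -c0 vr_le.
  by rewrite !big1 ?mulr0 // => e _; rewrite Z ?mul0r.
have Eg : cm = vr g.
  by rewrite /cm EA EB /vr /pr !natrM mulf_div.
have Hg1 : feasI (fun e => (e == g)%:R).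
  have sg (F : nat -> rat) : \sum_(e < m) F e * (nat_of_ord e == g)%:R = F g.
    rewrite (bigD1 (Ordinal Hg)) //= eqxx mulr1 big1 ?addr0 // => e /negbTE He.
    by rewrite -val_eqE /= in He; rewrite He mulr0.
  split.
  - by move=> e _; case: (e == g); rewrite ?lexx ?ler01.
  - move=> v Hv; rewrite (eq_bigr (fun e : 'I_m => ((inc v e)%:R * pr e) * (nat_of_ord e == g)%:R)); last first.
      by move=> e _; rewrite mulrA.
    rewrite (sg (fun e => (inc v e)%:R * pr e)).
    have p1 : pr g <= 1.
      by have /andP[_ hq] := PNPD Hg; rewrite /pr ler_pdivrMr ?PDr // mul1r ler_nat.
    have p0 : 0 <= pr g by rewrite /pr divr_ge0 ?ler0n.
    by case: (inc v g); rewrite ?mul1r ?mul0r.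
  - move=> v Hv; rewrite (sg (fun e => (inc v e)%:R)).
    by apply: (@le_trans _ _ 1); [case: (inc v g)|rewrite ler1n T0].
have H2 := value_gap Hg1.
have E2 : \sum_(e < m) vr e * (nat_of_ord e == g)%:R = cm.
  rewrite (bigD1 (Ordinal Hg)) //= eqxx mulr1 big1 ?addr0 // => e /negbTE He.
  by rewrite -val_eqE /= in He; rewrite He mulr0.
rewrite E2 in H2.
move: H1 H2; set a := kR%:R * \sum_(e < m) _; set b := \sum_(e < m) _; set c := kR%:R * cm.
have e1 : 0 <= 1 - 2%:R / h%:R :> rat by rewrite subr_ge0 ler_pdivrMr // mul1r ltW.
have e0 : 0 <= 2%:R / h%:R :> rat by rewrite divr_ge0 ?ler0n.
set g1 := 2%:R / h%:R in e0 e1 * => u1 u2.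
(* From [a <= b + g1 c] and [(1 - g1) c <= b], taken with weights [1 - g1] and [g1]. *)
have u3 := ler_wpM2l e1 u1; have u4 : g1 * (c * (1 - g1)) <= g1 * b by rewrite ler_wpM2l //; lra.
lra.
Qed.

End Quality.
End Quality.
Export Quality.

(** * The LP phase as a whole, and its independence of the randomness *)

Module Assembly.
Local Open Scope nat_scope.

Definition cpre (e1 e2 e3 e4 b : nat) : cmd :=
  cunpack ;; cparams e1 e2 e3 e4 b ;; cpowtab ;; cargmax ;; cquant ;; clp.

Lemma bl_mono x y : x <= y -> bl x <= bl y.
Proof. by move=> H; rewrite /bl ltnS; apply: leq_trunc_log. Qed.

Section Pre.
Variables (r : seq bool) (coins : nat -> bool).
Variables (n m : nat) (U V PN PD WN WD T In : nat -> nat) (e1 e2 e3 e4 b : nat).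
Hypothesis In0 : In 0 = n.
Hypothesis In1 : In 1 = m.
Hypothesis InE : forall e, e < m ->
  [/\ In (2 + 6 * e) = U e, In (3 + 6 * e) = V e, In (4 + 6 * e) = PN e,
      In (5 + 6 * e) = PD e & In (6 + 6 * e) = WN e /\ In (7 + 6 * e) = WD e].
Hypothesis InT : forall v, v < n -> In (2 + 6 * m + v) = T v.
Hypothesis Un : forall e, e < m -> U e < n.
Hypothesis Vn : forall e, e < m -> V e < n.
Hypothesis UV : forall e, e < m -> U e != V e.
Hypothesis PNPD : forall e, e < m -> 0 < PN e <= PD e.
Hypothesis WD0 : forall e, e < m -> 0 < WD e.
Hypothesis e13 : e1 <= e3.
Hypothesis e23 : e2 <= e3.

Definition N0 : nat := 2 * (n + m) + 1.
Definition Lb : nat := bl (sumb PN PD WN WD m + 2 ^ e3 * N0 ^ 4 + 1).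
Definition Kpre : nat :=
  (m * 200 + n * 80 + 200) + ((n + m).+1 * 120 + 7 * (e1 + e2 + e3 + e4) + 200) + (Lb * 31 + 50)
  + (m * (6 * Kmul Lb + 80) + 50) + (m * (7 * Kmul Lb + 34 * (2 ^ e1 * N0) + 120) + 50)
  + (2 ^ e4 * N0 ^ 4 * Klp n m Lb + 50).

Definition pre_post (s s' : hst) : Prop := exists a L A B P C,
  [/\ n + m < 2 ^ a, 2 ^ a <= N0, maxfrac PN PD WN WD A B m,
      (forall e, e < m -> goodC (2 ^ (e1 + a)) (2 ^ (e3 + 4 * a)) PN PD WN WD A B e (C e)) /\
      (forall e, e < m -> goodP (2 ^ (e1 + a)) PN PD e (P e)) &
      [/\ Env n m (2 ^ (e1 + a)) (2 ^ (e2 + 2 * a)) (2 ^ (e3 + 4 * a)) (2 ^ (e4 + 4 * a))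
            (b + 4 * a) L U V PN PD WN WD s',
          forall v, v < n -> rd s' aT v = T v,
          forall e, e < m -> rd s' aCNT e =
            (iter (2 ^ (e4 + 4 * a)) (lpstep m (2 ^ (e1 + a)) (2 ^ (e2 + 2 * a)) U V T P C)
              (fun=> 0, fun=> 0, fun=> 0)).2 e,
          hh s' = hh s & hc s' = hc s]].

Lemma spec_pre s : (forall i, i < 2 + 6 * m + n -> rd s aIn i = In i) ->
  spec r coins (cpre e1 e2 e3 e4 b) s Kpre (pre_post s).
Proof.
move=> HIn; rewrite /Kpre.
apply: (spec_then (spec_unpack r coins In0 In1 InE InT HIn)); first lia.
move=> s1 [[A1 A2 A3 A4] A5 A6 A7 [A8 A9]].
have okp : okc (cparams e1 e2 e3 e4 b) by rewrite /= !okc_pow2.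
apply: (spec_then (spec_frame okp (spec_params r coins In0 In1 e1 e2 e3 e4 b A1 A2 A3))); first lia.
move=> s2 [[a [B1 B2 B3 [B4 B5 B6 B7]]] [F1 F2 F3]].
have nm x : x \in [:: vone; vn; vm; vbig] -> rd s2 0 x = rd s1 0 x.
  move=> Hx; apply: F1; move: Hx; rewrite !inE => /or4P[] /eqP ->;
    by rewrite /cparams /= !mem_cat !modv_pow2.
have ma j k : j != 0 -> rd s2 j k = rd s1 j k.
  by move=> Hj; apply: F2 => //; rewrite /= !moda_pow2.
have [H2h H2c] : hh s2 = hh s1 /\ hc s2 = hc s1 by apply: F3; rewrite /= !pure_pow2.
have P4 : (2 ^ a) ^ 4 <= N0 ^ 4 by rewrite leq_exp2r.
have HKb : 2 ^ (e3 + 4 * a) <= 2 ^ e3 * N0 ^ 4 by rewrite expnD leq_mul2l (mulnC 4) expnM P4 orbT.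
have Rb : 2 ^ (e4 + 4 * a) <= 2 ^ e4 * N0 ^ 4 by rewrite expnD leq_mul2l (mulnC 4) expnM P4 orbT.
have Kb : 2 ^ (e1 + a) <= 2 ^ e1 * N0 by rewrite expnD leq_mul2l B2 orbT.
set kK := 2 ^ (e1 + a) in B3 Kb *; set kKK := 2 ^ (e2 + 2 * a) in B4 *.
set kHK := 2 ^ (e3 + 4 * a) in B5 HKb *; set kR := 2 ^ (e4 + 4 * a) in B6 Rb *.
have K0 : 0 < kK by rewrite expn_gt0.
have KHK : kK <= kHK by rewrite leq_exp2l //; move: e13; lia.
have KKHK : kKK <= kHK by rewrite leq_exp2l //; move: e23; lia.
set sb := sumb PN PD WN WD m in A4 *.
have C1 : rd s2 0 vone = 1 by rewrite nm.
have C4 : rd s2 0 vbig = sb by rewrite nm.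
have LL : bl (sb + kHK + 1) <= Lb by apply: bl_mono; rewrite leq_add2r leq_add2l.
apply: (spec_then (spec_frame _ (spec_powtab r coins In0 In1 C1 C4 B5))) => //; first lia.
move=> s3 [[L [D1 D2 D3 D4]] [G1 G2 G3]].
have [H3h H3c] : hh s3 = hh s2 /\ hc s3 = hc s2 by apply: G3.
have E3 : Env n m kK kKK kHK kR (b + 4 * a) L U V PN PD WN WD s3.
  split; [split|split| |] => //; rewrite ?G1 //; try by rewrite nm.
  by move=> e He; rewrite !G2 // !ma //; apply: A5.
have T3 v : v < n -> [/\ rd s3 aT v = T v, rd s3 aY v = 0 & rd s3 aZ v = 0].
  by move=> Hv; rewrite !G2 // !ma //; apply: A6.
have N3 e : e < m -> rd s3 aCNT e = 0 by move=> He; rewrite G2 // ma // A7.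
have LLb : L <= Lb by apply: leq_trans LL.
have big e : e < m -> PN e + PD e + WN e + WD e <= sb.
  by move=> He; rewrite /sb /sumb (bigD1 (Ordinal He)) //= leq_addr.
have PNL e : e < m -> PN e < 2 ^ L by move=> He; have := big e He; lia.
have PDL e : e < m -> 0 < PD e < 2 ^ L by move=> He; have := big e He; have := PNPD He; lia.
have WNL e : e < m -> WN e < 2 ^ L by move=> He; have := big e He; lia.
have WDL e : e < m -> 0 < WD e < 2 ^ L by move=> He; have := big e He; have := WD0 He; lia.
have KL : kK < 2 ^ L by lia.
have KKL : kKK < 2 ^ L by lia.
have HKL : kHK < 2 ^ L by lia.
have ML : Kmul L <= Kmul Lb by rewrite /Kmul; lia.
have b4 : m * (6 * Kmul L + 80) + 50 <= m * (6 * Kmul Lb + 80) + 50.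
  by rewrite leq_add2r leq_mul2l; apply/orP; right; lia.
have b5 : m * (7 * Kmul L + 34 * kK + 120) + 50 <= m * (7 * Kmul Lb + 34 * (2 ^ e1 * N0) + 120) + 50.
  by rewrite leq_add2r leq_mul2l; apply/orP; right; lia.
have b6 : kR * Klp n m L + 50 <= 2 ^ e4 * N0 ^ 4 * Klp n m Lb + 50.
  rewrite leq_add2r; apply: leq_mul => //; rewrite /Klp !leq_add2r leq_mul2l.
  by apply/orP; right; lia.
have b3 : bl (sb + kHK + 1) * 31 + 50 <= Lb * 31 + 50 by lia.
move: b3 b4 b5 b6; move: (bl (sb + kHK + 1) * 31 + 50) (Lb * 31 + 50)
  (m * (6 * Kmul Lb + 80) + 50) (m * (7 * Kmul Lb + 34 * (2 ^ e1 * N0) + 120) + 50)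
  (2 ^ e4 * N0 ^ 4 * Klp n m Lb + 50) => z3 y3 y4 y5 y6 b3 b4 b5 b6.
apply: (spec_then (spec_argmax r coins PNL PDL WNL WDL KL KKL HKL E3)); first lia.
move=> s4 [E4 M4 [J1 J2 J3]]; have [H4h H4c] : hh s4 = hh s3 /\ hc s4 = hc s3 by apply: J3.
apply: (spec_then (spec_quant r coins PNL PDL WNL WDL KL KKL HKL PNPD K0 E4 erefl erefl M4)); first lia.
move=> s5 [E5 GC GP [Q1 Q2 Q3]]; have [H5h H5c] : hh s5 = hh s4 /\ hc s5 = hc s4 by apply: Q3.
pose P e := rd s5 aP e; pose C e := rd s5 aC e.
have PL e : e < m -> P e < 2 ^ L.
  move=> He; have /andP[h1 _] := GP e He; have /andP[p0 p1] := PNPD He.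
  apply: leq_ltn_trans KL; rewrite -(leq_pmul2r (leq_trans p0 p1)); apply: (leq_trans (ltnW h1)).
  by rewrite mulnC leq_mul2l p1 orbT.
have PC5 : PCT n m kK kKK kHK kR (b + 4 * a) L U V PN PD WN WD T P C s5.
  by split=> // v Hv; rewrite Q2 // J2 //; case: (T3 v Hv).
have LP5 : lprel n m s5 (fun=> 0, fun=> 0, fun=> 0).
  split=> x Hx; rewrite Q2 // J2 //=; [by case: (T3 x Hx)|by case: (T3 x Hx)|exact: N3].
have [s6 [k6 [R6 K6 [PC6 [_ _ L6] [W1 W2 W3]]]]] := spec_lp r coins KL KKL HKL K0 PL Un Vn UV PC5 LP5.
have [H6h H6c] : hh s6 = hh s5 /\ hc s6 = hc s5 by apply: W3.
exists s6, k6; split; [exact: R6| |].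
  apply: (leq_trans K6); apply: (leq_trans b6); move: b3 b4 b5; clear.
  by move: (m * (6 * Kmul L + 80) + 50) (m * (7 * Kmul L + 34 * kK + 120) + 50); clear; lia.
case: PC6 => [E6 _ _ T6].
exists a, L, (rd s4 0 vNA), (rd s4 0 vNB), P, C; split=> //.
by split=> //; rewrite ?H6h ?H5h ?H4h ?H3h ?H2h ?H6c ?H5c ?H4c ?H3c ?H2c.
Qed.

End Pre.

Lemma reach_mono P r coins k s s' : reach P r coins k s s' ->
  ncoin s <= ncoin s' /\ size (mhist s) <= size (mhist s').
Proof.
elim=> [{}s|{}k {}s {}s' Hh _ [IH1 IH2]] //.
by split; [apply: leq_trans IH1|apply: leq_trans IH2]; case: (nth _ _ _) => //= *; rewrite ?size_rcons.
Qed.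

(** If neither the coin counter nor the history grows, no [ICoin] or [IProbe] was executed, so the
    run is the same for all realizations and coins. *)
Lemma reach_indep P r coins r' coins' k s s' : reach P r coins k s s' ->
  ncoin s' = ncoin s -> size (mhist s') = size (mhist s) -> reach P r' coins' k s s'.
Proof.
elim=> [{}s|{}k {}s {}s' Hh R IH] Hn Hs; first exact: reach0.
have [M1 M2] := reach_mono R.
apply: reachS => //; move: Hh M1 M2 IH; case: (nth _ _ _) => //= *; auto.
- lia.
- by match goal with H : is_true (size (rcons _ _) <= _) |- _ => rewrite size_rcons in H; lia end.
Qed.

(** * Input encoding *)

Definition blk (I : instance) (e : nat) : seq nat :=
  [:: (ends I e).1; (ends I e).2] ++ enc_rat (p_ I e) ++ enc_rat (w_ I e).

Lemma nth_blocks (G : nat -> seq nat) a k e j : (forall e, size (G e) = 6) -> e < k -> j < 6 ->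
  nth 0 (flatten [seq G e | e <- iota a k]) (6 * e + j) = nth 0 (G (a + e)) j.
Proof.
move=> HG; elim: k a e => // k IH a [|e] He Hj /=; rewrite nth_cat HG.
  by rewrite muln0 add0n Hj addn0.
have -> : (6 * e.+1 + j < 6) = false by apply/negbTE; rewrite -leqNgt; lia.
rewrite (_ : 6 * e.+1 + j - 6 = 6 * e + j); last lia.
by rewrite IH // addSnnS.
Qed.

Lemma size_blocks (G : nat -> seq nat) a k : (forall e, size (G e) = 6) ->
  size (flatten [seq G e | e <- iota a k]) = 6 * k.
Proof. by move=> HG; elim: k a => //= k IH a; rewrite size_cat HG IH; lia. Qed.

Lemma encodeE I : encode I = [:: nV I, nE I & flatten [seq blk I e | e <- iota 0 (nE I)] ++ tmo I].
Proof. by []. Qed.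

Lemma encode_edge I e j : e < nE I -> j < 6 ->
  nth 0 (encode I) (2 + j + 6 * e) = nth 0 (blk I e) j.
Proof.
move=> He Hj; rewrite encodeE -addnA 2!addSn add0n -[nth _ _ _.+2]/(nth 0 (_ ++ _) _) nth_cat.
rewrite size_blocks //; have -> : j + 6 * e < 6 * nE I by lia.
by rewrite addnC nth_blocks.
Qed.

Lemma encode_tmo I v : nth 0 (encode I) (2 + 6 * nE I + v) = t_ I v.
Proof.
rewrite encodeE -addnA 2!addSn add0n -[nth _ _ _.+2]/(nth 0 (_ ++ _) _) nth_cat size_blocks //.
by rewrite ltnNge leq_addr /= addKn.
Qed.

Lemma bl_gt0 x : 0 < bl x. Proof. by []. Qed.

Lemma lt_bl x : x < 2 ^ bl x.
Proof. exact: trunc_log_ltn. Qed.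

Lemma bl_in I x : x \in encode I -> bl x <= input_size I.
Proof. by move=> Hx; rewrite /input_size (big_rem x) //= leq_addr. Qed.

Lemma size_encode I : size (encode I) <= input_size I.
Proof.
rewrite /input_size -sum1_size; elim: (encode I) => [|x s IH]; first by rewrite !big_nil.
by rewrite !big_cons leq_add.
Qed.

Lemma mem_encode I i : nth 0 (encode I) i <= 2 ^ input_size I.
Proof.
case: (ltnP i (size (encode I))) => Hi; last by rewrite nth_default.
apply: (leq_trans (ltnW (lt_bl _))); rewrite leq_exp2l //; exact: bl_in (mem_nth _ Hi).
Qed.

(** Both powers are at least 2, so their sum is at most their product. *)
Lemma bl_add x y : bl (x + y) <= bl x + bl y.
Proof.
case: (posnP (x + y)) => [->|xy]; first by rewrite /bl trunc_log0.
rewrite {1}/bl -(@ltn_exp2l 2) //; apply: (leq_ltn_trans (trunc_logP _ xy)) => //.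
have := lt_bl x; have := lt_bl y; rewrite expnD.
have : 2 <= 2 ^ bl x by rewrite -{1}(expn1 2) leq_exp2l.
have : 2 <= 2 ^ bl y by rewrite -{1}(expn1 2) leq_exp2l.
move: (2 ^ bl x) (2 ^ bl y) => a c; nia.
Qed.

Lemma bl_le_succ x : bl x <= x.+1.
Proof. by rewrite /bl ltnS; case: (posnP x) => [->|x0]; [rewrite trunc_log0|apply: ltnW; apply: (leq_trans (ltn_expl _ (ltnSn 1))); apply: trunc_logP]. Qed.

(** * Polynomial bounds *)

Definition polyb (f : instance -> nat) : Prop :=
  exists c k, forall I, wf_instance I -> f I <= c * (input_size I).+1 ^ k.

Lemma polyb_le f g : (forall I, wf_instance I -> f I <= g I) -> polyb g -> polyb f.
Proof. by move=> H [c [k Hg]]; exists c, k => I W; apply: leq_trans (H I W) (Hg I W). Qed.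

Lemma polyb_const c : polyb (fun=> c).
Proof. by exists c, 0 => I _; rewrite expn0 muln1. Qed.

Lemma polyb_size : polyb input_size.
Proof. by exists 1, 1 => I _; rewrite mul1n expn1. Qed.

Lemma polyb_add f g : polyb f -> polyb g -> polyb (fun I => f I + g I).
Proof.
move=> [c [k Hf]] [c' [k' Hg]]; exists (c + c'), (k + k') => I W.
rewrite mulnDl; apply: leq_add.
  by apply: (leq_trans (Hf I W)); rewrite leq_mul2l; apply/orP; right; apply: leq_pexp2l => //; apply: leq_addr.
by apply: (leq_trans (Hg I W)); rewrite leq_mul2l; apply/orP; right; apply: leq_pexp2l => //; apply: leq_addl.
Qed.

Lemma polyb_mul f g : polyb f -> polyb g -> polyb (fun I => f I * g I).
Proof.
move=> [c [k Hf]] [c' [k' Hg]]; exists (c * c'), (k + k') => I W.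
by rewrite expnD mulnACA; apply: leq_mul; [apply: Hf|apply: Hg].
Qed.
End Assembly.
Export Assembly.

Module Algorithm.
Local Open Scope nat_scope.

(** * The program and its running time *)

Lemma polyb_exp f k : polyb f -> polyb (fun I => f I ^ k).
Proof.
move=> Hf; elim: k => [|k IH]; first exact: (polyb_const 1).
by apply: (polyb_le _ (polyb_mul Hf IH)) => I _; rewrite expnS.
Qed.

Lemma all_opmax (l : program) b : \sum_(i <- l) opmax i <= b -> all (fun i => opmax i <= b) l.
Proof.
elim: l => //= i l IH; rewrite big_cons => H.
by rewrite (leq_trans (leq_addr _ _) H) IH // (leq_trans (leq_addl _ _) H).
Qed.

Lemma rat_absE (x : rat) : (0 <= x)%R -> x = ((`|numq x|%N)%:R / (`|denq x|%N)%:R)%R.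
Proof.
move=> x0; rewrite !natr_absz ger0_norm ?numq_ge0 // ger0_norm ?denq_ge0 //.
by rewrite divq_num_den.
Qed.

Section Algorithm.
Variables (e1 N : nat).
(** With [h = 2 ^ e1] and [M = 2 ^ a] these exponents encode [K = h M], [KK = K^2], [HK = h M^3 K],
    [R = 8 h^3 M^4] and [2 ^ kb = 2 h R]. *)
Definition lp_phase : cmd := cpre e1 (2 * e1) (2 * e1) (3 * e1 + 3) (4 * e1 + 4).
Definition entry : nat := size (prologue 0).
Definition main_code : seq instr := comp entry (CSeq lp_phase (cprobe N)).
Definition exit_pc : nat := entry + size main_code.
Definition alg : program := prologue exit_pc ++ main_code ++ [:: IHalt].

Lemma codeat_alg : [/\ codeat alg 0 (prologue exit_pc), codeat alg entry main_code &
  nth IHalt alg exit_pc = IHalt].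
Proof.
have C0 : codeat alg 0 alg by move=> i Hi; rewrite add0n.
have [C1 /codeat_cat [C2 /codeat_cons [C3 _]]] := codeat_cat C0.
by split.
Qed.

Lemma okc_lp_phase : okc lp_phase.
Proof. by rewrite /lp_phase /cpre /= !okc_pow2. Qed.

(** These bounds repeat [N0], [Lb] and [Kpre] with every quantity replaced by a function of the
    input size, so that [polyb_Cz] follows from their shape alone. *)
Definition Nz (s : nat) : nat := 2 * s + 1.
Definition Lz (s : nat) : nat := 2 * s + 5 + 2 ^ (2 * e1) * Nz s ^ 4.
Definition kz (s : nat) : nat := 4 * e1 + 4 + 4 * Nz s.
Definition Kz (s : nat) : nat :=
  (s * 200 + s * 80 + 200) + ((s + s + 1) * 120 + 7 * (e1 + 2 * e1 + 2 * e1 + (3 * e1 + 3)) + 200)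
  + (Lz s * 31 + 50) + (s * (6 * (Lz s * 70 + 50) + 80) + 50)
  + (s * (7 * (Lz s * 70 + 50) + 34 * (2 ^ e1 * Nz s) + 120) + 50)
  + (2 ^ (3 * e1 + 3) * Nz s ^ 4 * (s * (2 * (Lz s * 70 + 50) + 310) + s * 70 + 100) + 50).
Definition Tz (s : nat) : nat :=
  (size pre_code + 7 * s + 20) + Kz s + (N * (s * (kz s * 31 + 217) + 40) + 50) + N * s * kz s.
Definition opsum : nat := \sum_(i <- alg) opmax i.
(** [opsum] bounds the constants occurring in the program, as [reach_cost] requires. The extra
    summand [Tz] makes this a bound on fuel and on coins as well. *)
Definition Cz (s : nat) : nat := Tz s * (1 + 5 * (s + opsum + Tz s)) + Tz s.

Lemma polyb_Cz : polyb (fun I => Cz (input_size I)).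
Proof.
rewrite /Cz /Tz /Kz /kz /Lz /Nz.
by repeat first [exact: polyb_size | exact: polyb_const | apply: polyb_add | apply: polyb_mul
  | apply: polyb_exp].
Qed.

Section Instance.
Variable I : instance.
Hypothesis wfI : wf_instance I.
Hypothesis m0 : 0 < nE I.

Local Notation n := (nV I).
Local Notation m := (nE I).
Local Notation s := (input_size I).
Definition iU (e : nat) : nat := (ends I e).1.
Definition iV (e : nat) : nat := (ends I e).2.
Definition iPN (e : nat) : nat := `|numq (p_ I e)|.
Definition iPD (e : nat) : nat := `|denq (p_ I e)|.
Definition iWN (e : nat) : nat := `|numq (w_ I e)|.
Definition iWD (e : nat) : nat := `|denq (w_ I e)|.
Definition iIn (i : nat) : nat := nth 0 (encode I) i.

Lemma iInE e : e < m ->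
  [/\ iIn (2 + 6 * e) = iU e, iIn (3 + 6 * e) = iV e, iIn (4 + 6 * e) = iPN e,
      iIn (5 + 6 * e) = iPD e & iIn (6 + 6 * e) = iWN e /\ iIn (7 + 6 * e) = iWD e].
Proof.
move=> He; split; [exact: (@encode_edge I e 0 He isT)|exact: (@encode_edge I e 1 He isT)|
  exact: (@encode_edge I e 2 He isT)|exact: (@encode_edge I e 3 He isT)|].
by split; [exact: (@encode_edge I e 4 He isT)|exact: (@encode_edge I e 5 He isT)].
Qed.

Lemma iIn_tmo v : v < n -> iIn (2 + 6 * m + v) = t_ I v.
Proof. by move=> _; apply: encode_tmo. Qed.

Lemma iUn e : e < m -> iU e < n. Proof. by move=> /(wf_ends wfI) []. Qed.
Lemma iVn e : e < m -> iV e < n. Proof. by move=> /(wf_ends wfI) []. Qed.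
Lemma iUV e : e < m -> iU e != iV e. Proof. by move=> /(wf_ends wfI) []. Qed.
Lemma iWD_gt0 e : e < m -> 0 < iWD e. Proof. by rewrite /iWD absz_gt0 denq_neq0. Qed.

Lemma w_ge0 e : (0 <= w_ I e)%R.
Proof.
case/and5P: wfI => _ _ _ _ /and4P[_ _ /allP H _].
case: (ltnP e (size (wt I))) => He; first by apply: H; apply: mem_nth.
by rewrite /w_ nth_default.
Qed.

Lemma p_absE e : e < m -> p_ I e = ((iPN e)%:R / (iPD e)%:R)%R.
Proof. by move=> /(p_bounds wfI) /andP[p0 _]; apply: rat_absE; apply: ltW. Qed.
Lemma w_absE e : w_ I e = ((iWN e)%:R / (iWD e)%:R)%R.
Proof. exact: rat_absE (w_ge0 e). Qed.

Lemma iPNPD e : e < m -> 0 < iPN e <= iPD e.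
Proof.
move=> He; have /andP[p0 p1] := p_bounds wfI He.
apply/andP; split; first by rewrite /iPN absz_gt0 numq_eq0 lt0r_neq0.
have D0 : (0 < (iPD e)%:R :> rat)%R by rewrite ltr0n /iPD absz_gt0 denq_neq0.
by move: p1; rewrite (p_absE He) ler_pdivrMr // mul1r ler_nat.
Qed.

Lemma nV_ge2 : 1 < n.
Proof. by have := iUn m0; have := iVn m0; have := iUV m0; case: n => [|[|k]] //; lia. Qed.

Lemma size_input : n + 6 * m + 2 <= s.
Proof.
apply: leq_trans (size_encode I); rewrite encodeE /= size_cat size_blocks //.
by case/and5P: wfI => _ _ /eqP -> _ _; lia.
Qed.

Lemma sumb_bound : bl (sumb iPN iPD iWN iWD m) <= 2 * s + 3.
Proof.
have Hs := size_input.
have Hin e j : e < m -> j < 6 -> nth 0 (blk I e) j <= 2 ^ s.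
  by move=> He Hj; rewrite -encode_edge //; apply: mem_encode.
have -> : 2 * s + 3 = (2 * s + 2).+1 by lia.
apply: bl_le; apply: (@leq_trans (\sum_(e < m) 4 * 2 ^ s)).
  rewrite /sumb; apply: leq_sum => e _.
  have := Hin e 2 (ltn_ord e) isT; have := Hin e 3 (ltn_ord e) isT.
  have := Hin e 4 (ltn_ord e) isT; have := Hin e 5 (ltn_ord e) isT.
  rewrite /= -/(iPN e) -/(iPD e) -/(iWN e) -/(iWD e); move: (2 ^ s) => z; lia.
rewrite sum_nat_const card_ord expnD mul2n -addnn expnD.
have : m <= 2 ^ s by apply: ltnW; apply: leq_ltn_trans (ltn_expl s (ltnSn 1)); lia.
by move: (2 ^ s) => z; rewrite -[2 ^ 2]/4; nia.
Qed.

Lemma N0_bound : N0 n m <= Nz s.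
Proof. by rewrite /N0 /Nz; have := size_input; lia. Qed.

Lemma leq_pow4 x y : x <= y -> x ^ 4 <= y ^ 4. Proof. by rewrite leq_exp2r. Qed.

Lemma Lb_bound : Lb n m iPN iPD iWN iWD (2 * e1) <= Lz s.
Proof.
rewrite /Lb; apply: (leq_trans (bl_add _ _)); have b1 : bl 1 = 1 by [].
have A := bl_add (sumb iPN iPD iWN iWD m) (2 ^ (2 * e1) * N0 n m ^ 4).
have B := bl_le_succ (2 ^ (2 * e1) * N0 n m ^ 4).
have C : 2 ^ (2 * e1) * N0 n m ^ 4 <= 2 ^ (2 * e1) * Nz s ^ 4.
  by rewrite leq_mul2l leq_pow4 ?orbT // N0_bound.
have D := sumb_bound; rewrite b1 /Lz; move: A B C D.
by move: (_ * N0 n m ^ 4) (_ * Nz s ^ 4) (sumb _ _ _ _ _) => x y z; lia.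
Qed.

Lemma Kpre_bound : Kpre n m iPN iPD iWN iWD e1 (2 * e1) (2 * e1) (3 * e1 + 3) <= Kz s.
Proof.
have Hs := size_input; have nS : n <= s by lia. have mS : m <= s by lia.
have LS := Lb_bound; have NS := N0_bound; have N4 := leq_pow4 NS.
rewrite /Kpre /Klp /Kmul /Kz; have -> : (n + m).+1 = n + m + 1 by rewrite addn1.
repeat match goal with
  | |- is_true (?x <= ?x) => exact: (leqnn x)
  | H : is_true (?x <= ?y) |- is_true (?x <= ?y) => exact: H
  | |- is_true (_ + _ <= _ + _) => apply: leq_add
  | |- is_true (_ * _ <= _ * _) => apply: leq_mul
  end.
Qed.

Definition lp_count (a : nat) (P C : nat -> nat) : nat -> nat :=
  (iter (2 ^ (3 * e1 + 3 + 4 * a))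
    (lpstep m (2 ^ (e1 + a)) (2 ^ (2 * e1 + 2 * a)) iU iV (t_ I) P C)
    ((fun=> 0, fun=> 0, fun=> 0) : lpst)).2.

Definition lp_data (a A B : nat) (P C : nat -> nat) : Prop :=
  [/\ n + m < 2 ^ a, 2 ^ a <= N0 n m, maxfrac iPN iPD iWN iWD A B m,
      forall e, e < m -> goodC (2 ^ (e1 + a)) (2 ^ (2 * e1 + 4 * a)) iPN iPD iWN iWD A B e (C e) &
      forall e, e < m -> goodP (2 ^ (e1 + a)) iPN iPD e (P e)].

Definition alg_hist (a : nat) (P C : nat -> nat) (r : seq bool) (coins : nat -> bool) : history :=
  proc I (lp_count a P C) (4 * e1 + 4 + 4 * a) r coins 0 (flatten (nseq N (iota 0 m))) [::].

Definition halts_with (f : seq bool -> (nat -> bool) -> history) : Prop :=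
  forall r coins, exists k st, [/\ reach alg r coins k (init_state I) st,
    nth IHalt alg (pc st) = IHalt, k <= Tz s & mhist st = f r coins].

(** The LP data are chosen before realization and coins, which is what allows the later averaging to
    treat the counts as fixed numbers. *)
Lemma alg_halts : exists a A B P C, lp_data a A B P C /\ halts_with (alg_hist a P C).
Proof.
have Hs := size_input; have le3 : e1 <= 2 * e1 by lia.
have mS : m <= s by lia.
have T1 : pro_steps n m <= size pre_code + 7 * s + 20 by rewrite /pro_steps; move: (size _) => z; lia.
have [C0 CM CH] := codeat_alg; have [Ca Cb] := codeat_cat CM.
(* The deterministic part is run once, on an empty realization and constant coins; [reach_indep]
   transfers it to all others in [RR]. *)
have [st0 [R0 P0 [X0 H0 N0']]] := @prologue_ok alg [::] (fun=> false) n m iIn nV_ge2 m0 erefl erefl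
  exit_pc (init_state I) C0 erefl (fun=> erefl) erefl erefl.
pose s0 := HSt (fun j k => rmem st0 (aa j k)) [::] 0.
have rel0 : rel s0 st0 by split.
have HIn i : i < 2 + 6 * m + n -> rd s0 aIn i = iIn i.
  move=> Hi; have Hi' : i < n + 6 * m + 2 by move: Hi; clear; lia.
  have E : aa aIn i = 16 * i + 3 by rewrite /aa -addnA.
  by rewrite -(X0 i Hi') -E /rd -lock.
have [s1 [k1 [R1 K1 PP]]] := @spec_pre [::] (fun=> false) n m iU iV iPN iPD iWN iWD (t_ I) iIn
  e1 (2 * e1) (2 * e1) (3 * e1 + 3) (4 * e1 + 4) erefl erefl iInE iIn_tmo iUn iVn iUV iPNPD iWD_gt0
  le3 (leqnn _) s0 HIn.
have [st1 [R1' P1 rel1]] := comp_correct R1 okc_lp_phase Ca P0 rel0.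
case: PP => a [L [A [B [P [C [D1 D2 D3 [D4 D5] [E1 E2 E3 E4 E5]]]]]]].
exists a, A, B, P, C; split; first exact: (And5 D1 D2 D3 D4 D5).
have RR r coins : reach alg r coins (pro_steps n m + k1) (init_state I) st1.
  case: (rel1) => _ Hm1 Hn1; apply: reach_indep (reach_trans R0 R1') _ _.
    exact: etrans Hn1 E5.
  by rewrite Hm1 E4.
move=> r coins.
have PI : Pinv n m (2 ^ (e1 + a)) (2 ^ (2 * e1 + 2 * a)) (2 ^ (2 * e1 + 4 * a))
    (2 ^ (3 * e1 + 3 + 4 * a)) (4 * e1 + 4 + 4 * a) L iU iV iPN iPD iWN iWD I (lp_count a P C) [::] s1.
  split; [exact: E1|exact: E4|exact: E3|].
  by move=> v Hv; rewrite (E2 v Hv) /matched /nprobed /= subn0.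
have HU e : e < m -> ends I e = (iU e, iV e) by move=> _; apply: surjective_pairing.
have [s2 [k2 [R2 K2 H2]]] := spec_probe_phase r coins erefl HU iUn iVn N PI E5.
have [st2 [R2' P2 rel2]] := comp_correct R2 (isT : okc (cprobe N)) Cb P1 rel1.
exists (pro_steps n m + k1 + k2), st2; split.
- exact: reach_trans (RR r coins) R2'.
- rewrite P2 -addnA -size_cat; exact: CH.
- have aN : a <= Nz s.
    by apply: ltnW; apply: (leq_trans (ltn_expl a (ltnSn 1))); apply: leq_trans N0_bound.
  have kk : 4 * e1 + 4 + 4 * a <= kz s by rewrite /kz leq_add2l leq_mul2l aN orbT.
  have T2 := leq_trans K1 Kpre_bound.
  have T3 : k2 <= N * (s * (kz s * 31 + 217) + 40) + 50.
    apply: (leq_trans K2); rewrite leq_add2r leq_mul2l leq_add2r; apply/orP; right.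
    exact: (leq_mul mS (leq_add (leq_mul kk (leqnn _)) (leqnn _))).
  by rewrite /Tz; apply: leq_trans (leq_addr _ _); apply: leq_add _ T3; apply: leq_add T1 T2.
- by case: rel2 => _ Hm2 _; apply: etrans Hm2 H2.
Qed.

Lemma coins_bound a : 2 ^ a <= N0 n m ->
  size (flatten (nseq N (iota 0 m))) * (4 * e1 + 4 + 4 * a) <= Tz s.
Proof.
move=> Ha; have Hs := size_input.
have -> : size (flatten (nseq N (iota 0 m))) = N * m.
  by elim: N => //= k IH; rewrite size_cat size_iota IH mulSn.
have aN : a <= Nz s.
  by apply: ltnW; apply: (leq_trans (ltn_expl a (ltnSn 1))); apply: leq_trans N0_bound.
rewrite /Tz; apply: leq_trans (leq_addl _ _); apply: leq_mul; first by rewrite leq_mul2l; apply/orP; right; lia.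
by rewrite /kz leq_add2l leq_mul2l aN orbT.
Qed.

End Instance.

Lemma alg_halts_empty I : nE I = 0 -> halts_with I (fun _ _ => [::]).
Proof.
move=> E r coins; have [C0 _ CH] := codeat_alg; have [J0 _] := codeat_cons C0.
have J0' : nth IHalt alg (pc (init_state I)) = IJz 1 exit_pc := J0.
have Ep : pc (step (IJz 1 exit_pc) r coins (init_state I)) = exit_pc :=
  congr1 (fun x => if x == 0 then exit_pc else 1) E.
exists 1, (step (IJz 1 exit_pc) r coins (init_state I)); split.
- by apply: reachS; rewrite J0'; [reflexivity|exact: reach0].
- rewrite Ep; exact: CH.
- by rewrite /Tz; do 3 apply: leq_trans (leq_addr _ _); rewrite addnS.
- reflexivity.
Qed.

Lemma halts_run I f B : halts_with I f -> Cz (input_size I) <= B ->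
  forall r coins, exists2 st, run_alg alg I r coins B = Some st & mcost st <= B /\ mhist st = f r coins.
Proof.
move=> Hf HB r coins; have [k [st [R Hh Hk Hm]]] := Hf r coins.
set T := Tz _ in Hk; have TB : T <= B by apply: leq_trans HB; rewrite /Cz leq_addl.
exists st; first by apply: (exec_reach R Hh); rewrite ltnS (leq_trans Hk).
split; last exact: Hm.
have Hop : all (fun i => opmax i <= 2 ^ (input_size I + opsum)) alg.
  apply: all_opmax; apply: (leq_trans (ltnW (ltn_expl opsum (ltnSn 1)))).
  rewrite leq_exp2l //; exact: leq_addl.
have Hmem a : rmem (init_state I) a <= 2 ^ (input_size I + opsum).
  by apply: (leq_trans (mem_encode I a)); rewrite leq_exp2l // leq_addr.
apply: (leq_trans (reach_cost R Hop Hmem)); rewrite add0n; apply: leq_trans HB.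
rewrite /Cz; apply: leq_trans (leq_addr _ _); apply: (leq_mul Hk).
by rewrite leq_add2l leq_mul2l leq_add2l Hk orbT.
Qed.

End Algorithm.
End Algorithm.
Export Algorithm.

(** * Expected value of the algorithm against a strategy *)

Module Value.
Local Open Scope ring_scope.

Lemma Ec_sum n m (F : nat -> seq bool -> rat) :
  Ec n (fun l => \sum_(i < m) F i l) = \sum_(i < m) Ec n (F i).
Proof.
rewrite -EcE exchange_big mulr_sumr; apply: eq_bigr => i _; exact: EcE.
Qed.

Lemma EcZ n c (F : seq bool -> rat) : Ec n (fun l => c * F l) = c * Ec n F.
Proof. by rewrite -!EcE -mulr_sumr mulrCA. Qed.

Lemma hvalue_sum I h : legal_history I h -> hvalue I h = \sum_(e < nE I) w_ I e * Fe e h.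
Proof.
elim/last_ind: h => [|h [f b] IH]; first by rewrite /hvalue big_nil big1 // => e _; rewrite /Fe in_nil mulr0.
rewrite legal_history_rcons => /andP[Hl /= Hf].
have [fE fh] : (f < nE I)%N /\ f \notin map fst h by case/and3P: Hf.
rewrite /hvalue -cats1 big_cat /= -/(hvalue I h) IH // cats1 big_cons big_nil /=.
case: b; last first.
  by rewrite addr0; apply: eq_bigr => e _; rewrite /Fe mem_rcons inE xpair_eqE andbF.
have -> : w_ I f + 0 = \sum_(e < nE I) w_ I e * (nat_of_ord e == f)%:R.
  rewrite (bigD1 (Ordinal fE)) //= eqxx mulr1 big1 // => e /negbTE He.
  by rewrite -val_eqE /= in He; rewrite He mulr0.
rewrite -big_split /=; apply: eq_bigr => e _; rewrite -mulrDr /Fe mem_rcons inE xpair_eqE eqxx andbT.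
case: (eqVneq (nat_of_ord e) f) => [->|_] /=; last by rewrite addr0.
have -> : (f, true) \in h = false by apply: contraNF fh => H; apply/mapP; exists (f, true).
by rewrite add0r.
Qed.

Lemma alg_valueE e1 N I f B : halts_with e1 N I f -> (Cz e1 N (input_size I) <= B)%N ->
  alg_value (alg e1 N) I B = Er I (fun r => Ec B (fun cs => hvalue I (f r (nth false cs)))).
Proof.
move=> Hf HB; apply: eq_bigr => r _.
rewrite (EcE B (fun cs => run_value (alg e1 N) I r (fun k => nth false cs k) B)); congr (_ * _).
apply: eq_Ec => l _; rewrite /run_value.
by have [st -> [_ ->]] := halts_run Hf HB r (fun k => nth false l k).
Qed.

(** By linearity the value splits over the edges; averaging coins, then outcomes, gives for each
    edge a tree [PT], bounded by [edge_ge]. *)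
Lemma rounding_value I cnt kb q d N kap B : wf_instance I -> 0 < d < 1 ->
  (forall e, (e < nE I)%N -> (cnt e <= 2 ^ kb)%N) ->
  (forall e, q e = (cnt e)%:R / 2%:R ^+ kb) ->
  (forall e, (e < nE I)%N -> 0 <= q e <= d) ->
  (forall x, (x < nV I)%N -> \sum_(e < nE I | incident I x e) q e * p_ I e <= d) ->
  (forall x, (x < nV I)%N -> \sum_(e < nE I | incident I x e) q e <= d * (t_ I x)%:R) ->
  kap <= \sum_(k < N) (1 - d / 2%:R) ^+ k *
    ((1 - d) ^+ k.+1 * (1 - (k.+1%:R * (d / (1 - d))) ^+ 2)) ^+ 2 ->
  kap <= \sum_(k < N) (1 - d) ^+ k * ((1 - d) ^+ k.+1 *
    (1 - Num.max ((k.+1%:R * (d / (1 - d))) ^+ 2 / 8%:R) ((k.+1%:R * (d / (1 - d))) ^+ 3))) ^+ 2 ->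
  (forall k, (k <= N)%N -> 0 <= k%:R * (d / (1 - d)) <= 1) ->
  (size (flatten (nseq N (iota 0 (nE I)))) * kb <= B)%N ->
  kap * \sum_(e < nE I) w_ I e * p_ I e * q e <=
  Er I (fun r => Ec B (fun cs =>
    hvalue I (proc I cnt kb r (nth false cs) 0 (flatten (nseq N (iota 0 (nE I)))) [::]))).
Proof.
move=> W d01 Hc Hq q0d cm ct K1 K2 Hs HB; set l := flatten _ in HB *.
have Hl e : e \in l -> (e < nE I)%N by case/flattenP => t /nseqP[-> _]; rewrite mem_iota.
rewrite (@eq_Er _ _ (fun r => \sum_(e < nE I) w_ I e * Vr I q (Fe e) r l [::])); last first.
  move=> r; transitivity (Ec B (fun cs => \sum_(e < nE I) w_ I e *
      Fe e (proc I cnt kb r (nth false cs) 0 l [::]))).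
    by apply: eq_Ec => cs _; apply: hvalue_sum; apply: legal_proc.
  apply: (etrans (Ec_sum B (nE I) (fun e cs => w_ I e * Fe e (proc I cnt kb r (nth false cs) 0 l [::])))).
  apply: eq_bigr => e _; apply: (etrans (EcZ _ _ _)); congr (_ * _).
  apply: (@Ec_proc I q cnt kb r (Fe e) l [::] B); [|by move=> f _; apply: Hq|exact: HB].
  by move=> f /Hl; apply: Hc.
rewrite [X in _ <= X](Er_sum I (nE I) (fun e r => w_ I e * Vr I q (Fe e) r l [::])) mulr_sumr.
apply: ler_sum => e _.
have -> : Er I (fun r => w_ I e * Vr I q (Fe e) r l [::]) = w_ I e * PT I q (Fe e) l [::].
  by rewrite ErZ Er_Vr // Er1 mulr1.
rewrite (_ : kap * (w_ I e * p_ I e * q e) = w_ I e * (q e * p_ I e * kap)); last by ring.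
apply: (ler_wpM2l (w_ge0 W e)); exact: (edge_ge W d01 q0d (ltn_ord e) cm ct K1 K2 Hs).
Qed.

Lemma cancel_scale_mul (i c p z : rat) : z != 0 -> i * (c * z^-1 * p) * z = i * (p * c).
Proof. by move=> z0; field. Qed.
Lemma cancel_scale (i c z : rat) : z != 0 -> i * (c * z^-1) * z = i * c.
Proof. by move=> z0; field. Qed.
Lemma cancel_half (a R V h : rat) : h != 0 -> a / (2%:R * h) * V * (2%:R * h * R) = a * (R * V).
Proof. by move=> h0; field. Qed.

Section LPRounding.
Variables (I : instance) (h M kK kKK kHK kR kb A B : nat) (P C : nat -> nat).
Hypothesis wfI : wf_instance I.
Hypothesis m0 : (0 < nE I)%N.
Hypothesis hgt2 : (2 < h)%N.
Hypothesis KE : kK = (h * M)%N.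
Hypothesis KKE : kKK = (kK * kK)%N.
Hypothesis HKE : kHK = (h * M ^ 3 * kK)%N.
Hypothesis RE : kR%:R = 8%:R * h%:R ^+ 3 * M%:R ^+ 4 :> rat.
Hypothesis kbE : 2%:R ^+ kb = 2%:R * h%:R * kR%:R :> rat.
Hypothesis HM : (nV I + nE I < M)%N.
Hypothesis HAB : maxfrac (iPN I) (iPD I) (iWN I) (iWD I) A B (nE I).
Hypothesis HC : forall e, (e < nE I)%N -> goodC kK kHK (iPN I) (iPD I) (iWN I) (iWD I) A B e (C e).
Hypothesis HP : forall e, (e < nE I)%N -> goodP kK (iPN I) (iPD I) e (P e).

Let Un := iUn wfI.
Let Vn := iVn wfI.
Let UV := iUV wfI.
Let PNPD := iPNPD wfI.
Let WD0 := @iWD_gt0 I.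
Let T0 : forall v, (v < nV I)%N -> (0 < t_ I v)%N := fun v Hv => wf_tmo wfI Hv.

Local Notation cnt := ((iter kR (lpstep (nE I) kK kKK (iU I) (iV I) (t_ I) P C)
  ((fun=> 0%N, fun=> 0%N, fun=> 0%N) : lpst)).2).
Definition lp_q (c : nat -> nat) (e : nat) : rat := (c e)%:R / 2%:R ^+ kb.
Local Notation q := (lp_q cnt).
(** As [2 ^ kb = 2 h R], a probing probability is the fraction [cnt e / R] divided by [2 h], which
    is 1024 for [h = 512]. The numerator is the overshoot of the constraints. *)
Definition lp_d : rat := (1 + 2%:R / h%:R) / (2%:R * h%:R).

Let h0 : (0 : rat) < h%:R. Proof. by rewrite ltr0n; lia. Qed.
Let R0 : (0 : rat) < kR%:R.
Proof.
have M0 : (0 : rat) < M%:R by rewrite ltr0n; lia.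
by rewrite RE; apply: mulr_gt0; [apply: mulr_gt0; [|apply: exprn_gt0]|apply: exprn_gt0].
Qed.
Let Z0 : (0 : rat) < 2%:R ^+ kb. Proof. by rewrite exprn_gt0. Qed.

Let qE e : q e = (cnt e)%:R * (2%:R ^+ kb)^-1. Proof. by []. Qed.
Let dE : lp_d * 2%:R ^+ kb = kR%:R * (1 + 2%:R / h%:R).
Proof. by rewrite kbE /lp_d; field; rewrite lt0r_neq0. Qed.

Lemma lp_cnt_le e : (cnt e)%:R <= kR%:R :> rat.
Proof. by eapply (@cnt_le (nV I) (nE I) M h); eassumption. Qed.

Lemma lp_q_bounds e : 0 <= q e <= lp_d.
Proof.
rewrite qE; apply/andP; split; first by rewrite mulr_ge0 ?ler0n ?invr_ge0 ?ltW.
rewrite ler_pdivrMr // dE; apply: (le_trans (lp_cnt_le e)).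
rewrite mulrDr mulr1 lerDl mulr_ge0 ?divr_ge0 ?ler0n //.
Qed.

Lemma lp_cnt_kb e : (cnt e <= 2 ^ kb)%N.
Proof.
rewrite -(@ler_nat rat) natrX; apply: (le_trans (lp_cnt_le e)); rewrite kbE.
rewrite -[leLHS]mul1r ler_wpM2r ?ler0n //.
by have : (2%:R : rat) < h%:R; [rewrite ltr_nat|lra].
Qed.

Let incE v e : incident I v e = incb (iU I) (iV I) v e. Proof. by []. Qed.

Let sum_inc v (F : nat -> rat) :
  \sum_(e < nE I | incident I v e) F e = \sum_(e < nE I) (incb (iU I) (iV I) v e)%:R * F e.
Proof.
rewrite big_mkcond; apply: eq_bigr => e _; rewrite incE.
by case: (incb _ _ _ _); rewrite ?mul1r ?mul0r.
Qed.

Let Zn : (2%:R ^+ kb : rat) != 0. Proof. exact: lt0r_neq0 Z0. Qed.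

Let prE (e : 'I_(nE I)) : pr (iPN I) (iPD I) e = p_ I e := esym (p_absE wfI (ltn_ord e)).

Lemma lp_capm v : (v < nV I)%N -> \sum_(e < nE I | incident I v e) q e * p_ I e <= lp_d.
Proof.
move=> Hv; have -> : \sum_(e < nE I | incident I v e) q e * p_ I e =
  \sum_(e < nE I) (incb (iU I) (iV I) v e)%:R * (q e * p_ I e) := sum_inc v (fun e => q e * p_ I e).
rewrite -(ler_pM2r Z0) dE mulr_suml.
have H : \sum_(e < nE I) (incb (iU I) (iV I) v e)%:R * (pr (iPN I) (iPD I) e * (cnt e)%:R)
  <= kR%:R * (1 + 2%:R / h%:R) by eapply (@load_matching (nV I) (nE I) M h); eassumption.
apply: le_trans H; apply: ler_sum => e _; rewrite prE qE (cancel_scale_mul _ _ _ Zn); exact: lexx.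
Qed.

Lemma lp_capt v : (v < nV I)%N -> \sum_(e < nE I | incident I v e) q e <= lp_d * (t_ I v)%:R.
Proof.
move=> Hv; have -> : \sum_(e < nE I | incident I v e) q e =
  \sum_(e < nE I) (incb (iU I) (iV I) v e)%:R * q e := sum_inc v q.
rewrite -(ler_pM2r Z0) [leRHS]mulrAC dE mulr_suml.
have H : \sum_(e < nE I) (incb (iU I) (iV I) v e)%:R * (cnt e)%:R
  <= kR%:R * (1 + 2%:R / h%:R) * (t_ I v)%:R :> rat.
  by eapply (@load_timeout (nV I) (nE I) M h); eassumption.
apply: le_trans H; apply: ler_sum => e _; rewrite qE (cancel_scale _ _ Zn); exact: lexx.
Qed.

Lemma lp_gain S : valid_strategy I S ->
  (1 - 2%:R / h%:R) / (2%:R * h%:R) * strat_value I S <= \sum_(e < nE I) w_ I e * p_ I e * q e.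
Proof.
move=> VS; rewrite (strat_valueE VS).
have vE (e : 'I_(nE I)) : vr (iPN I) (iPD I) (iWN I) (iWD I) e = w_ I e * p_ I e.
  by rewrite /vr prE -(w_absE wfI) mulrC.
have Hx : feasI (nV I) (nE I) (iU I) (iV I) (iPN I) (iPD I) (t_ I) (marg I S).
  split.
  - by move=> e _; apply: marg_bounds.
  - move=> v Hv; have H := marg_matching wfI VS v.
    have E : \sum_(e < nE I | incident I v e) p_ I e * marg I S e =
      \sum_(e < nE I) (incb (iU I) (iV I) v e)%:R * (p_ I e * marg I S e) :=
      sum_inc v (fun e => p_ I e * marg I S e).
    rewrite E in H; apply: le_trans H; apply: ler_sum => e _; rewrite prE; exact: lexx.
  - move=> v Hv; have H := marg_timeout wfI VS v.
    have E : \sum_(e < nE I | incident I v e) marg I S e =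
      \sum_(e < nE I) (incb (iU I) (iV I) v e)%:R * marg I S e := sum_inc v (marg I S).
    by rewrite E in H.
have H : (1 - 2%:R / h%:R) * (kR%:R * \sum_(e < nE I) vr (iPN I) (iPD I) (iWN I) (iWD I) e * marg I S e)
   <= \sum_(e < nE I) vr (iPN I) (iPD I) (iWN I) (iWD I) e * (cnt e)%:R.
  by eapply (@lp_value (nV I) (nE I) M h); eassumption.
have E1 : \sum_(e < nE I) vr (iPN I) (iPD I) (iWN I) (iWD I) e * marg I S e =
  \sum_(e < nE I) w_ I e * p_ I e * marg I S e by apply: eq_bigr => e _; rewrite vE.
have E2 : \sum_(e < nE I) vr (iPN I) (iPD I) (iWN I) (iWD I) e * (cnt e)%:R =
  (\sum_(e < nE I) w_ I e * p_ I e * q e) * 2%:R ^+ kb.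
  by rewrite mulr_suml; apply: eq_bigr => e _; rewrite vE qE (cancel_scale _ _ Zn).
rewrite E1 E2 in H; rewrite -(ler_pM2r Z0); apply: le_trans H.
rewrite kbE (cancel_half _ _ _ (lt0r_neq0 h0)); exact: lexx.
Qed.

Lemma lp_rounding S N kap Bc : valid_strategy I S -> 0 < lp_d < 1 -> 0 <= kap ->
  kap <= \sum_(k < N) (1 - lp_d / 2%:R) ^+ k *
    ((1 - lp_d) ^+ k.+1 * (1 - (k.+1%:R * (lp_d / (1 - lp_d))) ^+ 2)) ^+ 2 ->
  kap <= \sum_(k < N) (1 - lp_d) ^+ k * ((1 - lp_d) ^+ k.+1 *
    (1 - Num.max ((k.+1%:R * (lp_d / (1 - lp_d))) ^+ 2 / 8%:R) ((k.+1%:R * (lp_d / (1 - lp_d))) ^+ 3))) ^+ 2 ->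
  (forall k, (k <= N)%N -> 0 <= k%:R * (lp_d / (1 - lp_d)) <= 1) ->
  (size (flatten (nseq N (iota 0 (nE I)))) * kb <= Bc)%N ->
  kap * ((1 - 2%:R / h%:R) / (2%:R * h%:R)) * strat_value I S <=
  Er I (fun r => Ec Bc (fun cs =>
    hvalue I (proc I cnt kb r (nth false cs) 0 (flatten (nseq N (iota 0 (nE I)))) [::]))).
Proof.
move=> VS d01 k0 K1 K2 Hs HB.
apply: le_trans (rounding_value (q := q) wfI d01 (fun e _ => lp_cnt_kb e) (fun=> erefl)
  (fun e _ => lp_q_bounds e) lp_capm lp_capt K1 K2 Hs HB).
by rewrite -mulrA; apply: (ler_wpM2l k0); apply: lp_gain.
Qed.

End LPRounding.

Lemma strat_value_ge0 I S : wf_instance I -> valid_strategy I S -> 0 <= strat_value I S.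
Proof.
move=> W VS; rewrite (strat_valueE VS); apply: sumr_ge0 => e _.
have /andP[m0 _] := marg_bounds S W e; have /andP[p0 _] := p_bounds W (ltn_ord e).
by rewrite !mulr_ge0 ?w_ge0 // ltW.
Qed.

Lemma alg_correct e1 N kap d : (1 < e1)%N -> d = lp_d (2 ^ e1) -> 0 < d < 1 -> 0 <= kap ->
  kap <= \sum_(k < N) (1 - d / 2%:R) ^+ k *
    ((1 - d) ^+ k.+1 * (1 - (k.+1%:R * (d / (1 - d))) ^+ 2)) ^+ 2 ->
  kap <= \sum_(k < N) (1 - d) ^+ k * ((1 - d) ^+ k.+1 *
    (1 - Num.max ((k.+1%:R * (d / (1 - d))) ^+ 2 / 8%:R) ((k.+1%:R * (d / (1 - d))) ^+ 3))) ^+ 2 ->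
  (forall k, (k <= N)%N -> 0 <= k%:R * (d / (1 - d)) <= 1) ->
  exists (P : program) (c k : nat), forall I : instance, wf_instance I ->
    let B := (c * (input_size I).+1 ^ k)%N in
    (forall (r : (nE I).-tuple bool) (coins : nat -> bool), good_run P I r coins B) /\
    (forall S : strategy, valid_strategy I S ->
      kap * ((1 - 2%:R / (2 ^ e1)%:R) / (2%:R * (2 ^ e1)%:R)) * strat_value I S <= alg_value P I B).
Proof.
move=> e1gt dE d01 k0 K1 K2 Hs; have [c [k Hck]] := polyb_Cz e1 N.
exists (alg e1 N), c, k => I W B; have HB : (Cz e1 N (input_size I) <= B)%N := Hck I W.
clearbody B.
case: (posnP (nE I)) => [E0|m0].
  have HW := alg_halts_empty e1 N E0; split=> [r coins|S VS].
    by rewrite /good_run; have [st -> [H1 H2]] := halts_run HW HB r coins; split; [exact: H1|rewrite H2].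
  rewrite (alg_valueE HW HB) (strat_valueE VS) big1 ?mulr0; last first.
    by move=> e _; have := ltn_ord e; rewrite {2}E0.
  apply: sumr_ge0 => r _; apply: mulr_ge0; first exact: real_prob_ge0.
  by rewrite /hvalue big_nil Ec_const.
have [a [A [B' [P [C [[D1 D2 D3 D4 D5] HW]]]]]] := alg_halts e1 N W m0.
split=> [r coins|S VS].
  rewrite /good_run; have [st -> [H1 H2]] := halts_run HW HB r coins; split; first exact: H1.
  by rewrite H2; apply: legal_proc.
rewrite (alg_valueE HW HB).
have TB : (size (flatten (nseq N (iota 0 (nE I)))) * (4 * e1 + 4 + 4 * a) <= B)%N.
  have X : (size (flatten (nseq N (iota 0 (nE I)))) * (4 * e1 + 4 + 4 * a) <= Tz e1 N (input_size I))%N.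
    by first [exact: (coins_bound e1 N W D2) | apply: coins_bound | eapply coins_bound; eassumption].
  have Y : (Tz e1 N (input_size I) <= Cz e1 N (input_size I))%N by rewrite /Cz; apply: leq_addl.
  exact: leq_trans X (leq_trans Y HB).
have hgt2 : (2 < 2 ^ e1)%N.
  by have := ltn_exp2l 1 e1 (ltnSn 1); rewrite e1gt expn1.
have KE : (2 ^ (e1 + a) = 2 ^ e1 * 2 ^ a)%N by rewrite expnD.
have KKE : (2 ^ (2 * e1 + 2 * a) = 2 ^ (e1 + a) * 2 ^ (e1 + a))%N.
  by rewrite -expnD; congr expn; lia.
have HKE : (2 ^ (2 * e1 + 4 * a) = 2 ^ e1 * (2 ^ a) ^ 3 * 2 ^ (e1 + a))%N.
  by rewrite -expnM -!expnD; congr expn; lia.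
have RE : (2 ^ (3 * e1 + 3 + 4 * a))%:R = 8%:R * (2 ^ e1)%:R ^+ 3 * (2 ^ a)%:R ^+ 4 :> rat.
  rewrite !natrX (mulnC 3%N) (mulnC 4%N) !exprD !exprM.
  by move: (2%:R ^+ e1) (2%:R ^+ a) => x y; ring.
have kbE : 2%:R ^+ (4 * e1 + 4 + 4 * a) = 2%:R * (2 ^ e1)%:R * (2 ^ (3 * e1 + 3 + 4 * a))%:R :> rat.
  by rewrite !natrX -exprS -exprD; congr (_ ^+ _); lia.
subst d.
rewrite /alg_hist /lp_count.
exact: (lp_rounding W m0 hgt2 KE KKE HKE RE kbE D1 D3 D4 D5 VS d01 k0 K1 K2 Hs TB).
Qed.
End Value.
Export Value.

(** * The choice [h = 512] with 1000 rounds *)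

Local Open Scope ring_scope.

Lemma dz_lp : dz = lp_d (2 ^ 9).
Proof. rewrite /lp_d dzE; have -> : (2 ^ 9)%N = 512%N by []; lra. Qed.

Lemma dz_lt1 : 0 < dz < 1.
Proof. by have /andP[h1 h2] := dz_bounds; apply/andP; split; lra. Qed.

Lemma ratio_bound :
  269%:R / 1000%:R <= 277%:R * ((1 - 2%:R / (2 ^ 9)%:R) / (2%:R * (2 ^ 9)%:R)) :> rat.
Proof. by have -> : (2 ^ 9)%N = 512%N by []; lra. Qed.

Theorem theorem2 :
  exists (P : program) (c k : nat),
    forall I : instance, wf_instance I ->
      let B := (c * (input_size I).+1 ^ k)%N in
      (forall (r : (nE I).-tuple bool) (coins : nat -> bool), good_run P I r coins B) /\
      (forall S : strategy, valid_strategy I S ->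
         (269%:R / 1000%:R) * strat_value I S <= alg_value P I B).
Proof.
have [P [c [k H]]] :=
  @alg_correct 9 1000 277%:R dz isT dz_lp dz_lt1 (ler0n _ _) rounds1 rounds2 sk_le1.
exists P, c, k => I W B; have [H1 H2] := H I W; split; first exact: H1.
move=> S VS; apply: le_trans (H2 S VS).
exact: (ler_wpM2r (strat_value_ge0 W VS) ratio_bound).
Qed.
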